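(* Let $\xi_1,\xi_2,\ldots$ be i.i.d. complex-valued random variables, fix a deterministic $u_0\in\mathbb{C}$, and let $P_n(z)=(z-u_0)\prod_{k=1}^n(z-\xi_k)$. Assume that on a sufficiently small disk around $u_0$ the random variables $\xi_k$ have a Lebesgue density $p$ that is continuous at $u_0$ (outside this disk the distribution may be arbitrary). Let the Cauchy--Stieltjes transform $f(z)=\mathbb{E}\left[\frac{1}{z-\xi_1}\right]$ satisfy $f(u_0)\neq 0$. Let $r_1,r_2,\ldots>0$ be a sequence satisfying $\lim_{n\to\infty}n r_n=+\infty$ and $\lim_{n\to\infty}\sqrt{n}\,r_n=0$. Then: (a) The probability that $P_n$ has exactly one critical point in the disk $\bar{\mathbb{B}}_{r_n}(u_0)$ converges to $1$: $$\lim_{n\to\infty}\mathbb{P}\left[\text{there is a unique }\zeta\in\bar{\mathbb{B}}_{r_n}(u_0)\text{ such that }P_n'(\zeta)=0\right]=1.$$ (b) Denoting this critical point by $\zeta_n$, if it exists uniquely, and defining $\zeta_n$ arbitrarily otherwise, we have $$f^2(u_0)\sqrt{\frac{n}{\log n}}\left(n(\zeta_n-u_0)+\frac{1}{f(u_0)}\right)\ \longrightarrow\ \mathcal{N}_{\mathbb{C}}(0,\pi p(u_0))$$ in distribution as $n\to\infty$.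
   Context: $\bar{\mathbb{B}}_r(u)=\{z\in\mathbb{C}\colon |z-u|\le r\}$ is the closed disk. The critical points of a polynomial $P$ are the complex zeroes of $P'$. The Cauchy--Stieltjes transform $f(z)=\mathbb{E}\left[\frac{1}{z-\xi_1}\right]$ is defined for those $z\in\mathbb{C}$ for which $\mathbb{E}\left|\frac{1}{z-\xi_1}\right|<\infty$; under the stated hypotheses on the density it exists finitely at $u_0$. $f^2(u_0)$ means $(f(u_0))^2$. $\mathcal{N}_{\mathbb{C}}(0,\sigma^2)$, $\sigma^2\ge 0$, denotes the complex normal distribution of a random variable $X$ such that $\mathrm{Re}\,X$ and $\mathrm{Im}\,X$ are independent real centered Gaussian variables, each with variance $\sigma^2/2$ (for $\sigma^2=0$, $X=0$ a.s.). *)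

(* Defs.v *)
From HB Require Import structures.
From mathcomp Require Import all_boot all_order all_algebra finmap.
From mathcomp Require Import complex.
From mathcomp Require Import all_classical all_reals all_analysis.

Set Implicit Arguments.
Unset Strict Implicit.
Unset Printing Implicit Defensive.

Import Order.TTheory GRing.Theory Num.Theory.
Import numFieldNormedType.Exports.

Local Open Scope classical_set_scope.
Local Open Scope complex_scope.
Local Open Scope ring_scope.

Section complex_measurable.
Variable R : realType.

(* measurableTypeR R is R with the display used by lebesgue_measure and       *)
(* normal_prob.                                                              *)
Local Notation R2 := (measurableTypeR R * measurableTypeR R)%type.

Definition reim (z : R[i]) : R2 := (complex.Re z, complex.Im z).
Definition of_reim (x : R2) : R[i] := (x.1 : R) +i* (x.2 : R).

HB.instance Definition _ := isPointed.Build R[i] 0.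

(* The Borel sigma-algebra of the complex plane, i.e. that of R * R.         *)
Definition complex_measurable : set (set R[i]) :=
  preimage_set_system setT reim measurable.

Let cm_sigma : sigma_algebra setT complex_measurable.
Proof. exact/sigma_algebra_preimage/sigma_algebra_measurable. Qed.

Let cm0 : complex_measurable set0.
Proof. by case: cm_sigma. Qed.

Let cmC A : complex_measurable A -> complex_measurable (~` A).
Proof. by case: cm_sigma => _ + _ => /[apply]; rewrite setTD. Qed.

Let cmU (F : (set R[i])^nat) : (forall i, complex_measurable (F i)) ->
  complex_measurable (\bigcup_i F i).
Proof. by case: cm_sigma => _ _; exact. Qed.

HB.instance Definition _ := @isMeasurable.Build (preimage_display reim)
  R[i] complex_measurable cm0 cmC cmU.

Lemma measurable_of_reim : measurable_fun setT of_reim.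
Proof.
move=> _ _ [B mB <-]; rewrite !setTI.
by rewrite (_ : _ @^-1` _ = B)//; apply/seteqP; split=> -[].
Qed.

HB.instance Definition _ :=
  isMeasurableFun.Build _ _ _ _ of_reim measurable_of_reim.

Definition complex_lebesgue : set R[i] -> \bar R :=
  pushforward ((@lebesgue_measure R) \x (@lebesgue_measure R))%E of_reim.

Let of_reim_preimage A : measurable A -> measurable (of_reim @^-1` A).
Proof.
by move=> mA; rewrite -[X in measurable X]setTI; exact: measurable_of_reim.
Qed.

Let complex_lebesgue0 : complex_lebesgue set0 = 0%E.
Proof. by rewrite /complex_lebesgue /pushforward preimage_set0 measure0. Qed.

Let complex_lebesgue_ge0 A : (0 <= complex_lebesgue A)%E.
Proof. by rewrite /complex_lebesgue /pushforward; exact: measure_ge0. Qed.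

Let complex_lebesgue_sigma_additive : semi_sigma_additive complex_lebesgue.
Proof.
move=> F mF tF mUF; rewrite /complex_lebesgue /pushforward preimage_bigcup.
apply: measure_semi_sigma_additive => //.
- by move=> n; exact: of_reim_preimage.
- apply/trivIsetP => /= i j _ _ ij; rewrite -preimage_setI.
  by move/trivIsetP : tF => /(_ _ _ _ _ ij) ->//; rewrite preimage_set0.
- by rewrite -preimage_bigcup; exact: of_reim_preimage.
Qed.

HB.instance Definition _ := isMeasure.Build _ _ _ complex_lebesgue
  complex_lebesgue0 complex_lebesgue_ge0 complex_lebesgue_sigma_additive.

(* normal_prob is parameterized by the standard deviation; with deviation 0  *)
(* it is not the Dirac mass at 0, hence the case distinction.                *)
Definition centered_gaussian (v : R) : probability (measurableTypeR R) R :=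
  if v == 0 then \d_(0 : measurableTypeR R) : probability (measurableTypeR R) R
  else normal_prob 0 (Num.sqrt v).

Definition complex_normal (s2 : R) : probability R[i] R :=
  distribution (centered_gaussian (s2 / 2) \x centered_gaussian (s2 / 2))%E
    of_reim.

Definition closed_disk (u : R[i]) (r : R) : set R[i] :=
  [set z | `|z - u| <= r%:C].

(* Both mu and p may be arbitrary outside D.                                 *)
Definition has_density_on (D : set R[i]) (mu : set R[i] -> \bar R)
    (p : R[i] -> R) : Prop :=
  [/\ measurable_fun D p, (forall z, D z -> 0 <= p z) &
      forall A, measurable A -> A `<=` D ->
        mu A = (\int[complex_lebesgue]_(z in A) (p z)%:E)%E].

(* Sequences start at 0: xi k stands for the (k + 1)-th random zero.         *)
Definition poly_with_zeros (u0 : R[i]) (xi : nat -> R[i]) (n : nat) :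
    {poly R[i]} :=
  ('X - u0%:P) * \prod_(k < n) ('X - (xi k)%:P).

Definition is_critical_point (Q : {poly R[i]}) (z : R[i]) : Prop :=
  Q^`().[z] = 0.

Definition critical_in_disk (Q : {poly R[i]}) (u : R[i]) (r : R) (z : R[i]) :
    Prop :=
  closed_disk u r z /\ is_critical_point Q z.

Section random.
Context d (T : measurableType d) (P : probability T R).

Definition complex_expectation (X : T -> R[i]) : R[i] :=
  (\int[P]_w complex.Re (X w))%R +i* (\int[P]_w complex.Im (X w))%R.

(* Meaningful only where E |1 / (z - X)| < oo. Since 0^-1 = 0, a positive    *)
(* mass of X at z would go unnoticed; a density around z excludes it.        *)
Definition cauchy_stieltjes (X : T -> R[i]) (z : R[i]) : R[i] :=
  complex_expectation (fun w => (z - X w)^-1).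

Definition mutually_independent d' (S : measurableType d')
    (X : nat -> {RV P >-> S}) : Prop :=
  forall (J : {fset nat}) (B : nat -> set S),
    (forall k, k \in J -> measurable (B k)) ->
    P (\bigcap_(k in [set` J]) (X k @^-1` B k)) =
    (\prod_(k <- J) P (X k @^-1` B k))%E.

Definition identically_distributed d' (S : measurableType d')
    (X : nat -> {RV P >-> S}) : Prop :=
  forall k (A : set S), measurable A ->
    distribution P (X k) A = distribution P (X 0%N) A.

(* R[i]^o carries the topology of the complex modulus.                       *)
Definition cvg_in_distribution (X : nat -> T -> R[i])
    (mu : probability R[i] R) : Prop :=
  forall g : R[i] -> R, continuous (g : R[i]^o -> R) ->
    (exists M, forall z, `|g z| <= M) ->
    (\int[P]_w g (X n w))%R @[n --> \oo] --> (\int[mu]_z g z)%R.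

End random.
End complex_measurable.

(* Main.v *)
(* Away from the zeros, P_n' vanishes exactly when z = u0 - 1 / S_n(z), where
   S_n(z) is the sum of the 1 / (z - xi_k). With high probability no xi_k lies
   within 2 r_n of u0, S_n(u0) is close to n f(u0), and the sum of the
   |u0 - xi_k|^-2 is at most n (ln n)^2. The map z |-> u0 - 1 / S_n(z) is then a
   contraction of the disk, whence a unique critical point, and
   S_n(zeta_n) - S_n(u0) is negligible. What remains of the normalized critical
   point is (S_n(u0) - n f(u0)) / sqrt (n ln n), a centered i.i.d. sum: the
   density at u0 gives 1 / |u0 - xi_k| a tail of order t^-2, so the second
   moments truncated at height sqrt (n ln n) grow like ln n, with coefficient
   pi p(u0) / 2 for each of the real and imaginary parts. The Gaussian limit
   follows from Lindeberg replacement in operator form, tested against products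
   of cubic B-splines, whose combinations approximate all bounded continuous
   functions on compact sets. *)
Require Import Defs.
From HB Require Import structures.
From mathcomp Require Import all_boot all_order all_algebra finmap.
From mathcomp Require Import complex.
From mathcomp Require Import all_classical all_reals all_analysis.
From mathcomp Require Import measurable_realfun ring lra.

Set Implicit Arguments.
Unset Strict Implicit.
Unset Printing Implicit Defensive.

Import Order.TTheory GRing.Theory Num.Theory.
Import numFieldNormedType.Exports.
Local Open Scope classical_set_scope.
Local Open Scope complex_scope.
Local Open Scope ring_scope.

(** * Averaging operators and random walks *)

(** When p(u0) > 0 the summands 1 / (u0 - xi_k) have infinite variance, so no second moment over the
    whole space may appear. They are centered by their full mean, which makes the linear Taylor
    terms vanish exactly; only the quadratic terms are truncated, to the outside of a disk of radius
    2 / sqrt (n ln n). Inside that disk n E [1 + |A| + |B|] is O(1 / ln n), where A and B are the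
    scaled coordinates. The variance comes from the integral of |v|^-2 over an annulus, 2 pi ln (b /
    a): each coordinate receives half of it, and the logarithm of the inverse cutoff is equivalent
    to (ln n) / 2, which leaves pi p(u0) / 2. Laws of sums are handled as iterated transition
    operators, whose Gaussian iterates collapse by the semigroup property, so characteristic
    functions do not occur. The event of a unique critical point must also be shown measurable; this
    rests on compactness of the disk and on countable separation of distinct critical points. *)

Section indicator.
Context (T : Type) (D : set T).

Lemma indic_mem v (R : realType) : D v -> \1_D v = 1 :> R.
Proof. by move=> Dv; rewrite indicE mem_set. Qed.

Lemma indic_nmem v (R : realType) : ~ D v -> \1_D v = 0 :> R.
Proof. by move=> Dv; rewrite indicE memNset. Qed.

Lemma indic_ge0 v (R : realType) : 0 <= \1_D v :> R.
Proof. by rewrite indicE. Qed.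

End indicator.
Arguments indic_mem {T D v R}.
Arguments indic_nmem {T D v R}.

(** * Bounded measurable functions and Fubini's theorem *)

Section bounded_measurable.
Context d (T : measurableType d) (R : realType).

Definition bounded_measurable (f : T -> R) :=
  measurable_fun setT f /\ exists M, forall x, `|f x| <= M.

Lemma bounded_measurable_cst c : bounded_measurable (cst c).
Proof. by split; [exact: measurable_cst|exists `|c|]. Qed.

Lemma bounded_measurableB f g : bounded_measurable f -> bounded_measurable g ->
  bounded_measurable (fun x => f x - g x).
Proof.
move=> [mf [M fM]] [mg [N gN]]; split; first exact: measurable_funB.
by exists (M + N) => x; rewrite (le_trans (ler_normB _ _))// lerD.
Qed.

Lemma bounded_measurableM f g : bounded_measurable f -> bounded_measurable g ->
  bounded_measurable (fun x => f x * g x).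
Proof.
move=> [mf [M fM]] [mg [N gN]]; split; first exact: measurable_funM.
by exists (M * N) => x; rewrite normrM ler_pM.
Qed.

Variable P : probability T R.

Lemma bounded_measurable_integrable f :
  bounded_measurable f -> P.-integrable setT (EFin \o f).
Proof.
move=> [mf [M fM]]; apply: measurable_bounded_integrable => //.
  by rewrite (@le_lt_trans _ _ 1%E) ?ltry// probability_le1.
by exists M; split; [exact: num_real|move=> x Mx y _; exact: le_trans (fM y) (ltW Mx)].
Qed.

Lemma Rintegral_prob_cst c : \int[P]_x c = c.
Proof.
rewrite Rintegral_cst// -[RHS]mulr1; congr (_ * _).
rewrite -[RHS]/(fine 1%E); congr fine; exact: probability_setT.
Qed.

Lemma normr_Rintegral_le (f : T -> R) M : measurable_fun setT f ->
  (forall x, `|f x| <= M) -> `|\int[P]_x f x| <= M.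
Proof.
move=> mf fM.
have bf : bounded_measurable f by split=> //; exists M.
apply: (le_trans (le_normr_Rintegral _ _)) => //.
  exact: bounded_measurable_integrable.
rewrite -[leRHS]Rintegral_prob_cst; apply: le_Rintegral => //.
- apply: bounded_measurable_integrable; split.
    exact: measurableT_comp.
  by exists M => x; rewrite normr_id.
- by apply: bounded_measurable_integrable; exact: bounded_measurable_cst.
Qed.

End bounded_measurable.

Section fubini_bounded.
Context d1 d2 (S1 : measurableType d1) (S2 : measurableType d2) (R : realType).
Variables (m1 : probability S1 R) (m2 : probability S2 R).
Variable f : S1 * S2 -> R.
Hypothesis bf : bounded_measurable f.

Lemma bounded_measurable_xsection x : bounded_measurable (fun y => f (x, y)).
Proof.
case: bf => mf [M fM]; split; last by exists M.
exact: measurableT_comp.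
Qed.

Lemma bounded_measurable_ysection y : bounded_measurable (fun x => f (x, y)).
Proof.
case: bf => mf [M fM]; split; last by exists M.
exact: measurableT_comp.
Qed.

Let FE x : (\int[m2]_y f (x, y))%:E = (\int[m2]_y (f (x, y))%:E)%E.
Proof.
rewrite fineK//; apply: integrable_fin_num => //.
by apply: bounded_measurable_integrable; exact: bounded_measurable_xsection.
Qed.

Lemma bounded_measurable_Rintegral :
  bounded_measurable (fun x => \int[m2]_y f (x, y)).
Proof.
have [mf [M fM]] := bf; split; last first.
  exists M => x; apply: normr_Rintegral_le => //.
  by have [] := bounded_measurable_xsection x.
(* Adding [M] makes the integrand nonnegative, so that Tonelli's measurability statement applies. *)
have -> : (fun x => \int[m2]_y f (x, y)) =
    (fun x => fine (\int[m2]_y (f (x, y) + M)%:E)%E - M).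
  apply/funext => x; rewrite -[LHS](addrK M); congr (_ - _).
  rewrite -[X in _ + X](Rintegral_prob_cst m2) -RintegralD//.
  - apply: bounded_measurable_integrable.
    exact: bounded_measurable_xsection.
  - by apply: bounded_measurable_integrable; exact: bounded_measurable_cst.
apply: measurable_funB => //; apply: measurableT_comp => //.
apply: (@measurable_fun_fubini_tonelli_F _ _ _ _ _ m2 (fun z => (f z + M)%:E)).
- by apply/measurable_EFinP; exact: measurable_funD.
- by move=> z; rewrite lee_fin -lerBlDr sub0r; have := fM z; rewrite ler_norml => /andP[].
Qed.

Let intf : (m1 \x m2)%E.-integrable setT (EFin \o f).
Proof. exact: bounded_measurable_integrable. Qed.

Let GE y : (\int[m1]_x f (x, y))%:E = (\int[m1]_x (f (x, y))%:E)%E.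
Proof.
rewrite fineK//; apply: integrable_fin_num => //.
by apply: bounded_measurable_integrable; exact: bounded_measurable_ysection.
Qed.

Lemma Rintegral_fubini :
  \int[m1]_x (\int[m2]_y f (x, y)) = \int[m2]_y (\int[m1]_x f (x, y)).
Proof.
rewrite /Rintegral; congr fine.
under eq_integral do rewrite FE.
under [RHS]eq_integral do rewrite GE.
exact: (Fubini intf).
Qed.

Lemma Rintegral_prod :
  \int[(m1 \x m2)%E]_z f z = \int[m1]_x (\int[m2]_y f (x, y)).
Proof.
rewrite /Rintegral; congr fine.
under [RHS]eq_integral do rewrite FE.
by rewrite -(integral12_prod_meas1 intf).
Qed.

End fubini_bounded.

Section averaging.
Context d (V : measurableType d) (R : realType).

(** The transition operator of a walk whose steps have law [m] and move the state by [act]. *)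
Definition averaging d' (S : measurableType d') (m : probability S R)
    (act : V * S -> V) (F : V -> R) (x : V) : R :=
  \int[m]_s F (act (x, s)).

Section averaging_lemmas.
Context d' (S : measurableType d') (m : probability S R) (act : V * S -> V).
Hypothesis mact : measurable_fun setT act.
Local Notation A := (averaging m act).

Let bact (F : V -> R) : bounded_measurable F -> bounded_measurable (F \o act).
Proof.
move=> [mF [M FM]]; split; first exact: measurableT_comp.
by exists M => x; exact: FM.
Qed.

Lemma bounded_measurable_averaging F :
  bounded_measurable F -> bounded_measurable (A F).
Proof. by move=> bF; exact: (bounded_measurable_Rintegral m (bact bF)). Qed.

Lemma averaging_dist F G e : bounded_measurable F -> bounded_measurable G ->
  (forall x, `|F x - G x| <= e) -> forall x, `|A F x - A G x| <= e.
Proof.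
move=> bF bG FGe x; rewrite /averaging -RintegralB//; last 2 first.
- apply: bounded_measurable_integrable.
  exact: (bounded_measurable_xsection (bact bF)).
- apply: bounded_measurable_integrable.
  exact: (bounded_measurable_xsection (bact bG)).
apply: normr_Rintegral_le => // ; apply: measurable_funB.
- by have [] := bounded_measurable_xsection (bact bF) x.
- by have [] := bounded_measurable_xsection (bact bG) x.
Qed.

Lemma bounded_measurable_iter_averaging n F :
  bounded_measurable F -> bounded_measurable (iter n A F).
Proof.
by move=> bF; elim: n => //= n; exact: bounded_measurable_averaging.
Qed.

Lemma iter_averaging_dist n F G e : bounded_measurable F ->
  bounded_measurable G -> (forall x, `|F x - G x| <= e) ->
  forall x, `|iter n A F x - iter n A G x| <= e.
Proof.
move=> bF bG FG; elim: n => //= n ih; apply: averaging_dist => //;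
  exact: bounded_measurable_iter_averaging.
Qed.

End averaging_lemmas.

Section commuting.
Context d1 (S1 : measurableType d1) (m1 : probability S1 R)
  (act1 : V * S1 -> V).
Context d2 (S2 : measurableType d2) (m2 : probability S2 R)
  (act2 : V * S2 -> V).
Hypothesis mact1 : measurable_fun setT act1.
Hypothesis mact2 : measurable_fun setT act2.
Hypothesis actC : forall x s1 s2,
  act1 (act2 (x, s2), s1) = act2 (act1 (x, s1), s2).
Local Notation A := (averaging m1 act1).
Local Notation B := (averaging m2 act2).

Lemma averagingC F : bounded_measurable F -> A (B F) = B (A F).
Proof.
move=> [mF [M FM]]; apply/funext => x; rewrite /averaging.
have bG : bounded_measurable (fun s => F (act1 (act2 (x, s.2), s.1))).
  split; last by exists M.
  apply: (measurableT_comp mF); apply: (measurableT_comp mact1).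
  apply: measurable_fun_pair => //=.
  by apply: (measurableT_comp mact2); apply: measurable_fun_pair.
rewrite -(Rintegral_fubini m1 m2 bG)/=.
by apply: eq_Rintegral => s1 _; apply: eq_Rintegral => s2 _; rewrite actC.
Qed.

Lemma iter_averagingC n F : bounded_measurable F ->
  iter n A (B F) = B (iter n A F).
Proof.
move=> bF; elim: n => //= n ->; apply: averagingC.
exact: bounded_measurable_iter_averaging.
Qed.

(* Trotter's form of Lindeberg's replacement argument: the operators commute, *)
(* so their n-th powers differ on F by at most n times as much as they do.    *)
Lemma iter_averaging_replacement n F e : bounded_measurable F ->
  (forall x, `|A F x - B F x| <= e) ->
  forall x, `|iter n A F x - iter n B F x| <= n%:R * e.
Proof.
move=> bF ABe; have bA := bounded_measurable_averaging m1 mact1.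
have bB := bounded_measurable_averaging m2 mact2.
elim: n => [x|n ih x]; first by rewrite subrr normr0 mul0r.
rewrite iterSr iterS.
have -> : iter n A (A F) x - B (iter n B F) x =
    (iter n A (A F) x - iter n A (B F) x) +
    (B (iter n A F) x - B (iter n B F) x).
  by rewrite -iter_averagingC// addrA subrK.
rewrite -natr1 mulrDl mul1r [leRHS]addrC; apply: (le_trans (ler_normD _ _)); apply: lerD.
  apply: iter_averaging_dist => //; [exact: bA|exact: bB].
apply: averaging_dist => //; exact: bounded_measurable_iter_averaging.
Qed.

End commuting.
End averaging.

(** * Random walks with i.i.d. steps *)

Section random_walk.
Context d (T : measurableType d) (R : realType) (P : probability T R).
Context d' (S : measurableType d') (X : nat -> {RV P >-> S}).
Context d'' (V : measurableType d'') (act : V * S -> V) (x0 : V).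
Hypothesis indX : mutually_independent X.
Hypothesis idX : identically_distributed X.
Hypothesis mact : measurable_fun setT act.

Fixpoint walk n (w : T) : V :=
  if n is k.+1 then act (walk k w, X k w) else x0.

Let cylinder k (B : nat -> set S) : set T :=
  \bigcap_(j in [set j | (j < k)%N]) (X j @^-1` B j).

(** A pi-system generating the sigma-algebra of the first [k] variables. Independence is given for
    finite families of preimages and has to be extended to all events of the past. *)
Let cylinders k : set (set T) :=
  [set E | exists2 B : nat -> set S, (forall j, measurable (B j)) &
    E = cylinder k B].

Let cylindersT k : cylinders k setT.
Proof.
exists (fun=> setT) => //; rewrite /cylinder; apply/esym.
by rewrite bigcapT// => i _; rewrite preimage_setT.
Qed.

Let cylindersI k : setI_closed (cylinders k).
Proof.
move=> _ _ [B mB ->] [C mC ->]; exists (fun j => B j `&` C j).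
  by move=> j; exact: measurableI.
by rewrite /cylinder -bigcapI; apply: eq_bigcapr => j _; rewrite preimage_setI.
Qed.

Let measurable_cylinders k : cylinders k `<=` measurable.
Proof.
move=> _ [B mB ->]; apply: bigcap_measurableType.
by move=> j _; rewrite -[X in measurable X]setTI; exact: measurable_funP.
Qed.

Let index_below k : {fset nat} := [fset j in iota 0 k]%fset.

Let in_index_below k j : (j \in index_below k) = (j < k)%N.
Proof. by rewrite in_fset/= mem_iota add0n. Qed.

Let cylinderE k B : cylinder k B = \bigcap_(j in [set` index_below k]) (X j @^-1` B j).
Proof.
rewrite /cylinder; congr (\bigcap_(j in _) _).
by apply/seteqP; split=> j/=; rewrite in_index_below.
Qed.

Let cylinder_indep k B C : (forall j, measurable (B j)) -> measurable C ->
  P (cylinder k B `&` X k @^-1` C) = (P (cylinder k B) * P (X k @^-1` C))%E.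
Proof.
move=> mB mC; pose B' j := if j == k then C else B j.
have mB' j : measurable (B' j) by rewrite /B'; case: ifP.
have kk : k \notin index_below k by rewrite in_index_below ltnn.
have eB : (\prod_(j <- index_below k) P (X j @^-1` B' j) =
    \prod_(j <- index_below k) P (X j @^-1` B j))%E.
  apply: eq_big_seq => j jk; rewrite /B'; case: eqP => // jk'.
  by subst j; rewrite (negbTE kk) in jk.
rewrite cylinderE indX// muleC.
have := @indX (k |` index_below k)%fset B' (fun j _ => mB' j).
have B'k : B' k = C by rewrite /B' eqxx.
rewrite big_fsetU1//= eB B'k => <-; congr (P _).
rewrite set_fsetU1 bigcap_setU1 B'k setIC; congr (_ `&` _).
apply: eq_bigcapr => j /=; rewrite /B'; case: eqP => // -> kk'.
by rewrite (negbTE kk) in kk'.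
Qed.

(** For fixed [C] both sides are finite measures in [E], a restriction and a multiple of [P]. They
    agree on cylinders, hence on the sigma-algebra that the cylinders generate. *)
Let past_indep k E C : <<s cylinders k >> E -> measurable C ->
  P (E `&` X k @^-1` C) = (P E * P (X k @^-1` C))%E.
Proof.
move=> sE mC.
have mXC : measurable (X k @^-1` C).
  by rewrite -[Y in measurable Y]setTI; exact: measurable_funP.
have c0 : (0 <= fine (P (X k @^-1` C)))%R by exact: fine_ge0.
rewrite -[X in (_ * X)%E]fineK ?fin_num_measure//.
pose m2 := mscale (NngNum c0) P.
rewrite [RHS]muleC -[RHS]/(m2 E) -[LHS]/(mrestr P mXC E).
apply: (@g_sigma_algebra_measure_unique _ _ _ (cylinders k) _ (fun=> setT)) => //.
- by apply/seteqP; split=> // x _; exists 0%N.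
- move=> _ [B mB ->]; rewrite /mrestr /m2 /mscale/=.
  apply: etrans (cylinder_indep _ mB mC) _; rewrite muleC; congr (_ * _)%E.
  by rewrite fineK ?fin_num_measure.
- move=> _; apply: le_lt_trans (ltry 1).
  exact: (probability_le1 P (measurableI _ _ measurableT mXC)).
Qed.

Let measurable_cylinder1 k j : (j < k)%N ->
  measurable_fun (setT : set (g_sigma_algebraType (cylinders k))) (X j).
Proof.
move=> jk _ C mC; rewrite setTI; apply: sub_sigma_algebra.
exists (fun i => if i == j then C else setT); first by move=> i; case: ifP.
apply/seteqP; split=> [w Cw i _/=|w /(_ j jk)/=]; last by rewrite eqxx.
by case: eqP => // ->.
Qed.

Let walk_adapted k :
  measurable_fun (setT : set (g_sigma_algebraType (cylinders k))) (walk k).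
Proof.
elim: k => [|k ih] /=; first exact: measurable_cst.
apply: (measurableT_comp mact); apply: measurable_fun_pair; last first.
  exact: measurable_cylinder1.
move=> _ C mC; have := ih measurableT _ mC; rewrite !setTI.
apply: sub_sigma_algebra2 => _ [B mB ->].
exists (fun j => if j == k then setT else B j); first by move=> j; case: ifP.
apply/seteqP; split=> [w Bw j /=|w Bw j /= jk].
  rewrite ltnS leq_eqVlt; case: eqP => //= _; exact: Bw.
by have := Bw j (ltnW jk); case: eqP jk => // ->; rewrite ltnn.
Qed.

Lemma measurable_walk k : measurable_fun setT (walk k).
Proof.
elim: k => [|k ih] /=; first exact: measurable_cst.
by apply: (measurableT_comp mact); exact: measurable_fun_pair.
Qed.

Let walkRV k : {RV P >-> V} :=
  HB.pack (walk k) (isMeasurableFun.Build _ _ _ _ (walk k) (measurable_walk k)).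

Let walk_next k w := (walk k w, X k w).

Let measurable_walk_next k : measurable_fun setT (walk_next k).
Proof. by apply: measurable_fun_pair => //; exact: measurable_walk. Qed.

Let walk_nextRV k : {RV P >-> (V * S)%type} :=
  HB.pack (walk_next k)
   (isMeasurableFun.Build _ _ _ _ (walk_next k) (measurable_walk_next k)).

Let mu : probability S R := distribution P (X 0%N).

(** The state after [k] steps is a function of the first [k] variables, hence independent of [X k],
    and the joint law is a product measure. *)
Let law_walk_next k A : measurable A ->
  (distribution P (walkRV k) \x mu)%E A = distribution P (walk_nextRV k) A.
Proof.
move=> mA; apply: product_measure_unique => // B C mB mC.
rewrite /= /distribution /pushforward/= -[X in _ = (_ * X)%E](idX k)//.
rewrite /distribution /pushforward -past_indep//.
by have := @walk_adapted k measurableT B mB; rewrite setTI.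
Qed.

(** The last step is integrated first: being independent of the state it acts on, it replaces [F] by
    its average, to which the induction hypothesis applies. *)
Lemma Rintegral_walk n F : bounded_measurable F ->
  \int[P]_w F (walk n w) = iter n (averaging mu act) F x0.
Proof.
elim: n F => [|n ih] F bF; first by rewrite /= Rintegral_prob_cst.
rewrite iterSr -ih; last exact: bounded_measurable_averaging.
have [mF [M FM]] := bF.
have bFa : bounded_measurable (F \o act).
  by split; [exact: measurableT_comp|exists M => x; exact: FM].
transitivity (\int[distribution P (walk_nextRV n)]_z F (act z)).
  rewrite /Rintegral (@integral_distribution _ _ _ _ _ _ _ (EFin \o (F \o act)))//.
    by apply/measurable_EFinP; case: bFa.
  apply: bounded_measurable_integrable; split.
    exact: (measurableT_comp mF (measurable_walk n.+1)).
  by exists M => x; exact: FM.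
transitivity (\int[(distribution P (walkRV n) \x mu)%E]_z F (act z)).
  congr fine; apply: eq_measure_integral => A mA _; exact/esym/law_walk_next.
rewrite (Rintegral_prod _ _ bFa)/=.
have bG := bounded_measurable_averaging mu mact bF.
have [mG [N GN]] := bG.
rewrite /Rintegral (@integral_distribution _ _ _ _ _ _ _ (EFin \o averaging mu act F))//.
  by apply/measurable_EFinP.
apply: bounded_measurable_integrable; split.
  exact: (measurableT_comp mG (measurable_walk n)).
by exists N => x; exact: GN.
Qed.

End random_walk.

(** * B-splines and weak convergence *)

Section bspline.
Context (R : realType).
Implicit Types x h : R.

(* [psi1] and [psi2] play the role of the first two derivatives. *)
Definition taylor3 (psi psi1 psi2 : R -> R) (C : R) :=
  [/\ measurable_fun setT psi, measurable_fun setT psi1,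
    measurable_fun setT psi2,
    forall x, [/\ `|psi x| <= C, `|psi1 x| <= C & `|psi2 x| <= C] &
    forall x h, `|psi (x + h) - psi x - psi1 x * h - psi2 x * h ^+ 2 / 2|
      <= C * `|h| ^+ 3].

Let pos x : R := Num.max x 0.

(** The truncated power. Its second derivative [pos] is 1-Lipschitz, which gives a cubic Taylor
    remainder although the third derivative jumps at 0. *)
Let cube x : R := pos x ^+ 3 / 6.
Let cube1 x : R := pos x ^+ 2 / 2.
Let cube2 x : R := pos x.

Let cube_taylor x h :
  `|cube (x + h) - cube x - cube1 x * h - cube2 x * h ^+ 2 / 2| <= `|h| ^+ 3.
Proof.
rewrite /cube /cube1 /cube2 /pos -normrX.
case: (leP x 0) => x0; case: (leP (x + h) 0) => xh0.
- by rewrite !expr0n/= !mul0r !subr0 normr0.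
- have h0 : 0 < h by lra.
  rewrite !expr0n/= !mul0r !subr0 !ger0_norm ?divr_ge0 ?exprn_ge0//; try lra.
  have : (x + h) ^+ 3 <= h ^+ 3 by rewrite lerXn2r ?nnegrE; lra.
  have := exprn_ge0 3 (ltW h0); lra.
- have h0 : h < 0 by lra.
  have -> : 0 ^+ 3 / 6 - x ^+ 3 / 6 - x ^+ 2 / 2 * h - x * h ^+ 2 / 2 =
    (h ^+ 3 - (x + h) ^+ 3) / 6 by field.
  have a1 : 0 <= (- (x + h)) ^+ 3 by rewrite exprn_ge0//; lra.
  have a2 : (- (x + h)) ^+ 3 <= (- h) ^+ 3 by rewrite lerXn2r ?nnegrE; lra.
  have a3 : 0 <= (- h) ^+ 3 by rewrite exprn_ge0//; lra.
  have e t : (- t) ^+ 3 = - t ^+ 3 :> R by ring.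
  rewrite !e in a1 a2 a3.
  rewrite ler_norml ler0_norm; lra.
- have -> : (x + h) ^+ 3 / 6 - x ^+ 3 / 6 - x ^+ 2 / 2 * h - x * h ^+ 2 / 2 =
    h ^+ 3 / 6 by field.
  rewrite normrM normfV (@ger0_norm _ 6)//.
  have := normr_ge0 (h ^+ 3); lra.
Qed.

(** The fourth backward difference with unit step. Applied to the truncated power it yields the
    cardinal cubic B-spline with knots 0, 1, 2, 3, 4. *)
Definition diff4 (f : R -> R) x :=
  f x - 4 * f (x - 1) + 6 * f (x - 2) - 4 * f (x - 3) + f (x - 4).

Definition bspline x := diff4 cube x.
Definition bspline1 x := diff4 cube1 x.
Definition bspline2 x := diff4 cube2 x.

(** The third difference of the truncated power: a ramp from 0 on the negative axis to 1 beyond 3.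
    The spline is a difference of two shifted ramps, so sums of its integer translates telescope. *)
Let smooth_step x := cube x - 3 * cube (x - 1) + 3 * cube (x - 2) - cube (x - 3).

Let bspline_step x : bspline x = smooth_step x - smooth_step (x - 1).
Proof.
rewrite /bspline /diff4 /smooth_step.
have -> : x - 1 - 1 = x - 2 by ring.
have -> : x - 1 - 2 = x - 3 by ring.
have -> : x - 1 - 3 = x - 4 by ring.
by ring.
Qed.

Let sum_bspline_step (m : nat) x :
  \sum_(i < m) bspline (x - i%:R) = smooth_step x - smooth_step (x - m%:R).
Proof.
elim: m => [|m ih]; first by rewrite big_ord0 subr0 subrr.
rewrite big_ord_recr/= ih bspline_step -natr1.
have -> : x - (m%:R + 1) = x - m%:R - 1 by ring.
by ring.
Qed.

Lemma sum_bspline (m : nat) x : 3 <= x -> x <= m%:R ->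
  \sum_(i < m) bspline (x - i%:R) = 1.
Proof.
move=> x3 xm.
rewrite sum_bspline_step.
have -> : smooth_step (x - m%:R) = 0.
  rewrite /smooth_step /cube /pos; do 4 (case: leP => ?; last by lra).
  by rewrite expr0n/=; lra.
rewrite /smooth_step /cube /pos.
case: leP => ?; first by lra.
case: leP => ?; first by lra.
case: leP => ?; first by lra.
have [?|?] := leP (x - 3) 0; last by field.
have -> : x = 3 by lra.
by rewrite expr0n/=; field.
Qed.

Let cube_bounds (t : R) : 0 <= t -> t <= 1 ->
  [/\ 0 <= t ^+ 3, t ^+ 3 <= t ^+ 2, 0 <= t ^+ 2 & t ^+ 2 <= 1].
Proof.
by move=> t0 t1; rewrite ?exprn_ge0 ?ler_wiXn2l// exprn_ile1.
Qed.

Lemma bspline_support x : bspline x != 0 -> 0 < x < 4.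
Proof.
move=> /eqP; rewrite /bspline /diff4 /cube /pos => b0; apply/andP; split.
- rewrite ltNge; apply/negP => xle; apply: b0.
  do 5 (case: leP => ?; last by lra).
  by rewrite expr0n/=; lra.
- rewrite ltNge; apply/negP => xle; apply: b0.
  do 4 (case: leP => ?; first by lra).
  have [?|?] := leP (x - 4) 0; last by field.
  have -> : x = 4 by lra.
  by rewrite expr0n/=; field.
Qed.

Lemma bspline_ge0 x : 0 <= bspline x.
Proof.
have [->//|/bspline_support /andP[x0 x4]] := eqVneq (bspline x) 0.
rewrite /bspline /diff4 /cube /pos.
case: (leP x 0) => x0'; first by lra.
case: (leP (x - 4) 0) => x4'; last by lra.
case: (leP (x - 1) 0) => x1; case: (leP (x - 2) 0) => x2;
case: (leP (x - 3) 0) => x3; rewrite ?expr0n/=; try lra.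
(* On the four unit intervals the spline is a cubic in t = x, x - 1, 3 - x and 4 - x respectively,
   with t in [0, 1]; the last two choices reflect its symmetry about 2. *)
- have [] := @cube_bounds x; lra.
- have [] := @cube_bounds (x - 1); lra.
- have [] := @cube_bounds (3 - x); lra.
- have [] := @cube_bounds (4 - x); lra.
Qed.

Lemma bspline_bounds x :
  [/\ `|bspline x| <= 100, `|bspline1 x| <= 100 & `|bspline2 x| <= 100].
Proof.
rewrite /bspline /bspline1 /bspline2 /diff4 /cube /cube1 /cube2 /pos !ler_norml.
case: (leP x 0) => x0.
  case: (leP (x - 1) 0) => [?|]; last by lra.
  case: (leP (x - 2) 0) => [?|]; last by lra.
  case: (leP (x - 3) 0) => [?|]; last by lra.
  case: (leP (x - 4) 0) => [?|]; last by lra.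
  by rewrite expr0n/=; split; lra.
case: (leP (x - 4) 0) => x4; last first.
  case: (leP (x - 1) 0) => [|?]; first by lra.
  case: (leP (x - 2) 0) => [|?]; first by lra.
  case: (leP (x - 3) 0) => [|?]; first by lra.
  by split; lra.
case: (leP (x - 1) 0) => x1; case: (leP (x - 2) 0) => x2;
case: (leP (x - 3) 0) => x3; rewrite ?expr0n/=; try lra.
- by have [||? ? ? ?] := @cube_bounds x; [lra|lra|split; lra].
- by have [||? ? ? ?] := @cube_bounds (x - 1); [lra|lra|split; lra].
- by have [||? ? ? ?] := @cube_bounds (3 - x); [lra|lra|split; lra].
- by have [||? ? ? ?] := @cube_bounds (4 - x); [lra|lra|split; lra].
Qed.

Lemma taylor3_bspline : taylor3 bspline bspline1 bspline2 100.
Proof.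
have mpos c : measurable_fun setT (fun x => pos (x - c)).
  by apply: measurable_maxr => //; exact: measurable_funB.
have mdiff (f : R -> R) : (forall c, measurable_fun setT (fun x => f (x - c))) ->
    measurable_fun setT (diff4 f).
  move=> mf; have mf0 : measurable_fun setT f.
    by have := mf 0; under eq_fun do rewrite subr0.
  apply: measurable_funD => //; apply: measurable_funB; last exact: measurable_funM.
  apply: measurable_funD; last exact: measurable_funM.
  by apply: measurable_funB => //; exact: measurable_funM.
split.
- apply: mdiff => c; apply: measurable_funM => //; exact: measurable_funX.
- apply: mdiff => c; apply: measurable_funM => //; exact: measurable_funX.
- by apply: mdiff => c; exact: mpos.
- exact: bspline_bounds.
- move=> x h; rewrite /bspline /bspline1 /bspline2 /diff4.
  have ct c := @cube_taylor (x - c) h.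
  have e c : x + h - c = x - c + h by ring.
  rewrite !e; move: (cube_taylor x h) (ct 1) (ct 2) (ct 3) (ct 4).
  rewrite !ler_norml; lra.
Qed.

Let smooth_step_bounds x : 0 <= smooth_step x <= 1.
Proof.
rewrite /smooth_step /cube /pos.
case: (leP x 0) => x0.
  case: (leP (x - 1) 0) => [?|]; last by lra.
  case: (leP (x - 2) 0) => [?|]; last by lra.
  case: (leP (x - 3) 0) => [?|]; last by lra.
  by rewrite expr0n/=; lra.
case: (leP (x - 3) 0) => x3; last first.
  case: (leP (x - 1) 0) => [|?]; first by lra.
  case: (leP (x - 2) 0) => [|?]; first by lra.
  by apply/andP; split; lra.
case: (leP (x - 1) 0) => x1; case: (leP (x - 2) 0) => x2; rewrite ?expr0n/=; try lra.
- by have [||? ? ? ?] := @cube_bounds x; [lra|lra|apply/andP; split; lra].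
- have [||? ? ? ?] := @cube_bounds (x - 1); [lra|lra|].
  have ? : 0 <= (1 - (x - 1)) * (1 - (x - 1) ^+ 2) by rewrite mulr_ge0; lra.
  by apply/andP; split; lra.
- by have [||? ? ? ?] := @cube_bounds (3 - x); [lra|lra|apply/andP; split; lra].
Qed.

Lemma sum_bspline_le1 (m : nat) x : \sum_(i < m) bspline (x - i%:R) <= 1.
Proof.
rewrite sum_bspline_step.
have /andP[_ a] := smooth_step_bounds x.
have /andP[b _] := smooth_step_bounds (x - m%:R).
lra.
Qed.

(** The chain rule produces powers of [a] up to the third; (1 + |a|)^3 dominates all of them at
    once. *)
Lemma taylor3_scale psi psi1 psi2 C a b : 0 <= C -> taylor3 psi psi1 psi2 C ->
  taylor3 (fun x => psi (a * x - b)) (fun x => a * psi1 (a * x - b))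
    (fun x => a ^+ 2 * psi2 (a * x - b)) (C * (1 + `|a|) ^+ 3).
Proof.
move=> C0 [m0 m1 m2 bd tay].
have maff : measurable_fun setT (fun x : R => a * x - b).
  by apply: measurable_funB => //; exact: measurable_funM.
have a0 := normr_ge0 a.
have a1 : 1 <= (1 + `|a|) ^+ 3 by rewrite exprn_ege1// lerDl.
have a2 : `|a| <= (1 + `|a|) ^+ 3.
  by rewrite (@le_trans _ _ (1 + `|a|))// ?ler_eXnr// ?lerDr// lerDl.
have a3 : `|a| ^+ 2 <= (1 + `|a|) ^+ 3.
  rewrite (@le_trans _ _ ((1 + `|a|) ^+ 2))//; last by rewrite ler_weXn2l// lerDl.
  by rewrite lerXn2r ?nnegrE ?lerDr ?addr_ge0.
have a4 : `|a| ^+ 3 <= (1 + `|a|) ^+ 3.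
  by rewrite lerXn2r ?nnegrE ?lerDr ?addr_ge0.
split.
- exact: measurableT_comp.
- by apply: measurable_funM => //; exact: measurableT_comp.
- by apply: measurable_funM => //; exact: measurableT_comp.
- move=> x; have [b0 b1 b2] := bd (a * x - b); split.
  + by rewrite (le_trans b0)// ler_peMr.
  + by rewrite normrM mulrC ler_pM.
  + by rewrite normrM normrX mulrC ler_pM.
- move=> x h; have := tay (a * x - b) (a * h).
  have -> : a * x - b + a * h = a * (x + h) - b by ring.
  have -> : psi1 (a * x - b) * (a * h) = a * psi1 (a * x - b) * h by ring.
  have -> : psi2 (a * x - b) * (a * h) ^+ 2 / 2 =
    a ^+ 2 * psi2 (a * x - b) * h ^+ 2 / 2 by ring.
  move/le_trans; apply; rewrite normrM exprMn mulrA ler_wpM2r ?exprn_ge0//.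
  exact: ler_wpM2l.
Qed.

(** Instead of the mean value theorem: points at distance at most 1 are compared by the Taylor
    remainder, and for the others the uniform bound 2 C is enough. *)
Lemma taylor3_lipschitz psi psi1 psi2 C x y : taylor3 psi psi1 psi2 C ->
  `|psi y - psi x| <= 3 * C * `|y - x|.
Proof.
move=> [_ _ _ bd tay].
have C0 : 0 <= C by have [+ _ _] := bd x; exact: le_trans.
have [h1|h1] := leP `|y - x| 1; last first.
  have [b1 _ _] := bd x; have [b2 _ _] := bd y.
  apply: (le_trans (ler_normB _ _)); apply: (le_trans (lerD b2 b1)).
  nra.
have := tay x (y - x); rewrite subrKC; have [_ b1 b2] := bd x.
set h := y - x in h1 *; set u := psi y - psi x => tt.
have -> : u = (u - psi1 x * h - psi2 x * h ^+ 2 / 2) + (psi1 x * h + psi2 x * h ^+ 2 / 2).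
  by rewrite /u; ring.
apply: (le_trans (ler_normD _ _)).
have n0 := normr_ge0 h.
have t1 : `|psi1 x * h + psi2 x * h ^+ 2 / 2| <= C * `|h| + C * `|h|.
  apply: (le_trans (ler_normD _ _)); apply: lerD.
    by rewrite normrM ler_wpM2r.
  rewrite normrM normfV (@ger0_norm _ 2)// normrM normrX.
  apply: (@le_trans _ _ (`|psi2 x| * `|h| ^+ 2)).
    by rewrite ler_piMr ?mulr_ge0 ?exprn_ge0// invf_le1 ?ler1n.
  by rewrite ler_pM ?exprn_ge0// -[leRHS]expr1 ler_wiXn2l.
have t2 : C * `|h| ^+ 3 <= C * `|h|.
  by rewrite ler_wpM2l// -[leRHS]expr1 ler_wiXn2l.
lra.
Qed.
End bspline.

(** * Continuous functions and open sets of the plane *)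

Section plane.
Context (R : realType).
Local Notation mR := (measurableTypeR R).

(** Only the first point is confined to the square: it will be a grid point, while the second one is
    an arbitrary argument of [g]. *)
Lemma uniformly_continuous_on_square (g : R * R -> R) (L e : R) :
  continuous g -> 0 < e -> exists2 del : R, 0 < del &
    forall x y : R * R, `|x.1| <= L -> `|x.2| <= L ->
      `|x.1 - y.1| < del -> `|x.2 - y.2| < del -> `|g x - g y| < e.
Proof.
move=> cg e0; pose A := `[- L, L]%classic `*` `[- L, L]%classic : set (R * R).
have cA : compact A by apply: compact_setX; exact: segment_compact.
pose Q (del : R) (x : R * R) := forall y : R * R,
  `|x.1 - y.1| < del -> `|x.2 - y.2| < del -> `|g x - g y| < e.
have : \forall del \near (0 : R)^'+, A `<=` Q del.
  move/compact_near_coveringP : cA; apply => // x _.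
  have e20 : 0 < e / 2 by rewrite divr_gt0.
  have /cvgrPdist_lt /(_ _ e20) /nbhs_ballP[r /= r0 xr] := cg x.
  have r20 : 0 < r / 2 by rewrite divr_gt0.
  exists (ball x (r / 2), [set del | 0 < del < r / 2]) => /=.
    split; first exact: nbhsx_ballx.
    near=> del => /=; apply/andP; split; first by near: del; exact: nbhs_right_gt.
    by near: del; exact: nbhs_right_lt.
  move=> [z del] /= [[xz1 xz2] /andP[del0 delr]] y zy1 zy2.
  rewrite /ball/= in xz1 xz2.
  have h1 : `|g x - g z| < e / 2.
    by apply: xr; split; rewrite /ball/= (lt_trans xz1, lt_trans xz2)// ltr_pdivrMr// ltr_pMr// ltr1n.
  have h2 : `|g x - g y| < e / 2.
    apply: xr; split; rewrite /ball/= (splitr r).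
      by rewrite -(subrKA z.1) (le_lt_trans (ler_normD _ _))// ltrD// (lt_trans zy1).
    by rewrite -(subrKA z.2) (le_lt_trans (ler_normD _ _))// ltrD// (lt_trans zy2).
  rewrite -(subrKA (g x)) (le_lt_trans (ler_normD _ _))//.
  by rewrite (splitr e) ltrD// distrC.
move=> nQ; near (0 : R)^'+ => del.
have QA : A `<=` Q del by near: del.
exists del => [|x y x1 x2]; first by near: del; exact: nbhs_right_gt.
by apply: QA; split=> /=; rewrite in_itv/= -ler_norml.
Unshelve. all: by end_near. Qed.

(** An open set is the union of the balls with rational center and radius 1 / (m + 1) that it
    contains. Balls are products of intervals, so this links the product topology with the product
    sigma-algebra. *)
Lemma open_plane_measurable (U : set (R * R)) :
  open U -> measurable (U : set (mR * mR)).
Proof.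
move=> oU.
pose box (t : rat * rat * nat) : set (mR * mR) :=
  ball (ratr t.1.1 : R) (t.2.+1%:R^-1) `*` ball (ratr t.1.2 : R) (t.2.+1%:R^-1).
have -> : U = \bigcup_(t : rat * rat * nat)
    (if pselect (box t `<=` U) then box t else set0).
  apply/seteqP; split=> [x Ux|x [t _]]; last by case: pselect => // bU; exact: bU.
  have /nbhs_ballP[r /= r0 xr] := open_nbhs_nbhs (conj oU Ux).
  pose n := Num.trunc (2 / r).
  have nr : n.+1%:R^-1 < r / 2.
    rewrite -[ltRHS]invrK ltf_pV2 ?posrE ?invr_gt0 ?divr_gt0//.
    by rewrite invf_div truncnS_gt.
  have n0 : 0 < n.+1%:R^-1 :> R by rewrite invr_gt0.
  have lt2 (a b : R) : 0 < b -> a - b < a + b by move=> *; lra.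
  have [q1 q1x] : exists q : rat, ratr q \in `]x.1 - n.+1%:R^-1, x.1 + n.+1%:R^-1[.
    by apply: rat_in_itvoo; exact: lt2.
  have [q2 q2x] : exists q : rat, ratr q \in `]x.2 - n.+1%:R^-1, x.2 + n.+1%:R^-1[.
    by apply: rat_in_itvoo; exact: lt2.
  move: q1x q2x; rewrite !in_itv/= => /andP[? ?] /andP[? ?].
  have b1 : ball (ratr q1 : R) n.+1%:R^-1 x.1 by rewrite /ball/= ltr_distl; apply/andP; split.
  have b2 : ball (ratr q2 : R) n.+1%:R^-1 x.2 by rewrite /ball/= ltr_distl; apply/andP; split.
  exists (q1, q2, n) => //; case: pselect => [?|]/=; first by split.
  case; move=> y [/= y1 y2]; apply: xr; split.
  - rewrite /= in y1 b1 *; rewrite /ball/= in y1 b1 *.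
    rewrite -(subrKA (ratr q1)) (le_lt_trans (ler_normD _ _))// (splitr r).
    by rewrite ltrD ?(lt_trans y1)// distrC (lt_trans b1).
  - rewrite /= in y2 b2 *; rewrite /ball/= in y2 b2 *.
    rewrite -(subrKA (ratr q2)) (le_lt_trans (ler_normD _ _))// (splitr r).
    by rewrite ltrD ?(lt_trans y2)// distrC (lt_trans b2).
apply: countable_bigcupT_measurable => // -[[q1 q2] n].
case: pselect => ? /=; last exact: measurable0.
exact: (measurableX (measurable_ball _ _) (measurable_ball _ _)).
Qed.

Lemma continuous_plane_measurable (g : R * R -> R) :
  continuous g -> measurable_fun setT (g : mR * mR -> R).
Proof.
move=> cg; apply: (measurability _ (RGenOInfty.measurableE R)).
move=> _ [_ [a ->] <-]; rewrite setTI; apply: open_plane_measurable.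
by apply: open_comp => [x _|]; [exact: cg|exact: interval_open].
Qed.

End plane.

(** * From spline averages to weak convergence *)

Section vague_to_weak.
Context (R : realType).
Local Notation mR := (measurableTypeR R).
Local Notation V := (mR * mR)%type.

Definition spline2 (c a b : R) (v : V) : R :=
  bspline (c * v.1 - a) * bspline (c * v.2 - b).

Lemma spline2_ge0 c a b v : 0 <= spline2 c a b v.
Proof. by rewrite mulr_ge0// bspline_ge0. Qed.

Lemma bounded_measurable_spline2 c a b : bounded_measurable (spline2 c a b).
Proof.
have [mb _ _ bd _] := taylor3_bspline R.
have maff a' : measurable_fun setT (fun x : mR => c * x - a').
  by apply: measurable_funB => //; exact: measurable_funM.
apply: bounded_measurableM; split.
- by apply: (measurableT_comp mb); apply: (measurableT_comp (maff a)).
- by exists 100 => v; have [] := bd (c * v.1 - a).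
- by apply: (measurableT_comp mb); apply: (measurableT_comp (maff b)).
- by exists 100 => v; have [] := bd (c * v.2 - b).
Qed.

Context d (T : measurableType d) (P : probability T R).
Variables (X : nat -> T -> V) (nu : probability V R).
Hypothesis mX : forall n, measurable_fun setT (X n).

Definition cvg_mean (f : V -> R) := bounded_measurable f /\
  \int[P]_w f (X n w) @[n --> \oo] --> \int[nu]_v f v.

Let bX n (f : V -> R) : bounded_measurable f -> bounded_measurable (fun w => f (X n w)).
Proof.
move=> [mf [M fM]]; split; last by exists M.
exact: (measurableT_comp mf (mX n)).
Qed.

Lemma cvg_mean_lin (f g : V -> R) c : cvg_mean f -> cvg_mean g ->
  cvg_mean (fun v => f v + c * g v).
Proof.
move=> [bf cf] [bg cg].
have bcg : bounded_measurable (fun v => c * g v).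
  by apply: bounded_measurableM => //; exact: bounded_measurable_cst.
split.
  have := bounded_measurableB bf (bounded_measurableB (bounded_measurable_cst _ 0) bcg).
  by congr bounded_measurable; apply/funext => v /=; rewrite sub0r opprK.
have lin d' (S : measurableType d') (Q : probability S R) (Y : S -> V) :
    bounded_measurable (f \o Y) -> bounded_measurable (g \o Y) ->
    \int[Q]_s (f (Y s) + c * g (Y s)) = \int[Q]_s f (Y s) + c * \int[Q]_s g (Y s).
  move=> bfY bgY; rewrite RintegralD//.
  - rewrite RintegralZl//; exact: bounded_measurable_integrable.
  - exact: bounded_measurable_integrable.
  - apply: (@bounded_measurable_integrable _ _ _ _ (fun s => c * g (Y s))).
    by apply: bounded_measurableM => //; exact: bounded_measurable_cst.
rewrite (lin _ _ nu id)//.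
have -> : (fun n => \int[P]_w (f (X n w) + c * g (X n w))) =
    (fun n => \int[P]_w f (X n w) + c * \int[P]_w g (X n w)).
  by apply/funext => n; rewrite lin//; exact: bX.
by apply: cvgD => //; apply: cvgM => //; exact: cvg_cst.
Qed.

Lemma cvg_mean_cst c : cvg_mean (cst c).
Proof.
split; first exact: bounded_measurable_cst.
rewrite Rintegral_prob_cst; under eq_fun do rewrite Rintegral_prob_cst.
exact: cvg_cst.
Qed.

Lemma cvg_mean_sum I (r : seq I) (c : I -> R) (f : I -> V -> R) :
  (forall i, cvg_mean (f i)) -> cvg_mean (fun v => \sum_(i <- r) c i * f i v).
Proof.
move=> cf; elim: r => [|i r ih].
  by have := cvg_mean_cst 0; congr cvg_mean; apply/funext => v; rewrite big_nil.
have := cvg_mean_lin (c i) ih (cf i); congr cvg_mean.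
by apply/funext => v; rewrite big_cons addrC.
Qed.

(** [chi] acts as a cutoff: the error where it falls short of 1 is at most [M] times the lost mass.
    This mass is small under [nu], and therefore for [X n] with [n] large, because the means of
    [chi] converge. Tightness is thus a consequence. *)
Lemma cvg_mean_approx (f : V -> R) : bounded_measurable f ->
  (forall e, 0 < e -> exists h chi M, [/\ 0 <= M, cvg_mean h /\ cvg_mean chi,
     forall v, `|f v - h v| <= M * (1 - chi v) + e &
     M * (1 - \int[nu]_v chi v) <= e]) -> cvg_mean f.
Proof.
move=> bf appr; split=> //; apply/cvgrPdist_le => e e0.
(* Six shares of the error: two for [nu], one for the means of [h], and three for [X n], whose lost
   mass costs one share more than that of [nu]. *)
have e50 : 0 < e / 6 by rewrite divr_gt0.
have [h [chi [M [M0 [[bh ch] [bchi cchi]] fh Mchi]]]] := appr _ e50.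
have key d' (S : measurableType d') (Q : probability S R) (Y : S -> V) :
    measurable_fun setT Y ->
    `|\int[Q]_s f (Y s) - \int[Q]_s h (Y s)| <=
      M * (1 - \int[Q]_s chi (Y s)) + e / 6.
  move=> mY.
  have bY (g : V -> R) : bounded_measurable g -> bounded_measurable (fun s => g (Y s)).
    move=> [mg [N gN]]; split; last by exists N.
    exact: (measurableT_comp mg mY).
  rewrite -RintegralB//; try by apply: bounded_measurable_integrable; exact: bY.
  have bD := bounded_measurableB (bY _ bf) (bY _ bh).
  apply: (le_trans (le_normr_Rintegral _ _)) => //.
    exact: bounded_measurable_integrable.
  have b1chi : bounded_measurable (fun s => M * (1 - chi (Y s))).
    apply: (bounded_measurableM (bounded_measurable_cst _ M)).
    by apply: bounded_measurableB (bY _ bchi); exact: bounded_measurable_cst.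
  have -> : M * (1 - \int[Q]_s chi (Y s)) + e / 6 =
      \int[Q]_s (M * (1 - chi (Y s)) + e / 6).
    rewrite RintegralD//; last 2 first.
    - exact: bounded_measurable_integrable.
    - apply: bounded_measurable_integrable; exact: bounded_measurable_cst.
    rewrite Rintegral_prob_cst RintegralZl//; last first.
      apply: bounded_measurable_integrable.
      by apply: bounded_measurableB (bY _ bchi); exact: bounded_measurable_cst.
    rewrite RintegralB//.
    - by rewrite Rintegral_prob_cst.
    - apply: bounded_measurable_integrable; exact: bounded_measurable_cst.
    - exact: bounded_measurable_integrable (bY _ bchi).
  apply: le_Rintegral => //.
  - have [mD [N DN]] := bD.
    apply: (@bounded_measurable_integrable _ _ _ _ (fun s => `|f (Y s) - h (Y s)|)).
    by split; [exact: measurableT_comp|exists N => s; rewrite normr_id].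
  - apply: (@bounded_measurable_integrable _ _ _ _ (fun s => M * (1 - chi (Y s)) + e / 6)).
    have := bounded_measurableB b1chi (bounded_measurable_cst _ (- (e / 6))).
    by under eq_fun do rewrite opprK.
have cM : M * \int[P]_w chi (X n w) @[n --> \oo] --> M * \int[nu]_v chi v.
  by apply: cvgM => //; exact: cvg_cst.
near=> n.
have a1 := key _ _ nu id (@measurable_id _ _ _).
have a2 := key _ _ P _ (mX n).
have a3 : `|\int[nu]_v h v - \int[P]_w h (X n w)| <= e / 6.
  by near: n; move/cvgrPdist_le : ch => /(_ _ e50).
have a4 : M * (\int[nu]_v chi v - \int[P]_w chi (X n w)) <= e / 6.
  apply: (@le_trans _ _ (`|M * \int[nu]_v chi v - M * \int[P]_w chi (X n w)|)).
    by rewrite mulrBr ler_norm.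
  by near: n; move/cvgrPdist_le : cM => /(_ _ e50).
move: a1 a2 a3; rewrite /= !ler_norml.
set A := \int[nu]_v f v; set B := \int[P]_w f (X n w).
set C := \int[nu]_v h v; set D := \int[P]_w h (X n w).
move=> /andP[? ?] /andP[? ?] /andP[? ?].
by apply/andP; split; lra.
Unshelve. all: by end_near. Qed.

Lemma exists_heavy_square e : 0 < e -> exists2 K : R, 0 <= K &
  fine (nu (~` [set v | `|v.1| <= K /\ `|v.2| <= K])) <= e.
Proof.
move=> e0; pose F (n : nat) : set V := ~` [set v | `|v.1| <= n%:R /\ `|v.2| <= n%:R].
have mF n : measurable (F n).
  apply: measurableC.
  rewrite (_ : [set v | _] = [set v : V | `|v.1| <= n%:R] `&` [set v : V | `|v.2| <= n%:R])//.
  have mn (p : V -> mR) : measurable_fun setT p -> measurable [set v | `|p v| <= n%:R].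
    move=> mp; rewrite -[X in measurable X]setTI.
    have -> : [set v | `|p v| <= n%:R] = (fun v => `|p v|) @^-1` `]-oo, n%:R]%classic.
      by apply/seteqP; split=> v/=; rewrite in_itv.
    have := measurableT_comp (@normr_measurable R setT) mp; exact.
  by apply: measurableI; exact: mn.
have capF : \bigcap_n F n = set0.
  apply/seteqP; split=> // v Fv.
  have := Fv (Num.truncn (Num.max `|v.1| `|v.2|)).+1 I; apply => /=.
  have := truncnS_gt (Num.max `|v.1| `|v.2|).
  by rewrite gt_max => /andP[/ltW -> /ltW ->].
have : (nu \o F) n @[n --> \oo] --> nu (\bigcap_n F n).
  apply: nonincreasing_cvg_mu => //.
  - by apply: le_lt_trans (probability_le1 nu (mF _)) (ltry _).
  - by rewrite capF.
  - move=> m n mn; apply/subsetPset; apply: subsetC => v /= [v1 v2].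
    by split; rewrite (le_trans v1, le_trans v2)// ler_nat.
rewrite capF measure0 => /fine_cvgP[_] /cvgrPdist_le /(_ _ e0)[N _ /(_ N (leqnn N))].
rewrite /= sub0r normrN => h; exists N%:R => //.
exact: le_trans (ler_norm _) h.
Qed.

Hypothesis cvg_spline2 : forall c a b, 0 < c -> cvg_mean (spline2 c a b).

Lemma cvg_mean_continuous (g : R * R -> R) (M : R) : continuous g ->
  (forall v, `|g v| <= M) -> cvg_mean (g : V -> R).
Proof.
move=> cg gM; have M0 : 0 <= M by exact: le_trans (gM (0, 0)).
have bg : bounded_measurable (g : V -> R).
  by split; [exact: continuous_plane_measurable|exists M].
apply: cvg_mean_approx => // e e0.
have eM0 : 0 < e / (M + 1) by rewrite divr_gt0// ltr_wpDl.
have [K K0 nuK] := exists_heavy_square eM0.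
(* The grid points below overshoot the square of half-width [K] by at most 4 meshes, each of length
   at most 1. *)
have [del0 del00 gdel] := @uniformly_continuous_on_square _ g (K + 4) e cg e0.
(* The mesh: at scale [del] a spline has a support of width 4 [del], which the modulus of continuity
   [del0] allows. *)
pose del := Num.min 1 (del0 / 4).
have del_gt0 : 0 < del by rewrite lt_min ltr01 divr_gt0.
have del1 : del <= 1 by rewrite ge_min lexx.
have del4 : 4 * del <= del0 by rewrite mulrC -ler_pdivlMr// ge_min lexx orbT.
pose c := del^-1; have c0 : 0 < c by rewrite invr_gt0.
have cd : c * del = 1 by rewrite /c mulVf// gt_eqF.
(* For |x| <= K the coordinate [c * x + N%:R] then lies between 3 and 2 N, where the translates of
   the spline sum to 1. *)
pose N := (Num.truncn (3 + c * K)).+1.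
have N1 : 3 + c * K < N%:R by rewrite truncnS_gt.
have N2 : N%:R <= 4 + c * K.
  have : (Num.truncn (3 + c * K))%:R <= 3 + c * K.
    by rewrite truncn_le addr_ge0// mulr_ge0// ltW.
  rewrite /N -natr1; lra.
pose m := (N + N)%N.
(* [g] is sampled at the left end of the support of each translate. *)
pose pt (i : 'I_m) : R := del * (i%:R - N%:R).
pose h (v : V) := \sum_(p : 'I_m * 'I_m) g (pt p.1, pt p.2) *
  spline2 c (p.1%:R - N%:R) (p.2%:R - N%:R) v.
pose chi (v : V) := \sum_(p : 'I_m * 'I_m) 1 *
  spline2 c (p.1%:R - N%:R) (p.2%:R - N%:R) v.
pose row x := \sum_(i < m) bspline (c * x + N%:R - i%:R).
have rowE x (i : 'I_m) : c * x - (i%:R - N%:R) = c * x + N%:R - i%:R by ring.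
have chiE v : chi v = row v.1 * row v.2.
  rewrite /chi /row big_distrlr/= pair_big/=.
  by apply: eq_bigr => p _; rewrite mul1r /spline2 !rowE.
have row_le1 x : row x <= 1 by exact: sum_bspline_le1.
have row_ge0 x : 0 <= row x by apply: sumr_ge0 => i _; exact: bspline_ge0.
have chi1 v : chi v <= 1 by rewrite chiE mulr_ile1.
have row1 x : `|x| <= K -> row x = 1.
  rewrite ler_norml => /andP[x1 x2].
  have cx1 : - (c * K) <= c * x by rewrite -mulrN ler_pM2l.
  have cx2 : c * x <= c * K by rewrite ler_pM2l.
  apply: sum_bspline; first lra.
  by rewrite /m natrD; lra.
exists h, chi, M; split => //.
- by split; apply: cvg_mean_sum => p; exact: cvg_spline2.
- move=> v.
  have -> : g v - h v = g v * (1 - chi v) + \sum_(p : 'I_m * 'I_m)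
      (g v - g (pt p.1, pt p.2)) * spline2 c (p.1%:R - N%:R) (p.2%:R - N%:R) v.
    have -> : \sum_(p : 'I_m * 'I_m)
      (g v - g (pt p.1, pt p.2)) * spline2 c (p.1%:R - N%:R) (p.2%:R - N%:R) v =
      g v * chi v - h v.
      rewrite /chi /h mulr_sumr -sumrB; apply: eq_bigr => p _.
      by rewrite mul1r mulrBl.
    by ring.
  apply: (le_trans (ler_normD _ _)); apply: lerD.
    by rewrite normrM (@ger0_norm _ (1 - _)) ?subr_ge0// ler_wpM2r ?subr_ge0.
  apply: (le_trans (ler_norm_sum _ _ _)).
  apply: (@le_trans _ _ (\sum_(p : 'I_m * 'I_m)
      e * (1 * spline2 c (p.1%:R - N%:R) (p.2%:R - N%:R) v))); last first.
    by rewrite -mulr_sumr -/(chi v) ler_piMr ?chi1// ltW.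
  apply: ler_sum => -[i j] _ /=; rewrite mul1r normrM (@ger0_norm _ (spline2 _ _ _ _)) ?spline2_ge0//.
  have [->|] := eqVneq (spline2 c (i%:R - N%:R) (j%:R - N%:R) v) 0; first by rewrite !mulr0.
  rewrite /spline2 mulf_eq0 negb_or => /andP[/bspline_support b1 /bspline_support b2].
  have close x (k : 'I_m) : 0 < c * x - (k%:R - N%:R) < 4 -> `|pt k - x| < del0.
    move=> /andP[k1 k2].
    have dx : del * (c * x) = x by rewrite mulrA (mulrC del) cd mul1r.
    have q1 : 0 < del * (c * x - (k%:R - N%:R)) by rewrite mulr_gt0.
    have q2 : del * (c * x - (k%:R - N%:R)) < del * 4 by rewrite ltr_pM2l.
    rewrite mulrBr dx in q1 q2; rewrite /pt ltr_norml; apply/andP; split; lra.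
  have bdd (k : 'I_m) : `|pt k| <= K + 4.
    have km : k%:R <= m%:R :> R by rewrite ler_nat ltnW.
    have k0 : 0 <= k%:R :> R by [].
    rewrite /m natrD in km.
    have q1 : del * N%:R <= K + 4.
      have : del * N%:R <= del * (4 + c * K) by rewrite ler_pM2l.
      rewrite mulrDr mulrA (mulrC del c) cd mul1r; lra.
    have q2 : del * (k%:R - N%:R) <= del * N%:R by rewrite ler_pM2l//; lra.
    have q3 : del * (- N%:R) <= del * (k%:R - N%:R) by rewrite ler_pM2l//; lra.
    rewrite mulrN in q3; rewrite /pt ler_norml; apply/andP; split; lra.
  apply: ler_wpM2r; first by rewrite mulr_ge0// bspline_ge0.
  by rewrite distrC ltW// gdel//= ?bdd// close.
- have bchi : bounded_measurable chi.
    by have [] := cvg_mean_sum (index_enum _) (fun=> 1) (fun p : 'I_m * 'I_m => cvg_spline2 (p.1%:R - N%:R) (p.2%:R - N%:R) c0).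
  pose A := [set v : V | `|v.1| <= K /\ `|v.2| <= K].
  have mA : measurable A.
    have mn (p : V -> mR) : measurable_fun setT p -> measurable [set v | `|p v| <= K].
      move=> mp; rewrite -[X in measurable X]setTI.
      have -> : [set v | `|p v| <= K] = (fun v => `|p v|) @^-1` `]-oo, K]%classic.
        by apply/seteqP; split=> v/=; rewrite in_itv.
      have := measurableT_comp (@normr_measurable R setT) mp; exact.
    rewrite (_ : A = [set v : V | `|v.1| <= K] `&` [set v : V | `|v.2| <= K])//.
    by apply: measurableI; exact: mn.
  have h1 : 1 - \int[nu]_v chi v <= e / (M + 1).
    apply: le_trans nuK; rewrite -(Rintegral_prob_cst nu 1) -RintegralB//; last 2 first.
    - apply: bounded_measurable_integrable; exact: bounded_measurable_cst.
    - exact: bounded_measurable_integrable.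
    have -> : fine (nu (~` A)) = \int[nu]_v (\1_(~` A) v).
      by rewrite /Rintegral integral_indic ?setIT//; exact: measurableC.
    apply: le_Rintegral => //.
    - apply: bounded_measurable_integrable; apply: bounded_measurableB => //.
      exact: bounded_measurable_cst.
    - apply: integrable_indic => //; exact: measurableC.
    - move=> v _; rewrite indicE; case: (boolP (v \in ~` A)) => vA /=.
        by rewrite gerBl chiE mulr_ge0.
      have : A v by move: vA; rewrite notin_setE => /contrapT.
      by move=> [v1 v2]; rewrite chiE !row1// mul1r subrr.
  apply: (@le_trans _ _ (M * (e / (M + 1)))); first exact: ler_wpM2l.
  by rewrite mulrCA ler_piMr ?(ltW e0)// ler_pdivrMr ?mul1r ?lerDl// ltr_wpDl.
Qed.

End vague_to_weak.

(** * The Gaussian semigroup *)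

Section density.
Context d (T : measurableType d) (R : realType).
Variables (mu nu : {measure set T -> \bar R}) (p : T -> R).
Hypothesis mp : measurable_fun setT p.
Hypothesis p0 : forall x, 0 <= p x.
Hypothesis nuE : forall A, measurable A -> nu A = (\int[mu]_(x in A) (p x)%:E)%E.
Local Open Scope ereal_scope.

Import HBNNSimple.

(** Monotone convergence along simple functions reduces both sides to level sets, where [nuE] is the
    claim. *)
Lemma ge0_integral_density (f : T -> \bar R) :
  measurable_fun setT f -> (forall x, 0 <= f x) ->
  \int[nu]_x f x = \int[mu]_x (f x * (p x)%:E).
Proof.
move=> mf f0; pose h := nnsfun_approx measurableT mf.
have mpE : measurable_fun setT (EFin \o p) by exact/measurable_EFinP.
have ndh x : {homo (fun n => h n x) : m n / (m <= n)%N >-> (m <= n)%R}.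
  by move=> m n mn; exact/lefP/nd_nnsfun_approx.
have -> : \int[nu]_x f x = limn (fun n => \int[nu]_x (h n x)%:E).
  rewrite -monotone_convergence//.
  - by apply: eq_integral => x _; apply/esym/cvg_lim => //; exact: cvg_nnsfun_approx.
  - by move=> n; exact/measurable_EFinP.
  - by move=> n x _; rewrite lee_fin.
  - by move=> x _ a b ab; rewrite lee_fin ndh.
have -> : \int[mu]_x (f x * (p x)%:E) =
    limn (fun n => \int[mu]_x ((h n x)%:E * (p x)%:E)).
  rewrite -monotone_convergence//.
  - apply: eq_integral => x _; apply/esym/cvg_lim => //; apply: cvgeZr => //.
    exact: cvg_nnsfun_approx.
  - move=> n; apply: emeasurable_funM => //; exact/measurable_EFinP.
  - by move=> n x _; rewrite mule_ge0 ?lee_fin.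
  - by move=> x _ a b ab; rewrite lee_wpmul2r ?lee_fin ?ndh.
congr (limn _); apply/funext => n.
have hE x : (h n x)%:E = \sum_(y \in range (h n)) (y * \1_(h n @^-1` [set y]) x)%:E.
  by rewrite fsumEFin// -(fimfunE _ x).
under eq_integral do rewrite hE.
rewrite ge0_integral_fsum//; last 2 first.
- move=> y; apply/measurable_EFinP; exact: measurable_funM.
- by move=> y x _; exact: nnfun_muleindic_ge0.
under [RHS]eq_integral => x _.
  rewrite hE ge0_mule_fsuml; last by move=> y; exact: nnfun_muleindic_ge0.
  over.
rewrite [RHS]ge0_integral_fsum//; last 2 first.
- move=> y; apply: emeasurable_funM => //; apply/measurable_EFinP.
  exact: measurable_funM.
- by move=> y x _; apply: mule_ge0; [exact: nnfun_muleindic_ge0|rewrite lee_fin].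
apply: eq_fsbigr => r; rewrite inE => -[t _ rt].
have r0 : (0 <= r)%R by rewrite -rt.
under eq_integral do rewrite EFinM.
rewrite ge0_integralZl//; last exact/measurable_EFinP.
under [RHS]eq_integral do rewrite EFinM -muleA.
rewrite ge0_integralZl//; last 2 first.
- by apply: emeasurable_funM => //; exact/measurable_EFinP.
- by move=> x _; rewrite mule_ge0 ?lee_fin.
congr (_ * _); rewrite integral_indic// setIT nuE//.
rewrite integral_mkcond; apply: eq_integral => x _.
by rewrite epatch_indic/= muleC.
Qed.

End density.

(** * Reflections and translations of Lebesgue measure *)

Section lebesgue_invariance.
Context (R : realType).
Local Notation mR := (measurableTypeR R).
Local Notation leb := (@lebesgue_measure R).
Local Open Scope ereal_scope.

Lemma ge0_integral_lebesgueN (f : R -> \bar R) :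
  measurable_fun setT f -> (forall x, 0 <= f x) ->
  \int[leb]_x f (- x)%R = \int[leb]_x f x.
Proof.
move=> mf f0; have mN : measurable_fun setT (-%R : mR -> mR) by [].
transitivity (\int[pushforward leb (-%R : mR -> mR)]_x f x).
  by rewrite ge0_integral_pushforward.
by apply: eq_measure_integral => A mA _; exact: lebesgue_measureN.
Qed.

Lemma lebesgue_measureD (r : R) (A : set R) : measurable A ->
  pushforward leb (fun x : mR => (x + r)%R : mR) A = leb A.
Proof.
have mD : measurable_fun setT (fun x : mR => (x + r)%R : mR).
  exact: measurable_funD.
move=> mA; apply/esym/lebesgue_measure_unique => //= _ [[a b]] _ <-.
rewrite /pushforward.
have -> : (fun x : mR => (x + r)%R : mR) @^-1` `]a, b] =
    `](a - r)%R, (b - r)%R]%classic.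
  by apply/seteqP; split=> x/=; rewrite !in_itv/= ltrBlDr lerBrDr.
rewrite !lebesgue_measure_itv/= !lte_fin ltrD2r; case: ifP => // _.
by rewrite -!EFinD; congr EFin; rewrite opprB addrA subrK.
Qed.

Lemma ge0_integral_lebesgueD (r : R) (f : R -> \bar R) :
  measurable_fun setT f -> (forall x, 0 <= f x) ->
  \int[leb]_x f (x + r)%R = \int[leb]_x f x.
Proof.
have mD : measurable_fun setT (fun x : mR => (x + r)%R : mR).
  exact: measurable_funD.
move=> mf f0.
transitivity (\int[pushforward leb (fun x : mR => (x + r)%R : mR)]_x f x).
  by rewrite ge0_integral_pushforward.
by apply: eq_measure_integral => A mA _; exact: lebesgue_measureD.
Qed.

End lebesgue_invariance.

(** * Gaussian densities and their convolution *)

Section gaussian.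
Context (R : realType).
Local Notation mR := (measurableTypeR R).
Local Notation leb := (@lebesgue_measure R).
Implicit Types s t : R.

(** Indexed by the variance, which is the parameter that adds up under convolution. *)
Definition gaussian_density s (x : R) := normal_pdf 0 (Num.sqrt s) x.
Local Notation dens := gaussian_density.

Lemma normal_pdf_sqrt m s x : 0 < s -> normal_pdf m (Num.sqrt s) x =
  (Num.sqrt (s * pi *+ 2))^-1 * expR (- (x - m) ^+ 2 / (s *+ 2)).
Proof.
move=> s0; rewrite normal_pdfE ?gt_eqF ?sqrtr_gt0//.
by rewrite /normal_peak /normal_fun sqr_sqrtr// ltW.
Qed.

Lemma gaussian_densityE s x : 0 < s ->
  dens s x = (Num.sqrt (s * pi *+ 2))^-1 * expR (- x ^+ 2 / (s *+ 2)).
Proof. by move=> s0; rewrite /dens normal_pdf_sqrt// subr0. Qed.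

Lemma gaussian_density_ge0 s x : 0 <= dens s x.
Proof. exact: normal_pdf_ge0. Qed.

Lemma measurable_gaussian_density s : measurable_fun setT (dens s : mR -> R).
Proof. exact: measurable_normal_pdf. Qed.

Lemma integral_centered_gaussian s (f : mR -> \bar R) : 0 < s ->
  measurable_fun setT f -> (forall x, 0 <= f x)%E ->
  (\int[centered_gaussian s]_x f x = \int[leb]_x (f x * (dens s x)%:E))%E.
Proof.
move=> s0 mf f0; apply: ge0_integral_density => //.
- exact: measurable_gaussian_density.
- exact: gaussian_density_ge0.
- by move=> A mA; rewrite /centered_gaussian gt_eqF.
Qed.

Lemma integral_centered_gaussian0 (f : mR -> \bar R) :
  measurable_fun setT f ->
  (\int[centered_gaussian (0%R : R)]_x f x = f 0%R)%E.
Proof.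
by move=> mf; rewrite /centered_gaussian eqxx integral_dirac// diracT mul1e.
Qed.

Let gaussian_peak_identity (s t q : R) : s + t != 0 ->
  t * q *+ 2 * (s * q *+ 2) = (s + t) * q *+ 2 * (s * t / (s + t) * q *+ 2).
Proof. by move=> st0; field. Qed.

Let gaussian_exponent_identity (s t a c : R) : s != 0 -> t != 0 -> s + t != 0 ->
  - (c - a) ^+ 2 / (t *+ 2) + - a ^+ 2 / (s *+ 2) =
  - c ^+ 2 / ((s + t) *+ 2) + - (a - s * c / (s + t)) ^+ 2 / (s * t / (s + t) *+ 2).
Proof.
by move=> s0 t0 st0; field; rewrite s0 t0 st0.
Qed.

(** Completing the square in [a]: given the sum [c], the first summand is Gaussian with mean s c /
    (s + t) and variance s t / (s + t). *)
Lemma gaussian_density_convolution s t a c : 0 < s -> 0 < t ->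
  dens t (c - a) * dens s a =
  dens (s + t) c * normal_pdf (s * c / (s + t)) (Num.sqrt (s * t / (s + t))) a.
Proof.
move=> s0 t0; have st0 : 0 < s + t by rewrite addr_gt0.
have q0 : 0 < s * t / (s + t) by rewrite divr_gt0 ?mulr_gt0.
rewrite !gaussian_densityE// normal_pdf_sqrt// mulrACA [RHS]mulrACA.
rewrite -!expRD -!invfM; congr (_^-1 * expR _).
  have p0 : 0 <= pi :> R by exact: pi_ge0.
  have nn (u : R) : 0 < u -> 0 <= u * pi *+ 2 by move=> u0; rewrite mulrn_wge0//; exact: mulr_ge0 (ltW u0) p0.
  rewrite -[LHS]sqrtrM ?nn// -[RHS]sqrtrM ?nn//; congr Num.sqrt.
  by apply: gaussian_peak_identity; exact: lt0r_neq0.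
by apply: gaussian_exponent_identity; exact: lt0r_neq0.
Qed.

Local Open Scope ereal_scope.

Let measurable_shift (f : mR -> \bar R) : measurable_fun setT f ->
  measurable_fun setT (fun z : mR * mR => f (z.1 + z.2)%R).
Proof.
by move=> mf; apply: (measurableT_comp mf); exact: measurable_funD.
Qed.

(** Once the product of densities is factored as density of the sum times conditional density, the
    latter integrates to 1. Variance 0, a Dirac mass, is treated apart. *)
Lemma ge0_gaussian_semigroup s t (f : mR -> \bar R) : (0 <= s)%R -> (0 <= t)%R ->
  measurable_fun setT f -> (forall x, 0 <= f x) ->
  \int[centered_gaussian s]_a \int[centered_gaussian t]_b f (a + b)%R =
  \int[centered_gaussian (s + t)]_c f c.
Proof.
move=> s0 t0 mf f0.
have mF : measurable_fun setT (fun a : mR => \int[centered_gaussian t]_b f (a + b)%R).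
  apply: (@measurable_fun_fubini_tonelli_F _ _ _ _ _ (centered_gaussian t)
    (fun z : mR * mR => f (z.1 + z.2)%R)) => //; exact: measurable_shift.
move: s0 t0 mF; rewrite !le_eqVlt => /predU1P[<- _|s0 /predU1P[<-|t0]] mF.
- apply: etrans (integral_centered_gaussian0 mF) _; rewrite [in RHS]add0r.
  by apply: eq_integral => x _; rewrite add0r.
- rewrite [in RHS]addr0; apply: eq_integral => x _.
  have mfx : measurable_fun setT (fun b : mR => f (x + b)%R).
    by apply: (measurableT_comp mf); exact: measurable_funD.
  by apply: etrans (integral_centered_gaussian0 mfx) _; rewrite addr0.
have st0 : (0 < s + t)%R by rewrite addr_gt0.
have F0 (x : mR) : 0 <= \int[centered_gaussian t]_b f (x + b)%R.
  by apply: integral_ge0 => y _; exact: f0.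
apply: etrans (integral_centered_gaussian s0 mF F0) _.
apply: etrans (esym (integral_centered_gaussian st0 mf f0)).
have md u : measurable_fun setT (fun x => (dens u x)%:E : \bar R).
  apply/measurable_EFinP; exact: measurable_gaussian_density.
have d0 u x : 0 <= (dens u x)%:E by rewrite lee_fin gaussian_density_ge0.
pose g (z : mR * mR) := f z.2 * ((dens t (z.2 - z.1))%:E * (dens s z.1)%:E).
have mg : measurable_fun setT g.
  apply: emeasurable_funM; first exact: measurableT_comp mf _.
  apply: emeasurable_funM.
    by apply: (measurableT_comp (md t)); exact: measurable_funB.
  exact: measurableT_comp (md s) _.
have g0 z : 0 <= g z by rewrite /g !mule_ge0.
transitivity (\int[leb]_a \int[leb]_c g (a, c)).
  apply: eq_integral => a _.
  have mfa : measurable_fun setT (fun b : mR => f (a + b)%R).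
    by apply: (measurableT_comp mf); exact: measurable_funD.
  rewrite (integral_centered_gaussian t0 mfa (fun b => f0 (a + b)%R)).
  rewrite -ge0_integralZr//; first last.
  - by move=> x _; rewrite mule_ge0.
  - by apply: (emeasurable_funM mfa); exact: md.
  rewrite -(ge0_integral_lebesgueD a)//; last first.
    exact: measurableT_comp mg _.
  by apply: eq_integral => b _; rewrite /g/= addrK muleA (addrC a).
rewrite (@fubini_tonelli _ _ _ _ _ leb leb g mg g0).
apply: eq_integral => c _; rewrite /g/=.
under eq_integral => a _.
  rewrite -EFinM gaussian_density_convolution// EFinM.
  over.
rewrite ge0_integralZl//; last 2 first.
- apply: emeasurable_funM => //.
  by apply/measurable_EFinP; exact: measurable_normal_pdf.
- by move=> x _; rewrite mule_ge0// lee_fin normal_pdf_ge0.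
rewrite ge0_integralZl//; last 2 first.
- by apply/measurable_EFinP; exact: measurable_normal_pdf.
- by move=> x _; rewrite lee_fin normal_pdf_ge0.
by rewrite integral_normal_pdf mule1.
Qed.

End gaussian.

(** * Moments of centered Gaussian laws *)

Section gaussian_moments.
Context (R : realType).
Local Notation mR := (measurableTypeR R).
Local Notation leb := (@lebesgue_measure R).
Local Notation dens := (@gaussian_density R).
Implicit Types s t : R.

Let dens_ge0 := @gaussian_density_ge0 R.

Let measurable_densE s : measurable_fun setT (fun x : mR => (dens s x)%:E).
Proof. by apply/measurable_EFinP; exact: measurable_gaussian_density. Qed.

Let integral_dens s : (\int[leb]_x (dens s x)%:E = 1)%E.
Proof. exact: integral_normal_pdf. Qed.

Let integrable_dens s : leb.-integrable setT (EFin \o dens s).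
Proof. exact: integrable_normal_pdf. Qed.

(** Moments are bounded by dominating [f] times the density with a multiple of a wider Gaussian
    density, whose integral is 1; no moment integral is computed. *)
Let gaussian_moment_le s t C (f : mR -> R) : 0 < s -> 0 <= C -> measurable_fun setT f ->
  (forall x, `|f x| * dens s x <= C * dens t x) ->
  (\int[centered_gaussian s]_x `|(f x)%:E| <= C%:E)%E.
Proof.
move=> s0 C0 mf fd.
have mfE : measurable_fun setT (fun x : mR => `|(f x)%:E|%E).
  by apply: measurableT_comp => //; exact/measurable_EFinP.
apply: (@le_trans _ _ (\int[leb]_x (`|(f x)%:E| * (dens s x)%:E))%E).
  rewrite le_eqVlt; apply/orP; left; apply/eqP.
  by apply: integral_centered_gaussian => // x; exact: abse_ge0.
apply: (@le_trans _ _ (\int[leb]_x (C%:E * (dens t x)%:E))%E).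
  apply: ge0_le_integral => //.
  - by move=> x _; rewrite mule_ge0// lee_fin.
  - by apply: emeasurable_funM => //; exact: measurable_densE.
  - by apply: emeasurable_funM => //; exact: measurable_densE.
  - by move=> x _; rewrite -EFinM lee_fin; exact: fd.
rewrite ge0_integralZl//.
- by rewrite integral_dens mule1.
- by move=> x _; rewrite lee_fin.
Qed.

Let gaussian_integrable s t C (f : mR -> R) : 0 < s -> 0 <= C -> measurable_fun setT f ->
  (forall x, `|f x| * dens s x <= C * dens t x) ->
  (centered_gaussian s).-integrable setT (EFin \o f).
Proof.
move=> s0 C0 mf fd; apply/integrableP; split; first exact/measurable_EFinP.
by apply: le_lt_trans (ltry C); exact: gaussian_moment_le fd.
Qed.

Let peak_gt0 s : 0 < s -> 0 < (Num.sqrt (s * pi *+ 2))^-1 :> R.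
Proof.
by move=> s0; rewrite invr_gt0 sqrtr_gt0 mulrn_wgt0// mulr_gt0// pi_gt0.
Qed.

(** The quotient of [r * dens (r ^+ 2 * s) x] by [dens s x] is exp y with y = x^2 (1 - r^-2) / (2
    s), and exp y >= 1 + y. There is equality at r = 1, which [gaussian_sqr] exploits. *)
Let dens_scale s r x : 0 < s -> 0 < r ->
  (1 + x ^+ 2 / (s *+ 2) * (1 - r ^- 2)) * dens s x <= r * dens (r ^+ 2 * s) x.
Proof.
move=> s0 r0; have rs0 : 0 < r ^+ 2 * s by rewrite mulr_gt0// exprn_gt0.
have sqE : Num.sqrt (r ^+ 2 * s * pi *+ 2) = r * Num.sqrt (s * pi *+ 2).
  by rewrite -mulrA -mulrnAr sqrtrM ?sqr_ge0// sqrtr_sqr ger0_norm// ltW.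
have rr (q e : R) : r * ((r * q)^-1 * e) = q^-1 * e.
  by rewrite invfM !mulrA divff ?mul1r// gt_eqF.
rewrite !gaussian_densityE// sqE rr.
rewrite mulrCA ler_pM2l ?peak_gt0//.
apply: (@le_trans _ _ (expR (x ^+ 2 / (s *+ 2) * (1 - r ^- 2)) * expR (- x ^+ 2 / (s *+ 2)))).
  by rewrite ler_wpM2r ?expR_ge0// expR_ge1Dx.
rewrite -expRD ler_expR le_eqVlt; apply/orP; left; apply/eqP.
by field; rewrite !gt_eqF.
Qed.

Let cube_le_exp (w : R) : 0 <= w -> w ^+ 3 <= 4 * expR (w ^+ 2).
Proof.
move=> w0; have -> : expR (w ^+ 2) = expR (w ^+ 2 / 2) ^+ 2.
  by rewrite -expRM_natr -mulr_natr divfK.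
have h : 1 + w ^+ 2 / 2 <= expR (w ^+ 2 / 2) by exact: expR_ge1Dx.
have h2 : (1 + w ^+ 2 / 2) ^+ 2 <= expR (w ^+ 2 / 2) ^+ 2.
  by rewrite lerXn2r// nnegrE ?expR_ge0// addr_ge0// divr_ge0// sqr_ge0.
have h3 : 0 <= (w ^+ 2 - w) ^+ 2 by exact: sqr_ge0.
nra.
Qed.

Let dens_cube s x : 0 < s ->
  `| (`|x| ^+ 3) | * dens s x <= (64 * (s * Num.sqrt s)) * dens (2 * s) x.
Proof.
move=> s0; have s20 : 0 < 2 * s by rewrite mulr_gt0.
rewrite ger0_norm ?exprn_ge0//.
pose q := Num.sqrt s; have q0 : 0 < q by rewrite sqrtr_gt0.
have sq : s = q ^+ 2 by rewrite sqr_sqrtr// ltW.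
(* In this unit the exponent of [dens s] is - 2 w^2: one half of it absorbs the cube through
   [cube_le_exp], the other half is the exponent of [dens (2 * s)]. *)
pose w := `|x| / (2 * q); have w0 : 0 <= w by rewrite divr_ge0// mulr_ge0// ltW.
have xw : `|x| = 2 * q * w by rewrite /w mulrC divfK// gt_eqF// mulr_gt0.
have x2 : x ^+ 2 = 4 * s * w ^+ 2.
  rewrite -[x ^+ 2]ger0_norm ?sqr_ge0// normrX xw sq; ring.
rewrite !gaussian_densityE// x2.
have -> : - (4 * s * w ^+ 2) / (s *+ 2) = - (w ^+ 2 + w ^+ 2).
  by field; rewrite gt_eqF.
have -> : - (4 * s * w ^+ 2) / (2 * s *+ 2) = - w ^+ 2.
  by field; rewrite gt_eqF.
rewrite opprD expRD.
set E := expR (- w ^+ 2); have E0 : 0 < E by exact: expR_gt0.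
have pk : (Num.sqrt (s * pi *+ 2))^-1 <= 2 * (Num.sqrt (2 * s * pi *+ 2))^-1.
  have p2 : 0 < s * pi *+ 2 :> R by rewrite mulrn_wgt0// mulr_gt0// pi_gt0.
  have sq2E : Num.sqrt (2 * s * pi *+ 2) = Num.sqrt 2 * Num.sqrt (s * pi *+ 2).
    by rewrite -sqrtrM//; congr Num.sqrt; ring.
  rewrite sq2E invfM mulrA ler_peMl ?(ltW (peak_gt0 s0))//.
  rewrite ler_pdivlMr ?sqrtr_gt0// mul1r -[leRHS]ger0_norm// -sqrtr_sqr.
  by rewrite ler_wsqrtr// expr2 ler_peMl// ler1n.
set k1 := (Num.sqrt (s * pi *+ 2))^-1 in pk *.
set k2 := (Num.sqrt (2 * s * pi *+ 2))^-1 in pk *.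
have k20 : 0 < k2 by exact: peak_gt0.
have cE : w ^+ 3 * E <= 4.
  have EE : expR (w ^+ 2) * E = 1 by rewrite /E -expRD subrr expR0.
  by have := cube_le_exp w0; rewrite -(ler_pM2r E0) -(mulrA 4) EE mulr1.
have k10 : 0 < k1 by exact: peak_gt0.
have -> : `|x| ^+ 3 * (k1 * (E * E)) =
  (8 * q ^+ 3) * ((w ^+ 3 * E) * (k1 * E)) by rewrite xw; ring.
rewrite -/q.
have -> : 64 * (s * q) * (k2 * E) = (8 * q ^+ 3) * (4 * (2 * k2 * E)).
  by rewrite [in LHS]sq; ring.
rewrite ler_pM2l; last by rewrite mulr_gt0// exprn_gt0.
apply: ler_pM => //.
- by rewrite mulr_ge0 ?exprn_ge0// ltW.
- by rewrite mulr_ge0// ltW.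
- by rewrite ler_pM2r.
Qed.

Let sqr_le_cube (x : R) : x ^+ 2 <= 1 + `|x| ^+ 3.
Proof.
rewrite -[x ^+ 2]ger0_norm ?sqr_ge0// normrX; have := normr_ge0 x.
set y := `|x| => y0; have [y1|/ltW y1] := leP y 1.
  by rewrite (@le_trans _ _ 1)// ?exprn_ile1// lerDl exprn_ge0.
by rewrite (@le_trans _ _ (y ^+ 3))// ?ler_weXn2l// lerDr.
Qed.

Let norm_le_cube (x : R) : `|x| <= 1 + `|x| ^+ 3.
Proof.
have := normr_ge0 x; set y := `|x| => y0; have [y1|/ltW y1] := leP y 1.
  by rewrite (@le_trans _ _ 1)// lerDl exprn_ge0.
by rewrite (@le_trans _ _ (y ^+ 3))// ?lerDr// -[leLHS]expr1 ler_weXn2l.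
Qed.

Let mcube : measurable_fun setT (fun x : mR => `|x| ^+ 3).
Proof. by apply: measurable_funX; exact: normr_measurable. Qed.

Lemma integrable_gaussian_cube s : 0 <= s ->
  (centered_gaussian s).-integrable setT (EFin \o (fun x => `|x| ^+ 3)).
Proof.
rewrite le_eqVlt => /predU1P[<-|s0]; last first.
  apply: (@gaussian_integrable s (2 * s) (64 * (s * Num.sqrt s))) => //.
    by rewrite !mulr_ge0// ltW.
  by move=> x; exact: dens_cube.
apply/integrableP; split; first exact/measurable_EFinP.
rewrite integral_centered_gaussian0; last first.
  by apply: measurableT_comp => //; exact/measurable_EFinP.
by rewrite /= ltry.
Qed.

Let integrable_gaussian_le_cube s (f : mR -> R) : 0 <= s ->
  measurable_fun setT f -> (forall x, `|f x| <= 1 + `|x| ^+ 3) ->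
  (centered_gaussian s).-integrable setT (EFin \o f).
Proof.
move=> s0 mf f3.
have i13 : (centered_gaussian s).-integrable setT
    (EFin \o (fun x : R => 1 + `|x| ^+ 3)).
  have := integrableD measurableT (bounded_measurable_integrable
    (centered_gaussian s) (bounded_measurable_cst _ 1)) (integrable_gaussian_cube s0).
  by apply: eq_integrable.
apply: (le_integrable measurableT _ _ i13); first exact/measurable_EFinP.
move=> x _ /=; rewrite lee_fin (le_trans (f3 x))//.
by rewrite ler_norm.
Qed.

Lemma integrable_gaussian_sqr s : 0 <= s ->
  (centered_gaussian s).-integrable setT (EFin \o (fun x => x ^+ 2)).
Proof.
move=> s0; apply: integrable_gaussian_le_cube => // x.
by rewrite ger0_norm ?sqr_ge0.
Qed.

Lemma integrable_gaussian_id s : 0 <= s ->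
  (centered_gaussian s).-integrable setT (EFin \o (fun x => x)).
Proof. by move=> s0; exact: integrable_gaussian_le_cube. Qed.

Lemma gaussian_cube_le s : 0 <= s ->
  \int[centered_gaussian s]_x (`|x| ^+ 3) <= 64 * (s * Num.sqrt s).
Proof.
rewrite le_eqVlt => /predU1P[<-|s0].
  rewrite /Rintegral integral_centered_gaussian0; last exact/measurable_EFinP.
  by rewrite /= normr0 expr0n/= mul0r mulr0.
have c0 : 0 <= 64 * (s * Num.sqrt s) by rewrite !mulr_ge0// ltW.
have := gaussian_moment_le s0 c0 mcube (fun x => dens_cube x s0).
have -> : (\int[centered_gaussian s]_x `|(`|x| ^+ 3)%:E| =
    \int[centered_gaussian s]_x (`|x| ^+ 3)%:E)%E.
  by apply: eq_integral => x _; rewrite gee0_abs// lee_fin exprn_ge0.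
move=> h; rewrite -lee_fin fineK//.
exact: integrable_fin_num (integrable_gaussian_cube (ltW s0)).
Qed.

(** Integrating [dens_scale] gives 1 + V (1 - r^-2) <= r for all r > 0, with V = v / (2 s). As
    equality holds at r = 1, the slopes there must agree: 2 V = 1. Neither integration by parts nor
    the Gamma function is involved. *)
Lemma gaussian_sqr s : 0 <= s -> \int[centered_gaussian s]_x (x ^+ 2) = s.
Proof.
rewrite le_eqVlt => /predU1P[<-|s0].
  rewrite /Rintegral integral_centered_gaussian0; last first.
    by apply/measurable_EFinP; exact: measurable_funX.
  by rewrite /= expr0n.
have m2 : measurable_fun setT (fun x : mR => (x ^+ 2)%:E).
  by apply/measurable_EFinP; exact: measurable_funX.
have m2d : measurable_fun setT (fun x : mR => ((x ^+ 2)%:E * (dens s x)%:E)%E).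
  by apply: emeasurable_funM => //; exact: measurable_densE.
have vE : (\int[leb]_x ((x ^+ 2)%:E * (dens s x)%:E) =
    (\int[centered_gaussian s]_x (x ^+ 2))%:E)%E.
  rewrite fineK; last exact: integrable_fin_num (integrable_gaussian_sqr (ltW s0)).
  apply/esym; apply: integral_centered_gaussian => //.
  by move=> x; rewrite lee_fin sqr_ge0.
set v := \int[_]_x _ in vE *.
have v0 : 0 <= v by apply: Rintegral_ge0 => x _; exact: sqr_ge0.
have int2 : leb.-integrable setT (EFin \o (fun x => x ^+ 2 * dens s x)).
  apply/integrableP; split.
    by apply/measurable_EFinP; apply: measurable_funM;
      [exact: measurable_funX|exact: measurable_gaussian_density].
  have -> : (\int[leb]_x `|(EFin \o (fun x => x ^+ 2 * dens s x)%R) x| = v%:E)%E.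
    rewrite -vE; apply: eq_integral => x _ /=.
    by rewrite ger0_norm// mulr_ge0// sqr_ge0.
  exact: ltry.
have vR : \int[leb]_x (x ^+ 2 * dens s x) = v.
  by rewrite /Rintegral; under eq_integral do rewrite EFinM; rewrite vE.
have dR u : \int[leb]_x dens u x = 1 by rewrite /Rintegral integral_dens.
pose V := v / (s *+ 2).
have ineq r : 0 < r -> 1 + V * (1 - r ^- 2) <= r.
  move=> r0; have rs0 : 0 < r ^+ 2 * s by rewrite mulr_gt0// exprn_gt0.
  have iZ : leb.-integrable setT
      (EFin \o (fun x => (1 - r ^- 2) / (s *+ 2) * (x ^+ 2 * dens s x))).
    have := integrableZl measurableT ((1 - r ^- 2) / (s *+ 2)) int2.
    by apply: eq_integrable.
  have -> : 1 + V * (1 - r ^- 2) =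
      \int[leb]_x (dens s x + ((1 - r ^- 2) / (s *+ 2)) * (x ^+ 2 * dens s x)).
    rewrite RintegralD//.
    by rewrite RintegralZl// vR dR /V; congr (_ + _); rewrite [LHS]mulrC mulrA [RHS]mulrAC.
  have rE : r = \int[leb]_x (r * dens (r ^+ 2 * s) x).
    by rewrite RintegralZl// dR mulr1.
  rewrite [leRHS]rE.
  apply: le_Rintegral => //.
  - by have := integrableD measurableT (integrable_dens s) iZ; apply: eq_integrable.
  - have := integrableZl measurableT r (integrable_dens (r ^+ 2 * s)).
    by apply: eq_integrable.
  - move=> x _; apply: le_trans (dens_scale x s0 r0).
    rewrite le_eqVlt; apply/orP; left; apply/eqP; ring.
(* Multiplying by r^2 exposes the factor r - 1. Taking r = 1 + e or r = 1 - e with e = |V - 1 / 2|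
   contradicts either sign of V - 1 / 2. *)
have key r : 0 < r -> 0 <= (r - 1) * (r ^+ 2 - (r + 1) * V).
  move=> r0; have := ineq r r0; rewrite -subr_ge0 => h.
  have -> : (r - 1) * (r ^+ 2 - (r + 1) * V) = r ^+ 2 * (r - (1 + V * (1 - r ^- 2))).
    by field; rewrite gt_eqF.
  by rewrite mulr_ge0// sqr_ge0.
suff V2 : V = 1 / 2.
  have -> : v = V * (s *+ 2) by rewrite /V divfK// mulrn_eq0/= gt_eqF.
  by rewrite V2 -mulr_natr; field.
have V0 : 0 <= V by rewrite divr_ge0// mulrn_wge0// ltW.
apply/eqP; rewrite eq_le; apply/andP; split; rewrite leNgt; apply/negP => hV.
- pose e := V - 1 / 2; have e0 : 0 < e by rewrite subr_gt0.
  have := key (1 + e); rewrite addrAC subrr add0r => /(_ ltac:(lra)).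
  rewrite pmulr_rge0// /e; nra.
- pose e := 1 / 2 - V; have e0 : 0 < e by rewrite subr_gt0.
  have := key (1 - e); rewrite addrAC subrr add0r => /(_ ltac:(rewrite /e; lra)).
  rewrite mulNr oppr_ge0 pmulr_rle0// /e; nra.
Qed.

(** The reflection x to - x preserves the density and exchanges the positive and negative parts of
    the identity. *)
Lemma gaussian_mean0 s : 0 <= s -> \int[centered_gaussian s]_x x = 0.
Proof.
rewrite le_eqVlt => /predU1P[<-|s0].
  by rewrite /Rintegral integral_centered_gaussian0//; exact/measurable_EFinP.
have mpos : measurable_fun setT (fun x : mR => (Num.max x 0)%:E).
  by apply/measurable_EFinP; exact: measurable_maxr.
have pos0 (x : mR) : (0 <= (Num.max x 0)%:E)%E by rewrite lee_fin le_max lexx orbT.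
have mneg : measurable_fun setT (fun x : mR => (Num.max (- x) 0)%:E).
  by apply/measurable_EFinP; exact: measurable_maxr.
have ipos : (centered_gaussian s).-integrable setT (EFin \o (fun x : R => Num.max x 0)).
  apply: integrable_gaussian_le_cube; [exact: ltW|exact: measurable_maxr|].
  move=> x; apply: le_trans (norm_le_cube x).
  by have [x0|x0] := leP x 0; rewrite ?normr0// .
have ineg : (centered_gaussian s).-integrable setT (EFin \o (fun x : R => Num.max (- x) 0)).
  apply: integrable_gaussian_le_cube; [exact: ltW|exact: measurable_maxr|].
  move=> x; apply: le_trans (norm_le_cube x).
  by have [x0|x0] := leP (- x) 0; rewrite ?normr0 ?normrN.
have -> : \int[centered_gaussian s]_x x =
    \int[centered_gaussian s]_x (Num.max x 0 - Num.max (- x) 0).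
  apply: eq_Rintegral => x _; have [x0|x0] := leP x 0.
    by rewrite max_l ?oppr_ge0// sub0r opprK.
  by rewrite max_r ?subr0// oppr_le0 ltW.
rewrite RintegralB//; apply/eqP; rewrite subr_eq0; apply/eqP.
rewrite /Rintegral; congr fine.
apply: etrans (integral_centered_gaussian s0 mpos pos0) _.
apply: etrans _ (esym (integral_centered_gaussian s0 mneg (fun x => pos0 (- x)))).
rewrite -[LHS]ge0_integral_lebesgueN; last 2 first.
- by apply: emeasurable_funM => //; exact: measurable_densE.
- by move=> x; rewrite mule_ge0// lee_fin.
apply: eq_integral => x _; congr (_ * _%:E)%E.
by rewrite !gaussian_densityE// sqrrN.
Qed.

Lemma gaussian_taylor psi psi1 psi2 C s x : 0 <= s -> taylor3 psi psi1 psi2 C ->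
  `|\int[centered_gaussian s]_a psi (x + a) - psi x - psi2 x * (s / 2)|
    <= C * (64 * (s * Num.sqrt s)).
Proof.
move=> s0 [mpsi _ _ bd tay]; pose g := centered_gaussian s.
have C0 : 0 <= C by have [+ _ _] := bd x; exact: le_trans.
have mpx : measurable_fun setT (fun a : mR => psi (x + a)).
  by apply: (measurableT_comp mpsi); exact: measurable_funD.
have ipsi : g.-integrable setT (EFin \o (fun a => psi (x + a))).
  apply: bounded_measurable_integrable; split => //.
  by exists C => a; have [] := bd (x + a).
have icst c : g.-integrable setT (EFin \o cst c).
  by apply: bounded_measurable_integrable; exact: bounded_measurable_cst.
have i1 := integrable_gaussian_id s0; have i2 := integrable_gaussian_sqr s0.
have i3 := integrable_gaussian_cube s0.
have iA : g.-integrable setT (EFin \o (fun a => psi (x + a) - psi x)).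
  by have := integrableB measurableT ipsi (icst (psi x)); apply: eq_integrable.
have iB : g.-integrable setT (EFin \o (fun a => psi1 x * a)).
  by have := integrableZl measurableT (psi1 x) i1; apply: eq_integrable.
have iC : g.-integrable setT (EFin \o (fun a => psi2 x / 2 * a ^+ 2)).
  by have := integrableZl measurableT (psi2 x / 2) i2; apply: eq_integrable.
have iAB : g.-integrable setT (EFin \o (fun a => psi (x + a) - psi x - psi1 x * a)).
  by have := integrableB measurableT iA iB; apply: eq_integrable.
have iABC : g.-integrable setT
    (EFin \o (fun a => psi (x + a) - psi x - psi1 x * a - psi2 x / 2 * a ^+ 2)).
  by have := integrableB measurableT iAB iC; apply: eq_integrable.
have -> : \int[g]_a psi (x + a) - psi x - psi2 x * (s / 2) =
    \int[g]_a (psi (x + a) - psi x - psi1 x * a - psi2 x / 2 * a ^+ 2).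
  rewrite !RintegralB//; last exact: (icst (psi x)).
  rewrite !RintegralZl// Rintegral_prob_cst gaussian_mean0// gaussian_sqr//.
  by rewrite mulr0 subr0 mulrAC mulrA.
apply: (le_trans (le_normr_Rintegral _ _)) => //.
apply: (@le_trans _ _ (\int[g]_a (C * `|a| ^+ 3))).
  apply: le_Rintegral => //.
  - exact: integrable_norm iABC.
  - by have := integrableZl measurableT C i3; apply: eq_integrable.
  - by move=> a _; have := tay x a; rewrite [psi2 x * _ / 2]mulrAC.
by rewrite RintegralZl// ler_wpM2l// gaussian_cube_le.
Qed.

End gaussian_moments.

(** * A Lindeberg central limit theorem *)

Section product_taylor.
Context (R : realType).

(** The product of two second-order expansions. Its cross terms have order three or four, and the
    bounds |h|, |k| <= 1 bring the latter down to order three; 6 covers all coefficients. *)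
Lemma product_taylor_le (C a0 a1 a2 b0 b1 b2 h k f g : R) :
  `|a0| <= C -> `|a1| <= C -> `|a2| <= C ->
  `|b0| <= C -> `|b1| <= C -> `|b2| <= C -> `|g| <= C ->
  `|f - a0 - a1 * h - a2 * h ^+ 2 / 2| <= C * `|h| ^+ 3 ->
  `|g - b0 - b1 * k - b2 * k ^+ 2 / 2| <= C * `|k| ^+ 3 ->
  `|h| <= 1 -> `|k| <= 1 ->
  `|f * g - a0 * b0 - a1 * b0 * h - a0 * b1 * k
    - (a2 * b0 / 2 * h ^+ 2 + a0 * b2 / 2 * k ^+ 2 + a1 * b1 * (h * k))|
  <= 6 * C ^+ 2 * (`|h| + `|k|) ^+ 3.
Proof.
move=> a0C a1C a2C b0C b1C b2C gC fh gk h1 k1.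
have C0 : 0 <= C by exact: le_trans a0C.
set r1 := f - _ - _ - _ in fh; set r2 := g - _ - _ - _ in gk.
pose p := a0 + a1 * h + a2 * h ^+ 2 / 2.
have -> : f * g - a0 * b0 - a1 * b0 * h - a0 * b1 * k
    - (a2 * b0 / 2 * h ^+ 2 + a0 * b2 / 2 * k ^+ 2 + a1 * b1 * (h * k)) =
  r1 * g + p * r2 + (a1 * b2 / 2) * (h * k ^+ 2) + (a2 * b1 / 2) * (h ^+ 2 * k)
    + (a2 * b2 / 4) * (h ^+ 2 * k ^+ 2).
  by rewrite /r1 /r2 /p; field.
have H0 := normr_ge0 h; have K0 := normr_ge0 k.
have half (u : R) : `|u / 2| <= `|u|.
  by rewrite normrM normfV (@ger0_norm _ 2)// ler_piMr// invf_le1 ?ler1n.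
have quarter (u : R) : `|u / 4| <= `|u|.
  by rewrite normrM normfV (@ger0_norm _ 4)// ler_piMr// invf_le1 ?ler1n.
have CC (u v : R) : `|u| <= C -> `|v| <= C -> `|u * v| <= C ^+ 2.
  by move=> uC vC; rewrite normrM expr2 ler_pM.
have pC : `|p| <= 3 * C.
  have -> : 3 * C = C + C * 1 + C * 1 by ring.
  apply: (le_trans (ler_normD _ _)); apply: lerD.
    apply: (le_trans (ler_normD _ _)); apply: lerD => //.
    by rewrite normrM ler_pM.
  apply: (le_trans (half _)); rewrite normrM ler_pM// normrX.
  by rewrite exprn_ile1.
have e1 : `|r1 * g| <= C ^+ 2 * `|h| ^+ 3.
  have -> : C ^+ 2 * `|h| ^+ 3 = C * `|h| ^+ 3 * C by ring.
  by rewrite normrM ler_pM.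
have e2 : `|p * r2| <= 3 * C ^+ 2 * `|k| ^+ 3.
  have -> : 3 * C ^+ 2 * `|k| ^+ 3 = 3 * C * (C * `|k| ^+ 3) by ring.
  by rewrite normrM ler_pM.
have e3 : `|(a1 * b2 / 2) * (h * k ^+ 2)| <= C ^+ 2 * (`|h| * `|k| ^+ 2).
  by rewrite normrM ler_pM// ?(le_trans (half _) (CC _ _ _ _))// normrM normrX.
have e4 : `|(a2 * b1 / 2) * (h ^+ 2 * k)| <= C ^+ 2 * (`|h| ^+ 2 * `|k|).
  by rewrite normrM ler_pM// ?(le_trans (half _) (CC _ _ _ _))// normrM normrX.
have e5 : `|(a2 * b2 / 4) * (h ^+ 2 * k ^+ 2)| <= C ^+ 2 * (`|h| ^+ 2 * `|k|).
  rewrite normrM ler_pM// ?(le_trans (quarter _) (CC _ _ _ _))// normrM !normrX.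
  by rewrite ler_wpM2l ?exprn_ge0// -[leRHS]expr1 ler_wiXn2l.
apply: (@le_trans _ _ (C ^+ 2 * `|h| ^+ 3 + 3 * C ^+ 2 * `|k| ^+ 3 +
  C ^+ 2 * (`|h| * `|k| ^+ 2) + C ^+ 2 * (`|h| ^+ 2 * `|k|) +
  C ^+ 2 * (`|h| ^+ 2 * `|k|))).
  by do 4 (apply: (le_trans (ler_normD _ _)); apply: lerD => //).
have -> : C ^+ 2 * `|h| ^+ 3 + 3 * C ^+ 2 * `|k| ^+ 3 +
  C ^+ 2 * (`|h| * `|k| ^+ 2) + C ^+ 2 * (`|h| ^+ 2 * `|k|) +
  C ^+ 2 * (`|h| ^+ 2 * `|k|) = C ^+ 2 * (`|h| ^+ 3 + 3 * `|k| ^+ 3 +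
  `|h| * `|k| ^+ 2 + 2 * (`|h| ^+ 2 * `|k|)) by ring.
have -> : 6 * C ^+ 2 * (`|h| + `|k|) ^+ 3 = C ^+ 2 * (6 * (`|h| + `|k|) ^+ 3) by ring.
apply: ler_wpM2l; first exact: sqr_ge0.
have m1 : 0 <= `|h| ^+ 3 by rewrite exprn_ge0.
have m2 : 0 <= `|k| ^+ 3 by rewrite exprn_ge0.
have m3 : 0 <= `|h| * `|k| ^+ 2 by rewrite mulr_ge0// exprn_ge0.
have m4 : 0 <= `|h| ^+ 2 * `|k| by rewrite mulr_ge0// exprn_ge0.
have -> : 6 * (`|h| + `|k|) ^+ 3 = 6 * `|h| ^+ 3 + 18 * (`|h| ^+ 2 * `|k|) +
  18 * (`|h| * `|k| ^+ 2) + 6 * `|k| ^+ 3 by ring.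
lra.
Qed.

End product_taylor.

Section one_step.
Context d (S : measurableType d) (R : realType) (mu : probability S R).
Variables (A B : S -> R) (Tr : set S).
Hypotheses (mA : measurable_fun setT A) (mB : measurable_fun setT B).
Hypotheses (iA : mu.-integrable setT (EFin \o A))
  (iB : mu.-integrable setT (EFin \o B)).
Hypotheses (A0 : \int[mu]_s A s = 0) (B0 : \int[mu]_s B s = 0).
Hypothesis mTr : measurable Tr.
Hypotheses (TrA : forall s, Tr s -> `|A s| <= 1) (TrB : forall s, Tr s -> `|B s| <= 1).

Variables (psi psi1 psi2 phi phi1 phi2 : R -> R) (C : R).
Hypotheses (tpsi : taylor3 psi psi1 psi2 C) (tphi : taylor3 phi phi1 phi2 C).

Let bounded_on_Tr (f : S -> R) M : measurable_fun setT f ->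
  (forall s, Tr s -> `|f s| <= M) -> mu.-integrable Tr (EFin \o f).
Proof.
move=> mf fM; apply: measurable_bounded_integrable => //.
- by apply: le_lt_trans (probability_le1 mu mTr) (ltry _).
- exact: measurable_funTS.
- exists M; split; [exact: num_real|move=> x Mx y Ty].
  exact: le_trans (fM y Ty) (ltW Mx).
Qed.

(** The quadratic terms are integrated over [Tr] only, as [A] and [B] need not be square integrable.
    The linear terms are kept on the whole space, where their means vanish; off [Tr] the remainder
    is then at most affine in |A| and |B|. *)
Lemma one_step_expansion (x y : R) :
  `|\int[mu]_s (psi (x + A s) * phi (y + B s)) - psi x * phi y -
    (psi2 x * phi y / 2 * \int[mu]_(s in Tr) (A s ^+ 2) +
     psi x * phi2 y / 2 * \int[mu]_(s in Tr) (B s ^+ 2) +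
     psi1 x * phi1 y * \int[mu]_(s in Tr) (A s * B s))|
  <= 6 * C ^+ 2 * (\int[mu]_(s in Tr) (`|A s| + `|B s|) ^+ 3 +
                   \int[mu]_(s in ~` Tr) (1 + `|A s| + `|B s|)).
Proof.
have [mpsi _ _ bpsi Tpsi] := tpsi; have [mphi _ _ bphi Tphi] := tphi.
have [a0 a1 a2] := bpsi x; have [b0 b1 b2] := bphi y.
have C0 : 0 <= C by exact: le_trans a0.
have mTrC : measurable (~` Tr) by exact: measurableC.
have mpx : measurable_fun setT (fun s => psi (x + A s)).
  by apply: (measurableT_comp mpsi); exact: measurable_funD.
have mpy : measurable_fun setT (fun s => phi (y + B s)).
  by apply: (measurableT_comp mphi); exact: measurable_funD.
have ipp : mu.-integrable setT (EFin \o (fun s => psi (x + A s) * phi (y + B s))).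
  apply: bounded_measurable_integrable; apply: bounded_measurableM; split => //.
  - by exists C => s; have [] := bpsi (x + A s).
  - by exists C => s; have [] := bphi (y + B s).
have icst c : mu.-integrable setT (EFin \o cst c).
  by apply: bounded_measurable_integrable; exact: bounded_measurable_cst.
have i1 : mu.-integrable setT (EFin \o (fun s => psi1 x * phi y * A s)).
  by have := integrableZl measurableT (psi1 x * phi y) iA; apply: eq_integrable.
have i2 : mu.-integrable setT (EFin \o (fun s => psi x * phi1 y * B s)).
  by have := integrableZl measurableT (psi x * phi1 y) iB; apply: eq_integrable.
have iD1 : mu.-integrable setT
    (EFin \o (fun s => psi (x + A s) * phi (y + B s) - psi x * phi y)).
  by have := integrableB measurableT ipp (icst (psi x * phi y)); apply: eq_integrable.
have iD2 : mu.-integrable setT (EFin \o (fun s =>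
    psi (x + A s) * phi (y + B s) - psi x * phi y - psi1 x * phi y * A s)).
  by have := integrableB measurableT iD1 i1; apply: eq_integrable.
(* The linear terms are subtracted before the space is split: their integrals over [Tr] alone need
   not vanish. *)
pose D s := psi (x + A s) * phi (y + B s) - psi x * phi y
  - psi1 x * phi y * A s - psi x * phi1 y * B s.
have iD : mu.-integrable setT (EFin \o D).
  by have := integrableB measurableT iD2 i2; apply: eq_integrable.
have mD : measurable_fun setT D by exact/measurable_EFinP/(measurable_int _ iD).
have -> : \int[mu]_s (psi (x + A s) * phi (y + B s)) - psi x * phi y =
    \int[mu]_s D s.
  rewrite /D !RintegralB//; last exact: (icst (psi x * phi y)).
  by rewrite Rintegral_prob_cst (RintegralZl _ _ iA)// (RintegralZl _ _ iB)// A0 B0 !mulr0 !subr0.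
have -> : \int[mu]_s D s = \int[mu]_(s in Tr) D s + \int[mu]_(s in ~` Tr) D s.
  rewrite -(setUv Tr) Rintegral_setU ?setUv//.
  by apply/disj_setPS => s [].
have iT (f : S -> R) : mu.-integrable setT (EFin \o f) -> mu.-integrable Tr (EFin \o f).
  by move=> ?; exact: (integrableS measurableT).
have iTC (f : S -> R) : mu.-integrable setT (EFin \o f) -> mu.-integrable (~` Tr) (EFin \o f).
  by move=> ?; exact: (integrableS measurableT).
pose q s := psi2 x * phi y / 2 * A s ^+ 2 + psi x * phi2 y / 2 * B s ^+ 2
  + psi1 x * phi1 y * (A s * B s).
have sq1 (u : R) : `|u| <= 1 -> `|u ^+ 2| <= 1.
  by move=> u1; rewrite normrX exprn_ile1.
have iA2 : mu.-integrable Tr (EFin \o (fun s => A s ^+ 2)).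
  apply: (@bounded_on_Tr _ 1); first exact: measurable_funX.
  by move=> s Ts; rewrite sq1// TrA.
have iB2 : mu.-integrable Tr (EFin \o (fun s => B s ^+ 2)).
  apply: (@bounded_on_Tr _ 1); first exact: measurable_funX.
  by move=> s Ts; rewrite sq1// TrB.
have iAB : mu.-integrable Tr (EFin \o (fun s => A s * B s)).
  apply: (@bounded_on_Tr _ 1); first exact: measurable_funM.
  by move=> s Ts; rewrite normrM mulr_ile1// ?TrA// TrB.
have j1 : mu.-integrable Tr (EFin \o (fun s => psi2 x * phi y / 2 * A s ^+ 2)).
  by have := integrableZl mTr (psi2 x * phi y / 2) iA2; apply: eq_integrable.
have j2 : mu.-integrable Tr (EFin \o (fun s => psi x * phi2 y / 2 * B s ^+ 2)).
  by have := integrableZl mTr (psi x * phi2 y / 2) iB2; apply: eq_integrable.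
have j3 : mu.-integrable Tr (EFin \o (fun s => psi1 x * phi1 y * (A s * B s))).
  by have := integrableZl mTr (psi1 x * phi1 y) iAB; apply: eq_integrable.
have j12 : mu.-integrable Tr (EFin \o (fun s =>
    psi2 x * phi y / 2 * A s ^+ 2 + psi x * phi2 y / 2 * B s ^+ 2)).
  by have := integrableD mTr j1 j2; apply: eq_integrable.
have iq : mu.-integrable Tr (EFin \o q).
  by have := integrableD mTr j12 j3; apply: eq_integrable.
have <- : \int[mu]_(s in Tr) q s =
   psi2 x * phi y / 2 * \int[mu]_(s in Tr) (A s ^+ 2) +
   psi x * phi2 y / 2 * \int[mu]_(s in Tr) (B s ^+ 2) +
   psi1 x * phi1 y * \int[mu]_(s in Tr) (A s * B s).
  by rewrite /q !RintegralD// !RintegralZl.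
rewrite addrAC -RintegralB//; last exact: iT.
have iDq : mu.-integrable Tr (EFin \o (fun s => D s - q s)).
  by have := integrableB mTr (iT _ iD) iq; apply: eq_integrable.
have nAB : measurable_fun setT (fun s => `|A s| + `|B s|).
  by apply: measurable_funD; apply: (measurableT_comp (@normr_measurable R setT)).
have i3 : mu.-integrable Tr (EFin \o (fun s => (`|A s| + `|B s|) ^+ 3)).
  apply: (@bounded_on_Tr _ (2 ^+ 3)); first exact: measurable_funX.
  move=> s Ts; rewrite normrX lerXn2r ?nnegrE// ger0_norm ?addr_ge0//.
  by rewrite -[2]/(1 + 1)%:R natrD lerD ?TrA ?TrB.
have itail : mu.-integrable (~` Tr) (EFin \o (fun s => 1 + `|A s| + `|B s|)).
  apply: iTC.
  have h1 : mu.-integrable setT (EFin \o (fun s => 1 + `|A s|)).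
    have := integrableD measurableT (icst 1) (integrable_norm iA).
    by apply: eq_integrable.
  have := integrableD measurableT h1 (integrable_norm iB).
  by apply: eq_integrable.
rewrite mulrDr; apply: (le_trans (ler_normD _ _)); apply: lerD.
- apply: (le_trans (le_normr_Rintegral _ _)) => //.
  rewrite -RintegralZl//; apply: le_Rintegral => //.
  + exact: integrable_norm iDq.
  + by have := integrableZl mTr (6 * C ^+ 2) i3; apply: eq_integrable.
  + move=> s Ts; apply: product_taylor_le; rewrite ?TrA ?TrB//.
    by have [] := bphi (y + B s).
- apply: (le_trans (le_normr_Rintegral _ _)) => //; first exact: iTC.
  rewrite -RintegralZl//; apply: le_Rintegral => //.
  + exact: integrable_norm (iTC _ iD).
  + by have := integrableZl mTrC (6 * C ^+ 2) itail; apply: eq_integrable.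
  + move=> s _; rewrite /D.
    have [p0 _ _] := bpsi (x + A s); have [q0 _ _] := bphi (y + B s).
    have CC (u v : R) : `|u| <= C -> `|v| <= C -> `|u * v| <= C ^+ 2.
      by move=> uC vC; rewrite normrM expr2 ler_pM.
    apply: (@le_trans _ _ (C ^+ 2 + C ^+ 2 + C ^+ 2 * `|A s| + C ^+ 2 * `|B s|)).
      apply: (le_trans (ler_normB _ _)); apply: lerD; last by rewrite normrM ler_wpM2r// CC.
      apply: (le_trans (ler_normB _ _)); apply: lerD; last by rewrite normrM ler_wpM2r// CC.
      by apply: (le_trans (ler_normB _ _)); apply: lerD; exact: CC.
    have c2 : 0 <= C ^+ 2 by exact: sqr_ge0.
    have t1 : 0 <= C ^+ 2 * `|A s| by exact: mulr_ge0.
    have t2 : 0 <= C ^+ 2 * `|B s| by exact: mulr_ge0.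
    rewrite !mulrDr mulr1 -!mulrA; lra.
Qed.

End one_step.

(** * Gaussian averaging of product functions *)

Section gaussian_averaging.
Context (R : realType).
Local Notation mR := (measurableTypeR R).
Local Notation V := (mR * mR)%type.
Implicit Types (s t : R) (f g : mR -> R).

Definition plane_add (z : V * V) : V := ((z.1.1 + z.2.1)%R, (z.1.2 + z.2.2)%R).

Lemma measurable_plane_add : measurable_fun setT plane_add.
Proof.
apply: measurable_fun_pair; apply: measurable_funD.
- by apply: (measurableT_comp (@measurable_fst _ _ mR mR)).
- by apply: (measurableT_comp (@measurable_fst _ _ mR mR)).
- by apply: (measurableT_comp (@measurable_snd _ _ mR mR)).
- by apply: (measurableT_comp (@measurable_snd _ _ mR mR)).
Qed.

Definition tensor (f g : R -> R) (v : V) : R := f v.1 * g v.2.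

Lemma bounded_measurable_tensor (f g : mR -> R) : bounded_measurable f ->
  bounded_measurable g -> bounded_measurable (tensor f g).
Proof.
move=> [mf [M fM]] [mg [N gN]]; apply: bounded_measurableM; split.
- exact: measurableT_comp mf _.
- by exists M.
- exact: measurableT_comp mg _.
- by exists N.
Qed.

(** The heat semigroup at time [s], generated by half the second derivative. *)
Definition gaussian_smoothing s (f : mR -> R) (x : mR) : R :=
  \int[centered_gaussian s]_a f (x + a).
Local Notation u := gaussian_smoothing.

Let bounded_measurable_shift2 (f : mR -> R) : bounded_measurable f ->
  bounded_measurable (fun z : mR * mR => f (z.1 + z.2)).
Proof.
move=> [mf [M fM]]; split; last by exists M.
by apply: (measurableT_comp mf); exact: measurable_funD.
Qed.

Lemma bounded_measurable_shift (f : mR -> R) x : bounded_measurable f ->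
  bounded_measurable (fun a : mR => f (x + a)).
Proof.
by move=> bf; exact: (bounded_measurable_xsection (bounded_measurable_shift2 bf)).
Qed.

Lemma bounded_measurable_gaussian_smoothing s f : bounded_measurable f ->
  bounded_measurable (u s f).
Proof.
move=> bf.
exact: (bounded_measurable_Rintegral (centered_gaussian s) (bounded_measurable_shift2 bf)).
Qed.

Lemma gaussian_smoothing_le s (f : mR -> R) C : measurable_fun setT f ->
  (forall x, `|f x| <= C) -> forall x, `|u s f x| <= C.
Proof.
move=> mf fC x; apply: normr_Rintegral_le => //.
by apply: (measurableT_comp mf); exact: measurable_funD.
Qed.

Lemma gaussian_smoothing0 f : bounded_measurable f -> u 0 f = f.
Proof.
move=> bf; apply/funext => x; rewrite /u /Rintegral.
have [mf _] := bounded_measurable_shift x bf.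
rewrite integral_centered_gaussian0 /= ?addr0//; exact/measurable_EFinP.
Qed.

Lemma gaussian_smoothingD s t f : 0 <= s -> 0 <= t -> bounded_measurable f ->
  (forall x, 0 <= f x) -> u s (u t f) = u (s + t) f.
Proof.
move=> s0 t0 bf f0; apply/funext => x; rewrite /u /Rintegral.
apply: (congr1 (@fine _)).
have [mf _] := bounded_measurable_shift x bf.
have mfE : measurable_fun setT (fun a : mR => (f (x + a))%:E) by exact/measurable_EFinP.
have fE0 (a : mR) : (0 <= (f (x + a))%:E)%E by rewrite lee_fin.
apply: etrans _ (ge0_gaussian_semigroup s0 t0 mfE fE0).
apply: eq_integral => a _; rewrite fineK; last first.
  apply: integrable_fin_num => //.
  by apply: bounded_measurable_integrable; exact: bounded_measurable_shift.
by apply: eq_integral => b _; rewrite addrA.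
Qed.

Definition gaussian_plane s : probability V R :=
  (centered_gaussian s \x centered_gaussian s)%E.

Lemma averaging_gaussian_tensor s f g : bounded_measurable f ->
  bounded_measurable g ->
  averaging (gaussian_plane s) plane_add (tensor f g) = tensor (u s f) (u s g).
Proof.
move=> bf bg; apply/funext => -[x y]; rewrite /averaging /tensor /plane_add/=.
have bfx := bounded_measurable_shift x bf; have bgy := bounded_measurable_shift y bg.
have bfg := bounded_measurable_tensor bfx bgy.
apply: etrans (Rintegral_prod (centered_gaussian s) (centered_gaussian s) bfg) _.
rewrite /tensor/= -/(u s g y).
under eq_Rintegral => a _.
  rewrite (RintegralZl _ _ (bounded_measurable_integrable _ bgy))//.
  over.
by rewrite (RintegralZr _ _ (bounded_measurable_integrable _ bfx)).
Qed.

Lemma iter_averaging_gaussian k s f g : 0 <= s -> bounded_measurable f ->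
  bounded_measurable g -> (forall x, 0 <= f x) -> (forall x, 0 <= g x) ->
  iter k (averaging (gaussian_plane s) plane_add) (tensor f g) =
  tensor (u (k%:R * s) f) (u (k%:R * s) g).
Proof.
move=> s0 bf bg f0 g0; elim: k => [|k ih]/=.
  by rewrite mul0r !gaussian_smoothing0.
rewrite ih averaging_gaussian_tensor; try exact: bounded_measurable_gaussian_smoothing.
have ks0 : 0 <= k%:R * s by rewrite mulr_ge0.
rewrite (gaussian_smoothingD s0 ks0 bf f0) (gaussian_smoothingD s0 ks0 bg g0).
have sk : k.+1%:R * s = s + k%:R * s by rewrite -natr1 mulrDl mul1r addrC.
by rewrite sk; congr tensor.
Qed.

(** 161 = 64 + 96 + 1: the remainder of the first factor, that of the second one multiplied by at
    most 3 C / 2, and the mixed term of order s^2, which s <= 1 puts below s sqrt s. *)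
Lemma gaussian_plane_expansion psi psi1 psi2 phi phi1 phi2 C s x y :
  0 <= s <= 1 -> taylor3 psi psi1 psi2 C -> taylor3 phi phi1 phi2 C ->
  `|u s psi x * u s phi y - psi x * phi y -
    (psi2 x * phi y / 2 * s + psi x * phi2 y / 2 * s)|
  <= 161 * C ^+ 2 * (s * Num.sqrt s).
Proof.
move=> /andP[s0 s1] tpsi tphi.
have e1 := gaussian_taylor x s0 tpsi; have e2 := gaussian_taylor y s0 tphi.
have [mpsi _ _ bpsi _] := tpsi; have [mphi _ _ bphi _] := tphi.
have [a0 _ a2] := bpsi x; have [b0 _ b2] := bphi y.
have C0 : 0 <= C by exact: le_trans a0.
have uphi : `|u s phi y| <= C.
  by apply: gaussian_smoothing_le => // z; have [] := bphi z.
rewrite -/(u s psi x) -/(u s phi y) in e1 e2.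
set c := s * Num.sqrt s in e1 e2 *.
have c0 : 0 <= c by rewrite mulr_ge0.
set r1 := _ - _ - _ in e1; set r2 := _ - _ - _ in e2.
have -> : u s psi x * u s phi y - psi x * phi y -
    (psi2 x * phi y / 2 * s + psi x * phi2 y / 2 * s) =
  r1 * u s phi y + (psi x + psi2 x * (s / 2)) * r2 + psi2 x * phi2 y * (s ^+ 2 / 4).
  by rewrite /r1 /r2; field.
have h1 : `|r1 * u s phi y| <= C * (64 * c) * C by rewrite normrM ler_pM.
have s20 : 0 <= s / 2 by rewrite divr_ge0.
have h2 : `|(psi x + psi2 x * (s / 2)) * r2| <= (C + C * (1 / 2)) * (C * (64 * c)).
  rewrite normrM ler_pM//; apply: (le_trans (ler_normD _ _)); apply: lerD => //.
  by rewrite normrM ler_pM// ger0_norm// ler_wpM2r.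
have sc : s ^+ 2 <= c.
  rewrite expr2 /c ler_wpM2l// -[leLHS]sqr_sqrtr// expr2 ler_piMl//.
  by rewrite -sqrtr1 ler_wsqrtr.
have h3 : `|psi2 x * phi2 y * (s ^+ 2 / 4)| <= C * C * c.
  rewrite 2!normrM (@ger0_norm _ (s ^+ 2 / 4)) ?divr_ge0 ?sqr_ge0//.
  have s40 : s ^+ 2 / 4 <= c by have := sqr_ge0 s; lra.
  by rewrite ler_pM// ?mulr_ge0// ?divr_ge0 ?sqr_ge0// ler_pM.
apply: (le_trans (ler_normD _ _)).
apply: (@le_trans _ _ (C * (64 * c) * C + (C + C * (1 / 2)) * (C * (64 * c)) + C * C * c)).
  by apply: lerD => //; apply: (le_trans (ler_normD _ _)); exact: lerD.
have : 0 <= C ^+ 2 * c by rewrite mulr_ge0// sqr_ge0.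
by lra.
Qed.

End gaussian_averaging.

(** * Lindeberg's theorem for planar arrays with truncated moments *)

Section central_limit.
Context (R : realType) d (S : measurableType d) (mu : probability S R).
Local Notation mR := (measurableTypeR R).
Local Notation V := (mR * mR)%type.
Variables (A B : nat -> S -> R) (Tr : nat -> set S) (s2 : R).

Definition plane_shift (n : nat) (z : V * S) : V :=
  ((z.1.1 + A n z.2)%R, (z.1.2 + B n z.2)%R).

Hypotheses (mA : forall n, measurable_fun setT (A n))
  (mB : forall n, measurable_fun setT (B n)).
Hypotheses (iA : forall n, mu.-integrable setT (EFin \o A n))
  (iB : forall n, mu.-integrable setT (EFin \o B n)).
Hypotheses (A0 : forall n, \int[mu]_s A n s = 0)
  (B0 : forall n, \int[mu]_s B n s = 0).
Hypothesis mTr : forall n, measurable (Tr n).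
Hypothesis TrAB : \forall n \near \oo, forall s, Tr n s -> `|A n s| <= 1 /\ `|B n s| <= 1.
Hypothesis s20 : 0 <= s2.
Hypothesis varA : n%:R * \int[mu]_(s in Tr n) (A n s ^+ 2) @[n --> \oo] --> s2.
Hypothesis varB : n%:R * \int[mu]_(s in Tr n) (B n s ^+ 2) @[n --> \oo] --> s2.
Hypothesis covAB : n%:R * \int[mu]_(s in Tr n) (A n s * B n s) @[n --> \oo] --> (0 : R).
Hypothesis third : n%:R * \int[mu]_(s in Tr n) (`|A n s| + `|B n s|) ^+ 3
  @[n --> \oo] --> (0 : R).
Hypothesis tail : n%:R * \int[mu]_(s in ~` Tr n) (1 + `|A n s| + `|B n s|)
  @[n --> \oo] --> (0 : R).

Lemma measurable_plane_shift n : measurable_fun setT (plane_shift n).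
Proof.
apply: measurable_fun_pair; apply: measurable_funD.
- by apply: (measurableT_comp (@measurable_fst _ _ mR mR)).
- exact: (measurableT_comp (mA n)).
- by apply: (measurableT_comp (@measurable_snd _ _ mR mR)).
- exact: (measurableT_comp (mB n)).
Qed.

(** Gaussian steps of variance s2 / n compose to variance exactly s2, so the limit already equals
    the n-fold Gaussian average. Replacing the actual steps by these costs at most n times the
    one-step discrepancy. *)
Lemma iter_averaging_clt psi psi1 psi2 phi phi1 phi2 C :
  taylor3 psi psi1 psi2 C -> taylor3 phi phi1 phi2 C ->
  (forall x, 0 <= psi x) -> (forall x, 0 <= phi x) ->
  iter n (averaging mu (plane_shift n)) (tensor psi phi) (0, 0) @[n --> \oo] -->
  \int[gaussian_plane s2]_v tensor psi phi v.
Proof.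
move=> tpsi tphi psi0 phi0.
have [mpsi _ _ bpsi _] := tpsi; have [mphi _ _ bphi _] := tphi.
have bmpsi : bounded_measurable psi by split => //; exists C => x; have [] := bpsi x.
have bmphi : bounded_measurable phi by split => //; exists C => x; have [] := bphi x.
have bmF := bounded_measurable_tensor bmpsi bmphi.
pose a11 n := \int[mu]_(s in Tr n) (A n s ^+ 2).
pose a22 n := \int[mu]_(s in Tr n) (B n s ^+ 2).
pose a12 n := \int[mu]_(s in Tr n) (A n s * B n s).
pose t3 n := \int[mu]_(s in Tr n) (`|A n s| + `|B n s|) ^+ 3.
pose tl n := \int[mu]_(s in ~` Tr n) (1 + `|A n s| + `|B n s|).
pose sn n := s2 / n%:R.
(* The one-step discrepancy: Taylor remainder of the actual step, mismatch of the second moments,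
   Taylor remainder of the Gaussian step. It is o(1 / n). *)
pose e n := 6 * C ^+ 2 * (t3 n + tl n) + C ^+ 2 / 2 * `|a11 n - sn n| +
  C ^+ 2 / 2 * `|a22 n - sn n| + C ^+ 2 * `|a12 n| +
  161 * C ^+ 2 * (sn n * Num.sqrt (sn n)).
have sqn0 : Num.sqrt (sn n) @[n --> \oo] --> (0 : R).
  rewrite -[X in _ --> X]sqrtr0; apply: continuous_cvg; first exact: sqrt_continuous.
  rewrite -[X in _ --> X](mulr0 s2); apply: cvgM; first exact: cvg_cst.
  have npos : \forall n \near \oo, 0 < n%:R :> R.
    by near=> n; rewrite ltr0n; near: n; exact: nbhs_infty_gt.
  exact: (gtr0_cvgV0 npos).2 cvgr_idn.
have ne0 : n%:R * e n @[n --> \oo] --> (0 : R).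
  have lim0 : 6 * C ^+ 2 * (n%:R * t3 n + n%:R * tl n) +
      C ^+ 2 / 2 * `|n%:R * a11 n - s2| + C ^+ 2 / 2 * `|n%:R * a22 n - s2| +
      C ^+ 2 * `|n%:R * a12 n| + 161 * C ^+ 2 * (s2 * Num.sqrt (sn n))
      @[n --> \oo] --> 6 * C ^+ 2 * (0 + 0) + C ^+ 2 / 2 * `|s2 - s2| +
      C ^+ 2 / 2 * `|s2 - s2| + C ^+ 2 * `|0 : R| + 161 * C ^+ 2 * (s2 * 0).
    apply: cvgD; last first.
      apply: cvgM; first exact: cvg_cst.
      by apply: cvgM => //; exact: cvg_cst.
    apply: cvgD; last first.
      by apply: cvgM; [exact: cvg_cst|exact: cvg_norm].
    apply: cvgD; last first.
      apply: cvgM; first exact: cvg_cst.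
      by apply: cvg_norm; apply: cvgB => //; exact: cvg_cst.
    apply: cvgD; last first.
      apply: cvgM; first exact: cvg_cst.
      by apply: cvg_norm; apply: cvgB => //; exact: cvg_cst.
    by apply: cvgM; [exact: cvg_cst|exact: cvgD].
  rewrite !subrr normr0 addr0 !mulr0 !addr0 in lim0.
  apply: cvg_trans lim0; apply: near_eq_cvg; near=> n.
  have n0 : 0 < n%:R :> R by rewrite ltr0n; near: n; exact: nbhs_infty_gt.
  have nsn : n%:R * sn n = s2 by rewrite /sn mulrC divfK// gt_eqF.
  have nn (z : R) : n%:R * `|z| = `|n%:R * z| by rewrite normrM (ger0_norm (ltW n0)).
  rewrite /e -[in X in `|_ * a11 n - X|]nsn -[in X in `|_ * a22 n - X|]nsn.
  rewrite -!mulrBr -!nn -[in X in X * Num.sqrt (sn n)]nsn; ring.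
have UE n : (0 < n)%N ->
    iter n (averaging (gaussian_plane (sn n)) (@plane_add R)) (tensor psi phi) (0, 0) =
    \int[gaussian_plane s2]_v tensor psi phi v.
  move=> n0; have nR0 : 0 < n%:R :> R by rewrite ltr0n.
  rewrite iter_averaging_gaussian ?divr_ge0// /sn mulrC divfK ?gt_eqF//.
  rewrite -averaging_gaussian_tensor// /averaging.
  by apply: eq_Rintegral => -[a b] _; rewrite /plane_add/= !add0r.
apply/cvgrPdist_le => eps eps0; near=> n.
have n0 : (0 < n)%N by near: n; exact: nbhs_infty_gt.
have nR0 : 0 < n%:R :> R by rewrite ltr0n.
have TrAB' : forall s, Tr n s -> `|A n s| <= 1 /\ `|B n s| <= 1 by near: n.
have sn0 : 0 <= sn n by rewrite divr_ge0.
have sn1 : sn n <= 1.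
  rewrite ler_pdivrMr// mul1r; near: n; exact: nbhs_infty_ger.
rewrite -(UE n n0) distrC.
apply: (@le_trans _ _ (n%:R * e n)); last first.
  apply: (le_trans (ler_norm _)); rewrite -normrN -[X in `|X|]add0r.
  by near: n; move/cvgrPdist_le : ne0 => /(_ _ eps0).
apply: iter_averaging_replacement => //.
- exact: measurable_plane_shift.
- exact: measurable_plane_add.
- by move=> [x y] s [a b]; rewrite /plane_shift/plane_add/= addrAC [y + _ + _]addrAC.
move=> [x y]; rewrite averaging_gaussian_tensor//.
have h1 := one_step_expansion (mA n) (mB n) (iA n) (iB n) (A0 n) (B0 n) (mTr n)
  (fun s Ts => (TrAB' s Ts).1) (fun s Ts => (TrAB' s Ts).2) tpsi tphi x y.
have sn01 : 0 <= sn n <= 1 by rewrite sn0.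
have h2 := gaussian_plane_expansion x y sn01 tpsi tphi.
rewrite -/(a11 n) -/(a22 n) -/(a12 n) -/(t3 n) -/(tl n) in h1.
rewrite /averaging /tensor /plane_shift/=.
set TF := \int[mu]_s _ in h1 *.
set UF := _ * gaussian_smoothing _ phi y in h2 *.
have [p0 p1 p2] := bpsi x; have [q0 q1 q2] := bphi y.
have CC (z w : R) : `|z| <= C -> `|w| <= C -> `|z * w| <= C ^+ 2.
  by move=> zC wC; rewrite normrM expr2 ler_pM.
have CC2 (z w : R) : `|z| <= C -> `|w| <= C -> `|z * w / 2| <= C ^+ 2 / 2.
  by move=> zC wC; rewrite normrM normfV (@ger0_norm _ 2)// ler_wpM2r ?invr_ge0// CC.
have -> : TF - UF = (TF - psi x * phi y - (psi2 x * phi y / 2 * a11 n +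
    psi x * phi2 y / 2 * a22 n + psi1 x * phi1 y * a12 n)) +
  psi2 x * phi y / 2 * (a11 n - sn n) + psi x * phi2 y / 2 * (a22 n - sn n) +
  psi1 x * phi1 y * a12 n - (UF - psi x * phi y -
    (psi2 x * phi y / 2 * sn n + psi x * phi2 y / 2 * sn n)) by ring.
apply: (le_trans (ler_normB _ _)); apply: lerD => //.
apply: (le_trans (ler_normD _ _)); apply: lerD; last first.
  by rewrite normrM ler_wpM2r// CC.
apply: (le_trans (ler_normD _ _)); apply: lerD; last first.
  by rewrite normrM ler_wpM2r// CC2.
apply: (le_trans (ler_normD _ _)); apply: lerD => //.
by rewrite normrM ler_wpM2r// CC2.
Unshelve. all: by end_near. Qed.

End central_limit.

(** * Moments of the inverse distance to the center *)

Lemma measurable_set_le d (T : measurableType d) (R : realType) (f g : T -> R) :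
  measurable_fun setT f -> measurable_fun setT g -> measurable [set x | f x <= g x].
Proof.
move=> mf mg; have mgf : measurable_fun setT (fun x => g x - f x) by exact: measurable_funB.
rewrite (_ : [set x | _] = (fun x => g x - f x) @^-1` `[0, +oo[%classic).
  by rewrite -[X in measurable X]setTI; exact: mgf.
by apply/seteqP; split=> x/=; rewrite in_itv/= andbT subr_ge0.
Qed.

Lemma measurable_set_lt d (T : measurableType d) (R : realType) (f g : T -> R) :
  measurable_fun setT f -> measurable_fun setT g -> measurable [set x | f x < g x].
Proof.
move=> mf mg; rewrite (_ : [set x | _] = ~` [set x | g x <= f x]).
  by apply: measurableC; exact: measurable_set_le.
by apply/seteqP; split=> x/=; rewrite ltNge => /negP.
Qed.

Lemma measurable_invr (R : realType) : measurable_fun setT (@GRing.inv R).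
Proof.
rewrite -(setvU [set (0 : R)]); apply/measurable_funU => //.
  by apply: measurableC.
split; last exact: measurable_fun_set1.
apply: open_continuous_measurable_fun.
  by apply: closed_openC; exact: closed_eq.
by move=> x; rewrite inE/= => /eqP x0; exact: inv_continuous.
Qed.

Section one_dimensional_integrals.
Context (R : realType).
Local Notation mR := (measurableTypeR R).
Local Notation leb := (@lebesgue_measure R).

Let continuous_cauchy (c : R) : 0 < c -> continuous (fun y : R => (c ^+ 2 + y ^+ 2)^-1).
Proof.
move=> c0 y; have D0 : c ^+ 2 + y ^+ 2 != 0.
  by rewrite gt_eqF// ltr_wpDr ?sqr_ge0// exprn_gt0.
apply: cvgV => //; apply: cvgD; first exact: cvg_cst.
exact: exprn_continuous.
Qed.

Lemma integral_cauchy (c : R) : 0 < c ->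
  (\int[leb]_y ((c ^+ 2 + y ^+ 2)^-1)%:E = (pi / c)%:E)%E.
Proof.
move=> c0; have D0 y : 0 < c ^+ 2 + y ^+ 2.
  by rewrite ltr_wpDr ?sqr_ge0// exprn_gt0.
rewrite ge0_symfun_integralT//; last 3 first.
- by move=> x; rewrite invr_ge0 ltW.
- exact: continuous_cauchy.
- by move=> x /=; rewrite sqrrN.
have -> : [set x : R | (0 <= x)%R] = `[0, +oo[%classic.
  by apply/seteqP; split=> x/=; rewrite in_itv/= andbT.
pose F (y : R) := atan (y / c) / c.
have dF (y : R) : is_derive y 1 F ((c ^+ 2 + y ^+ 2)^-1).
  have -> : (c ^+ 2 + y ^+ 2)^-1 = (1 + (y / c) ^+ 2)^-1 * (c^-1) * c^-1.
    rewrite -!invfM; congr (_^-1); field; exact: lt0r_neq0.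
  have d1 : is_derive y 1 (fun t : R => t * c^-1) c^-1.
    have := @is_deriveM _ _ id (cst c^-1) y 1 _ _ (is_derive_id _ _) (is_derive_cst _ _ _).
    by move=> h; apply: (is_derive_eq h); rewrite /= scaler0 add0r /GRing.scale/= mulr1.
  have d2 := @is_derive1_comp _ (@atan R) (fun t => t * c^-1) y _ _ (is_derive1_atan (y / c)) d1.
  have := @is_deriveM _ _ _ (cst c^-1) y 1 _ _ d2 (is_derive_cst _ _ _).
  by move=> h; apply: (is_derive_eq h); rewrite /= scaler0 add0r /GRing.scale/= mulrC.
rewrite (@ge0_continuous_FTC2y _ _ F 0 (pi / 2 / c)).
- rewrite /F mul0r atan0 mul0r sube0 -EFinM; congr EFin; field; exact: lt0r_neq0.
- by move=> x _; rewrite invr_ge0 ltW.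
- exact: continuous_subspaceT (continuous_cauchy c0).
- apply: cvgM; last exact: cvg_cst.
  apply: (cvg_comp _ _ _ (@cvgy_atan R)).
  apply: gt0_cvgMly; last exact: cvg_id.
  by rewrite invr_gt0.
- by move=> x _; have [] := dF x.
- apply: cvg_at_right_filter; apply: differentiable_continuous.
  by apply/derivable1_diffP; have [] := dF 0.
- by move=> x _; rewrite derive1E; have [] := dF x.
Qed.

Lemma integral_inv_itv (a b : R) : 0 < a -> a < b ->
  (\int[leb]_(x in `[a, b]) (x^-1)%:E = (ln b - ln a)%:E)%E.
Proof.
move=> a0 ab; rewrite (@continuous_FTC2 _ _ (@ln R) a b ab) ?EFinB//.
- apply: continuous_in_subspaceT => x; rewrite inE/= in_itv/= => /andP[ax _].
  by apply: inv_continuous; rewrite gt_eqF// (lt_le_trans a0).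
- have cln x : 0 < x -> {for x, continuous (@ln R)} by exact: continuous_ln.
  split.
  + by move=> x; rewrite in_itv/= => /andP[ax _]; apply: ex_derive; apply: is_derive1_ln; exact: lt_trans ax.
  + by apply: cvg_at_right_filter; exact: cln.
  + by apply: cvg_at_left_filter; apply: cln; exact: lt_trans ab.
- move=> x; rewrite in_itv/= => /andP[ax _]; rewrite derive1E.
  by have [_] := is_derive1_ln (lt_trans a0 ax).
Qed.

Lemma integral_inv_sqr (a : R) : 0 < a ->
  (\int[leb]_(x in `[a, +oo[) (x ^- 2)%:E = (a^-1)%:E)%E.
Proof.
move=> a0; pose F (x : R) := - x^-1.
have dF (x : R) : 0 < x -> is_derive x 1 F (x ^- 2).
  move=> x0; have x0' : x != 0 by rewrite gt_eqF.
  have := is_deriveN (@is_deriveV _ id x 1 _ x0' (is_derive_id _ _)).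
  by move=> h; apply: (is_derive_eq h); rewrite /= scaleNr opprK /GRing.scale/= mulr1.
have cF (x : R) : 0 < x -> {for x, continuous F}.
  move=> x0; apply: differentiable_continuous.
  by apply/derivable1_diffP; have [] := dF x x0.
rewrite (@ge0_continuous_FTC2y _ _ F a 0).
- by rewrite /F sub0e -EFinN opprK.
- by move=> x ax; rewrite invr_ge0 exprn_ge0// (le_trans (ltW a0)).
- apply: continuous_in_subspaceT => x; rewrite inE/= in_itv/= andbT => ax.
  have x0 : x != 0 by rewrite gt_eqF// (lt_le_trans a0).
  by apply: cvgV; [rewrite expf_neq0|exact: exprn_continuous].
- rewrite -oppr0; apply: cvgN.
  have p0 : \forall x \near +oo, (0 : R) < x by exact: nbhs_pinfty_gt.
  exact: (gtr0_cvgV0 p0).2 cvg_id.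
- by move=> x ax; have [] := dF x (lt_trans a0 ax).
- by apply: cvg_at_right_filter; exact: cF.
- move=> x; rewrite in_itv/= andbT => ax; rewrite derive1E.
  by have [] := dF x (lt_trans a0 ax).
Qed.

End one_dimensional_integrals.

(** * Integrals over annuli in the plane *)

Section plane_integrals.
Context (R : realType).
Local Notation mR := (measurableTypeR R).
Local Notation V := (mR * mR)%type.
Local Notation leb := (@lebesgue_measure R).
Local Notation leb2 := (leb \x leb)%E.

Let mp1 : measurable_fun setT (fun v : V => v.1 : mR).
Proof. exact: measurable_fst. Qed.

Let mp2 : measurable_fun setT (fun v : V => v.2 : mR).
Proof. exact: measurable_snd. Qed.

Section invariance.
Local Open Scope ereal_scope.
Variable f : V -> \bar R.
Hypotheses (mf : measurable_fun setT f) (f0 : forall v, 0 <= f v).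

Let mpair (p q : V -> mR) : measurable_fun setT p -> measurable_fun setT q ->
  measurable_fun setT (fun v => f (p v, q v)).
Proof.
by move=> mp mq; apply: (measurableT_comp mf); exact: measurable_fun_pair.
Qed.

Lemma integral_plane_swap : \int[leb2]_v f (v.2, v.1) = \int[leb2]_v f v.
Proof.
have mg := mpair mp2 mp1.
apply: etrans (@fubini_tonelli1 _ _ _ _ _ leb leb _ mg (fun v => f0 _)) _.
exact: esym (@fubini_tonelli2 _ _ _ _ _ leb leb _ mf f0).
Qed.

Lemma integral_plane_reflect : \int[leb2]_v f (- v.1, v.2)%R = \int[leb2]_v f v.
Proof.
have mN : measurable_fun setT (fun v : V => (- v.1)%R : mR).
  exact: measurableT_comp mp1.
have mg := mpair mN mp2.
apply: etrans (@fubini_tonelli2 _ _ _ _ _ leb leb _ mg (fun v => f0 _)) _.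
apply: etrans _ (esym (@fubini_tonelli2 _ _ _ _ _ leb leb _ mf f0)).
apply: eq_integral => y _.
apply: (@ge0_integral_lebesgueN _ (fun x : R => f (x, y))) => //.
exact: measurableT_comp mf _.
Qed.

End invariance.

Let ge0_integral_lebesgueBl (c : R) (g : R -> \bar R) :
  measurable_fun setT g -> (forall x, 0 <= g x)%E ->
  (\int[leb]_x g (c - x)%R = \int[leb]_x g x)%E.
Proof.
move=> mg g0; rewrite -[RHS](ge0_integral_lebesgueD c)// -[RHS]ge0_integral_lebesgueN//.
  by apply: eq_integral => x _; rewrite addrC.
by apply: measurableT_comp mg _; exact: measurable_funD.
Qed.

Lemma integral_plane_affine (c1 c2 : R) (f : V -> \bar R) :
  measurable_fun setT f -> (forall v, 0 <= f v)%E ->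
  (\int[leb2]_v f ((c1 - v.1)%R, (c2 - v.2)%R) = \int[leb2]_v f v)%E.
Proof.
move=> mf f0.
have mg : measurable_fun setT (fun v : V => f ((c1 - v.1)%R, (c2 - v.2)%R)).
  apply: (measurableT_comp mf); apply: measurable_fun_pair.
  - exact: (measurable_funB (measurable_cst c1) mp1).
  - exact: (measurable_funB (measurable_cst c2) mp2).
apply: etrans (@fubini_tonelli1 _ _ _ _ _ leb leb _ mg (fun v => f0 _)) _.
apply: etrans _ (esym (@fubini_tonelli1 _ _ _ _ _ leb leb _ mf f0)).
rewrite /fubini_F/=.
have mF : measurable_fun setT (fun x : mR => \int[leb]_y f (x, y))%E.
  exact: (@measurable_fun_fubini_tonelli_F _ _ _ _ _ leb f).
have F0 (x : mR) : (0 <= \int[leb]_y f (x, y))%E by exact: integral_ge0.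
rewrite -(ge0_integral_lebesgueBl c1 mF F0).
apply: eq_integral => x _.
apply: (@ge0_integral_lebesgueBl c2 (fun y => f ((c1 - x)%R, y))) => //.
exact: measurableT_comp mf _.
Qed.

Definition normsq (v : V) : R := v.1 ^+ 2 + v.2 ^+ 2.

Definition annulus (a b : R) : set V := [set v | a ^+ 2 <= normsq v /\ normsq v <= b ^+ 2].

Lemma measurable_normsq : measurable_fun setT normsq.
Proof.
by apply: measurable_funD; apply: measurable_funX; [exact: measurable_fst|exact: measurable_snd].
Qed.

Lemma measurable_annulus a b : measurable (annulus a b).
Proof.
rewrite (_ : annulus a b = [set v | a ^+ 2 <= normsq v] `&` [set v | normsq v <= b ^+ 2])//.
by apply: measurableI; apply: measurable_set_le => //; exact: measurable_normsq.
Qed.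

Let measurable_inv (f : V -> R) : measurable_fun setT f -> measurable_fun setT (fun v => (f v)^-1).
Proof. by move=> mf; apply: (measurableT_comp _ mf); exact: measurable_invr. Qed.

(** In polar coordinates this is 2 pi ln (b / a). It is evaluated only up to an additive 4 pi, by
    comparing the annulus with the vertical strips a <= |x| <= b, where Fubini leads to an
    arctangent and a logarithm. A bounded error is harmless against ln n. *)
Definition log_mass (a b : R) : \bar R :=
  (\int[leb2]_v (\1_(annulus a b) v / normsq v)%:E)%E.

Let strip (a b : R) : set mR := [set x | a <= `|x| /\ `|x| <= b].

Let measurable_strip a b : measurable (strip a b).
Proof.
rewrite (_ : strip a b = [set x : mR | a <= `|x|] `&` [set x : mR | `|x| <= b])//.
by apply: measurableI; apply: measurable_set_le => //; exact: normr_measurable.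
Qed.

Let normsq_ge0 v : 0 <= normsq v.
Proof. by rewrite addr_ge0 ?sqr_ge0. Qed.

Let measurable_1D a b : measurable_fun setT (fun v : V => (\1_(annulus a b) v / normsq v)%:E).
Proof.
apply/measurable_EFinP; apply: measurable_funM.
  by apply: measurable_indic; exact: measurable_annulus.
by apply: measurable_inv; exact: measurable_normsq.
Qed.

Let measurable_1S a b : measurable_fun setT (fun v : V => (\1_(strip a b) v.1 / normsq v)%:E).
Proof.
apply/measurable_EFinP; apply: measurable_funM.
  have m1 : measurable_fun setT (\1_(strip a b) : mR -> R).
    by apply: measurable_indic; exact: measurable_strip.
  by apply: (measurableT_comp m1); exact: measurable_fst.
by apply: measurable_inv; exact: measurable_normsq.
Qed.

(** Dominates |v|^-2 where |x| <= c <= |v|, since there 2 |v|^2 >= c^2 + y^2. By scale invariance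
    its integral does not depend on [c]. *)
Let tube (c : R) (v : V) : R := \1_(strip 0 c) v.1 * (2 * (c ^+ 2 + v.2 ^+ 2)^-1).

Let measurable_tube c : measurable_fun setT (fun v : V => (tube c v)%:E).
Proof.
apply/measurable_EFinP; apply: measurable_funM.
  have m1 : measurable_fun setT (\1_(strip 0 c) : mR -> R).
    by apply: measurable_indic; exact: measurable_strip.
  by apply: (measurableT_comp m1); exact: measurable_fst.
apply: measurable_funM => //; apply: measurable_inv; apply: measurable_funD => //.
by apply: measurable_funX; exact: measurable_snd.
Qed.

Let tube_ge0 c v : 0 <= tube c v.
Proof.
by rewrite /tube mulr_ge0// mulr_ge0// invr_ge0 addr_ge0// sqr_ge0.
Qed.

Let cauchy_measurable (c k : R) : measurable_fun setT (fun y : mR => ((c ^+ 2 + y ^+ 2)^-1)%:E).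
Proof.
apply/measurable_EFinP; apply: (measurableT_comp (@measurable_invr R)).
by apply: measurable_funD => //; exact: measurable_funX.
Qed.

Let integral_tube c : 0 < c -> (\int[leb2]_v (tube c v)%:E = (4 * pi)%:E)%E.
Proof.
move=> c0.
rewrite (@fubini_tonelli1 _ _ _ _ _ leb leb (fun v => (tube c v)%:E) (measurable_tube c));
  last by move=> v; rewrite lee_fin.
rewrite /fubini_F.
transitivity (\int[leb]_x ((\1_(strip 0 c) x)%:E * (2 * (pi / c))%:E)%E)%E.
  apply: eq_integral => x _; rewrite /tube/=.
  under eq_integral do rewrite EFinM.
  rewrite ge0_integralZl//; last 2 first.
  - apply/measurable_EFinP; apply: measurable_funM => //.
    by apply/measurable_EFinP; exact: cauchy_measurable.
  - by move=> y _; rewrite lee_fin mulr_ge0// invr_ge0 addr_ge0// sqr_ge0.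
  congr (_ * _)%E; under eq_integral do rewrite EFinM.
  rewrite ge0_integralZl//; last 2 first.
  - exact: cauchy_measurable.
  - by move=> y _; rewrite lee_fin invr_ge0 addr_ge0// sqr_ge0.
  by rewrite integral_cauchy.
rewrite ge0_integralZr//; last 2 first.
- by apply/measurable_EFinP; apply: measurable_indic; exact: measurable_strip.
- by rewrite lee_fin mulr_ge0// divr_ge0 ?pi_ge0// ltW.
have mS := measurable_strip 0 c.
rewrite integral_indic//.
have -> : strip 0 c `&` setT = `[(- c), c]%classic.
  apply/seteqP; split=> x /=.
    by move=> [[_ +] _]; rewrite in_itv/= ler_norml.
  by rewrite in_itv/= -ler_norml => xc; do 2 split.
rewrite /= lebesgue_measure_itv/= lte_fin gtrN// -EFinD -EFinM; congr EFin.
by field; rewrite gt_eqF.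
Qed.

(** For fixed x the integral in y is pi / |x|; the two signs of x contribute pi ln (b / a) each. *)
Let integral_strip a b : 0 < a -> a < b ->
  (\int[leb2]_v (\1_(strip a b) v.1 / normsq v)%:E = (2 * pi * (ln b - ln a))%:E)%E.
Proof.
move=> a0 ab.
rewrite (@fubini_tonelli1 _ _ _ _ _ leb leb _ (measurable_1S a b));
  last by move=> v; rewrite lee_fin mulr_ge0// invr_ge0.
rewrite /fubini_F.
pose g (x : R) : \bar R := (\1_(`[a, b]%classic : set mR) x * (pi * x^-1))%:E.
have mg : measurable_fun setT g.
  apply/measurable_EFinP; apply: measurable_funM; first exact: measurable_indic.
  apply: measurable_funM => //; exact: measurable_invr.
have g0 x : (0 <= g x)%E.
  rewrite lee_fin indicE; have [|_] := boolP (x \in _); last by rewrite mul0r.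
  rewrite inE/= in_itv/= => /andP[ax _]; rewrite mul1r mulr_ge0 ?pi_ge0//.
  by rewrite invr_ge0 (le_trans (ltW a0)).
transitivity (\int[leb]_x (g x + g (- x)%R))%E.
  apply: eq_integral => x _ /=; rewrite /g /normsq/=.
  have xin (y : R) : (y \in (`[a, b]%classic : set mR)) = (a <= y <= b).
    by apply/idP/idP; rewrite inE/= in_itv.
  have xst : (x \in strip a b) = (a <= `|x| <= b).
    by apply/idP/idP; rewrite inE/= => /andP.
  rewrite !indicE !xin xst -EFinD.
  have [x0|x0|x0] := ltgtP x 0.
  - rewrite ltr0_norm// [a <= x]leNgt (lt_trans x0 a0)/= mul0r add0r.
    case: (a <= - x <= b) => /=; last first.
      by rewrite mul0r integral0_eq// => y _; rewrite mul0r.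
    under eq_integral do rewrite mul1r -sqrrN.
    by rewrite integral_cauchy ?oppr_gt0// mul1r.
  - rewrite gtr0_norm// [a <= - x]leNgt (_ : - x < a); last first.
      by rewrite (lt_trans _ a0)// oppr_lt0.
    rewrite /= mul0r addr0; case: (a <= x <= b) => /=; last first.
      by rewrite mul0r integral0_eq// => y _; rewrite mul0r.
    under eq_integral do rewrite mul1r.
    by rewrite integral_cauchy// mul1r.
  - rewrite x0 normr0 oppr0 leNgt a0/= !mul0r addr0.
    by rewrite integral0_eq// => y _; rewrite mul0r.
rewrite ge0_integralD//; last first.
  by apply: measurableT_comp mg _.
rewrite (ge0_integral_lebesgueN mg g0).
have -> : (\int[leb]_x g x = (pi * (ln b - ln a))%:E)%E.
  transitivity (\int[leb]_(x in `[a, b]) (pi * x^-1)%:E)%E.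
    rewrite [RHS]integral_mkcond; apply: eq_integral => x _.
    by rewrite /g epatch_indic/= mulrC EFinM.
  under eq_integral do rewrite EFinM.
  rewrite ge0_integralZl//.
  - by rewrite integral_inv_itv.
  - by apply/measurable_EFinP; apply: measurable_funTS; exact: measurable_invr.
  - move=> x /=; rewrite in_itv/= => /andP[ax _].
    by rewrite lee_fin invr_ge0 (le_trans (ltW a0)).
  - by rewrite lee_fin pi_ge0.
by rewrite -EFinD; congr EFin; ring.
Qed.

Let inv_le_tube c v : 0 < c -> `|v.1| <= c -> c ^+ 2 <= normsq v ->
  (normsq v)^-1 <= tube c v.
Proof.
move=> c0 vc nv; have sv : strip 0 c v.1 by split => //; exact: normr_ge0.
rewrite /tube (indic_mem sv).
have c20 : 0 < c ^+ 2 by rewrite exprn_gt0.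
have n0 : 0 < normsq v by rewrite (lt_le_trans c20).
have q0 : 0 < c ^+ 2 + v.2 ^+ 2 by rewrite ltr_wpDr// sqr_ge0.
rewrite mul1r ler_pdivlMr// mulrC ler_pdivrMr//.
have : v.2 ^+ 2 <= normsq v by rewrite /normsq lerDr sqr_ge0.
lra.
Qed.

Let sqr_le_normsq a v : 0 <= a -> a <= `|v.1| -> a ^+ 2 <= normsq v.
Proof.
move=> a0 av; rewrite (@le_trans _ _ (v.1 ^+ 2))//; last by rewrite /normsq lerDl sqr_ge0.
by rewrite -[leRHS]ger0_norm ?sqr_ge0// normrX lerXn2r// nnegrE.
Qed.

Let normsq_le_abs b v : 0 <= b -> normsq v <= b ^+ 2 -> `|v.1| <= b.
Proof.
move=> b0 nv; rewrite -(ler_pXn2r (n := 2))// ?nnegrE// -normrX ger0_norm ?sqr_ge0//.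
by apply: le_trans nv; rewrite /normsq lerDl sqr_ge0.
Qed.

(** The points of the annulus outside the strips have |x| < a <= |v|, where [tube a] takes over. *)
Lemma log_mass_le a b : 0 < a -> a < b ->
  (log_mass a b <= (2 * pi * (ln b - ln a) + 4 * pi)%:E)%E.
Proof.
move=> a0 ab; have b0 := lt_trans a0 ab.
rewrite EFinD -(integral_strip a0 ab) -(integral_tube a0) -ge0_integralD//.
- apply: ge0_le_integral => //.
  + by move=> v _; rewrite lee_fin mulr_ge0// invr_ge0.
  + by apply: emeasurable_funD; [exact: measurable_1S|exact: measurable_tube].
  + move=> v _; rewrite -EFinD lee_fin.
    have [[v1 v2]|nv] := pselect (annulus a b v); last first.
      by rewrite (indic_nmem nv) mul0r addr_ge0// mulr_ge0// invr_ge0.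
    rewrite (@indic_mem _ (annulus a b)); last by split.
    have [sv|nsv] := pselect (strip a b v.1).
      by rewrite (indic_mem sv) lerDl.
    rewrite (indic_nmem nsv) mul0r add0r mul1r inv_le_tube//.
    rewrite leNgt; apply/negP => va; apply: nsv; split; first exact: ltW.
    by apply: normsq_le_abs => //; exact: ltW.
- by move=> v _; rewrite lee_fin mulr_ge0// invr_ge0.
- by move=> v _; rewrite lee_fin.
Qed.

(** The points of the strips outside the annulus have |x| <= b < |v|, where [tube b] takes over. *)
Lemma log_mass_ge a b : 0 < a -> a < b ->
  ((2 * pi * (ln b - ln a))%:E <= log_mass a b + (4 * pi)%:E)%E.
Proof.
move=> a0 ab; have b0 := lt_trans a0 ab.
rewrite -(integral_strip a0 ab) -(integral_tube b0) -ge0_integralD//.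
- apply: ge0_le_integral => //.
  + by move=> v _; rewrite lee_fin mulr_ge0// invr_ge0.
  + by apply: emeasurable_funD; [exact: measurable_1D|exact: measurable_tube].
  + move=> v _; rewrite -EFinD lee_fin.
    have [[v1 v2]|nv] := pselect (strip a b v.1); last first.
      by rewrite (indic_nmem nv) mul0r addr_ge0// mulr_ge0// invr_ge0.
    rewrite (@indic_mem _ (strip a b)); last by split.
    have [sv|nsv] := pselect (annulus a b v).
      by rewrite (indic_mem sv) lerDl.
    rewrite (indic_nmem nsv) mul0r add0r mul1r inv_le_tube//.
    rewrite leNgt; apply/negP => vb; apply: nsv; split; last exact: ltW.
    by apply: sqr_le_normsq => //; exact: ltW.
- by move=> v _; rewrite lee_fin mulr_ge0// invr_ge0.
- by move=> v _; rewrite lee_fin.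
Qed.

End plane_integrals.

(** * The law of a zero near the center *)

Section complex_plane.
Context (R : realType).
Local Notation mR := (measurableTypeR R).
Local Notation V := (mR * mR)%type.
Local Notation leb2 := ((@lebesgue_measure R) \x (@lebesgue_measure R))%E.

Lemma measurable_reim : measurable_fun setT (@reim R).
Proof. by move=> _ B mB; rewrite setTI; exists B => //; rewrite setTI. Qed.

Lemma measurable_Re : measurable_fun setT (fun z : R[i] => complex.Re z : mR).
Proof. exact: measurableT_comp (@measurable_fst _ _ mR mR) measurable_reim. Qed.

Lemma measurable_Im : measurable_fun setT (fun z : R[i] => complex.Im z : mR).
Proof. exact: measurableT_comp (@measurable_snd _ _ mR mR) measurable_reim. Qed.

Lemma measurable_complex d (T : measurableType d) (f : T -> R[i]) :
  measurable_fun setT (fun w => complex.Re (f w) : mR) ->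
  measurable_fun setT (fun w => complex.Im (f w) : mR) -> measurable_fun setT f.
Proof.
move=> mre mim; have mp := measurable_fun_pair mre mim.
by move=> _ _ [B mB <-]; have := mp measurableT B mB; rewrite !setTI.
Qed.

(** The coordinates of u0 - z rather than z - u0, because the summands are 1 / (u0 - xi_k). *)
Definition to_plane (u0 z : R[i]) : V :=
  (complex.Re u0 - complex.Re z, complex.Im u0 - complex.Im z).

Lemma measurable_to_plane u0 : measurable_fun setT (to_plane u0).
Proof.
by apply: measurable_fun_pair; apply: measurable_funB => //;
  [exact: measurable_Re|exact: measurable_Im].
Qed.

Lemma normsq_to_plane (u0 z : R[i]) :
  `|z - u0| = (Num.sqrt (normsq (to_plane u0 z)))%:C.
Proof.
rewrite distrC normc_def /normsq/=; congr (Num.sqrt _)%:C.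
by case: u0 => a b; case: z => c e.
Qed.

Lemma closed_diskE (u0 z : R[i]) (r : R) : 0 <= r ->
  closed_disk u0 r z <-> normsq (to_plane u0 z) <= r ^+ 2.
Proof.
move=> r0; rewrite /closed_disk/= normsq_to_plane lecR.
by rewrite -(ler_sqrt _ (sqr_ge0 r)) sqrtr_sqr ger0_norm.
Qed.

Lemma measurable_closed_disk u0 r : measurable (@closed_disk R u0 r).
Proof.
have [r0|r0] := leP 0 r; last first.
  rewrite (_ : closed_disk u0 r = set0)//; apply/seteqP; split=> // z.
  rewrite /closed_disk/= normsq_to_plane lecR leNgt => /negP; apply.
  by rewrite (lt_le_trans r0)// sqrtr_ge0.
rewrite (_ : closed_disk u0 r = [set z | normsq (to_plane u0 z) <= r ^+ 2]).
  apply: measurable_set_le => //.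
  exact: (measurableT_comp (@measurable_normsq R) (measurable_to_plane u0)).
by apply/seteqP; split=> z /closed_diskE; exact.
Qed.

Lemma integral_complex_lebesgue u0 (f : V -> \bar R) :
  measurable_fun setT f -> (forall v, 0 <= f v)%E ->
  (\int[@complex_lebesgue R]_z f (to_plane u0 z) = \int[leb2]_v f v)%E.
Proof.
move=> mf f0; rewrite /complex_lebesgue.
have mg : measurable_fun setT (fun z => f (to_plane u0 z)).
  exact: (measurableT_comp mf (measurable_to_plane u0)).
apply: etrans (@ge0_integral_pushforward _ _ _ _ _ _ (@measurable_of_reim R) leb2
  setT _ measurableT mg (fun _ _ => f0 _)) _.
rewrite preimage_setT.
exact: (integral_plane_affine (complex.Re u0) (complex.Im u0) mf f0).
Qed.

Section law.
Variables (mu : probability R[i] R) (u0 : R[i]) (delta : R) (p : R[i] -> R).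
Hypothesis delta0 : 0 < delta.
Hypothesis hp : has_density_on (closed_disk u0 delta) mu p.
Hypothesis cp : {for u0, continuous (p : R[i]^o -> R)}.

Let D := @closed_disk R u0 delta.

Let mD : measurable D.
Proof. exact: measurable_closed_disk. Qed.

Lemma density_at_center_ge0 : 0 <= p u0.
Proof.
by have [_ + _] := hp; apply; rewrite /closed_disk/= subrr normr0 lecR ltW.
Qed.

(** As the integrand vanishes off the disk, [mu] may be replaced by its restriction to the disk,
    which has the density [p] cut off there. *)
Let integral_law_density (f : V -> \bar R) : measurable_fun setT f ->
  (forall v, 0 <= f v)%E -> (forall v, delta ^+ 2 < normsq v -> f v = 0%E) ->
  (\int[mu]_z f (to_plane u0 z) =
   \int[@complex_lebesgue R]_z (f (to_plane u0 z) * ((p \_ D) z)%:E))%E.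
Proof.
move=> mf f0 fD; have [mp p0 muE] := hp.
have mg : measurable_fun setT (fun z => f (to_plane u0 z)).
  exact: (measurableT_comp mf (measurable_to_plane u0)).
have fD0 z : ~ D z -> f (to_plane u0 z) = 0%E.
  move=> nDz; apply: fD; rewrite ltNge; apply/negP => h; apply: nDz.
  by apply/closed_diskE => //; exact: ltW.
rewrite -(@ge0_integral_density _ _ _ _ (mrestr mu mD) (p \_ D) _ _ _ _ mg)//.
- have toD (m : {measure set R[i] -> \bar R}) : (\int[m]_z f (to_plane u0 z) =
    \int[m]_(z in D) f (to_plane u0 z))%E.
    rewrite [RHS]integral_mkcond; apply: eq_integral => z _.
    by rewrite patchE; case: ifPn => //; rewrite notin_setE => /fD0.
  rewrite toD [RHS]toD; apply: eq_measure_integral => A mA AD.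
  by rewrite /mrestr; congr (mu _); apply/esym/setIidl.
- by apply/(measurable_restrictT _ mD).
- move=> z; rewrite patchE; case: ifPn => // /set_mem Dz; exact: p0.
- move=> A mA; rewrite /mrestr.
  apply: etrans (muE _ (measurableI _ _ mA mD) (@subIsetr _ _ _)) _.
  rewrite integral_mkcondr; apply: eq_integral => z _.
  by rewrite !patchE; case: ifP.
Qed.

(** Continuity puts p within [e] of p u0 near the center, so there the law is compared with a
    multiple of Lebesgue measure. The lower bound is written with a sum, as the integrals may be
    infinite. *)
Lemma law_compare (e : R) : 0 < e -> exists2 rho : R, 0 < rho &
  forall f : V -> \bar R, measurable_fun setT f -> (forall v, 0 <= f v)%E ->
    (forall v, rho ^+ 2 < normsq v -> f v = 0%E) ->
    (\int[mu]_z f (to_plane u0 z) <= (p u0 + e)%:E * \int[leb2]_v f v)%E /\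
    ((p u0)%:E * \int[leb2]_v f v <=
      \int[mu]_z f (to_plane u0 z) + e%:E * \int[leb2]_v f v)%E.
Proof.
move=> e0; have p0 := density_at_center_ge0.
have [r r0 rp] : exists2 r : R, 0 < r &
    forall z, normsq (to_plane u0 z) < r ^+ 2 -> `|p u0 - p z| <= e.
  have /cvgrPdist_le /(_ _ e0) /nbhs_ballP[r /= r0 rp] := cp.
  (* A ball of [R[i]] has its radius in [R[i]]; positivity in that order forces the radius to be
     real. *)
  have [rim rre] : complex.Im r = 0 /\ 0 < complex.Re r.
    by move: r0; rewrite ltcE/= => /andP[/eqP + ->].
  exists (complex.Re r) => // z zr; apply: rp; rewrite /ball/= distrC normsq_to_plane.
  have -> : r = (complex.Re r)%:C by rewrite [LHS]complexE rim mulr0 addr0.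
  rewrite ltcR -[ltRHS]ger0_norm ?ltW// -sqrtr_sqr ltr_sqrt//.
  by rewrite exprn_gt0.
pose rho := Num.min delta (r / 2).
have rho0 : 0 < rho by rewrite lt_min delta0 divr_gt0.
have rho_r : rho < r by rewrite gt_min ltr_pdivrMr// ltr_pMr// ltr1n orbT.
have rho_d : rho <= delta by rewrite ge_min lexx.
exists rho => // f mf f0 frho.
have [mp pge0 _] := hp.
have mg : measurable_fun setT (fun z => f (to_plane u0 z)).
  exact: (measurableT_comp mf (measurable_to_plane u0)).
have mpD : measurable_fun setT (fun z => ((p \_ D) z)%:E).
  by apply/measurable_EFinP/(measurable_restrictT _ mD).
have pD0 z : 0 <= (p \_ D) z.
  by rewrite patchE; case: ifPn => // /set_mem Dz; exact: pge0.
have pclose z : normsq (to_plane u0 z) <= rho ^+ 2 -> `|p u0 - (p \_ D) z| <= e.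
  move=> zr; rewrite patchE mem_set//; last first.
    apply/closed_diskE; first exact: ltW.
    by rewrite (le_trans zr)// lerXn2r// ?nnegrE ltW.
  by apply: rp; rewrite (le_lt_trans zr)// ltrXn2r// ?nnegrE ltW.
rewrite (integral_law_density mf f0); last first.
  by move=> v dv; apply: frho; apply: le_lt_trans dv; rewrite lerXn2r// nnegrE ltW.
rewrite -(integral_complex_lebesgue u0 mf f0); split.
- rewrite -ge0_integralZl//; last by rewrite lee_fin addr_ge0// ltW.
  apply: ge0_le_integral => //.
  + by move=> z _; rewrite mule_ge0// lee_fin.
  + exact: emeasurable_funM.
  + exact: emeasurable_funM.
  + move=> z _; rewrite muleC.
    have [zr|zr] := leP (normsq (to_plane u0 z)) (rho ^+ 2); last by rewrite frho// !mule0.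
    apply: lee_wpmul2r => //; rewrite lee_fin.
    by move: (pclose z zr); rewrite ler_norml; lra.
- rewrite -!ge0_integralZl//; last by rewrite lee_fin ltW.
  rewrite -ge0_integralD//;
    try (by move=> z _; rewrite mule_ge0 ?lee_fin// ltW);
    try (by move=> z _; rewrite mule_ge0 ?lee_fin//);
    try (by apply: emeasurable_funM).
  apply: ge0_le_integral => //;
    try (by move=> z _; rewrite mule_ge0 ?lee_fin// ltW);
    try (by move=> z _; rewrite mule_ge0 ?lee_fin//);
    try (by apply: emeasurable_funM);
    try (by apply: emeasurable_funD; apply: emeasurable_funM).
  + move=> z _; have eE0 : (0 <= e%:E)%E by rewrite lee_fin ltW.
    have pE0 : (0 <= ((p \_ D) z)%:E)%E by rewrite lee_fin.
    rewrite (muleC (f _)) -ge0_muleDl//.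
    have [zr|zr] := leP (normsq (to_plane u0 z)) (rho ^+ 2); last by rewrite frho// !mule0.
    apply: lee_wpmul2r => //; rewrite -EFinD lee_fin.
    by move: (pclose z zr); rewrite ler_norml; lra.
Qed.

End law.
End complex_plane.

(** * Truncated second moments of the inverse *)

Section moments.
Context (R : realType).
Local Notation mR := (measurableTypeR R).
Local Notation V := (mR * mR)%type.
Local Notation leb := (@lebesgue_measure R).
Local Notation leb2 := (leb \x leb)%E.

(* Real and imaginary part of 1 / (x + i y); both vanish at 0. *)
Definition inv_re (v : V) : R := v.1 / normsq v.
Definition inv_im (v : V) : R := - (v.2 / normsq v).

Lemma measurable_inv_normsq : measurable_fun setT (fun v : V => (normsq v)^-1).
Proof.
exact: (measurableT_comp (@measurable_invr R) (@measurable_normsq R)).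
Qed.

Lemma measurable_inv_re : measurable_fun setT inv_re.
Proof.
apply: measurable_funM; last exact: measurable_inv_normsq.
exact: (@measurable_fst _ _ mR mR).
Qed.

Lemma measurable_inv_im : measurable_fun setT inv_im.
Proof.
apply: (measurableT_comp (@oppr_measurable R setT)).
apply: measurable_funM; last exact: measurable_inv_normsq.
exact: (@measurable_snd _ _ mR mR).
Qed.

Lemma normsq_ge0 (v : V) : 0 <= normsq v.
Proof. by rewrite addr_ge0 ?sqr_ge0. Qed.

Lemma inv_sqr_sum v : inv_re v ^+ 2 + inv_im v ^+ 2 = (normsq v)^-1.
Proof.
rewrite /inv_re /inv_im sqrrN !expr_div_n -mulrDl -/(normsq v).
have [->|n0] := eqVneq (normsq v) 0; first by rewrite mul0r invr0.
by field.
Qed.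

Lemma inv_re_sqr_le v : inv_re v ^+ 2 <= (normsq v)^-1.
Proof. by rewrite -inv_sqr_sum lerDl sqr_ge0. Qed.

Lemma inv_im_sqr_le v : inv_im v ^+ 2 <= (normsq v)^-1.
Proof. by rewrite -inv_sqr_sum lerDr sqr_ge0. Qed.

Lemma inv_re_le v : `|inv_re v| <= Num.sqrt (normsq v)^-1.
Proof.
by rewrite -sqrtr_sqr ler_sqrt ?inv_re_sqr_le// invr_ge0 normsq_ge0.
Qed.

Lemma inv_im_le v : `|inv_im v| <= Num.sqrt (normsq v)^-1.
Proof.
by rewrite -sqrtr_sqr ler_sqrt ?inv_im_sqr_le// invr_ge0 normsq_ge0.
Qed.

Lemma inv_reM_im_le v : `|inv_re v * inv_im v| <= (normsq v)^-1.
Proof.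
have n0 : 0 <= (normsq v)^-1 by rewrite invr_ge0 normsq_ge0.
rewrite normrM -[leRHS]sqr_sqrtr// expr2.
by rewrite ler_pM ?inv_re_le ?inv_im_le.
Qed.

Let indic_annulus a b (v w : V) : normsq v = normsq w ->
  \1_(annulus a b) v = \1_(annulus a b) w :> R.
Proof.
move=> vw; rewrite !indicE.
have -> // : (v \in annulus a b) = (w \in annulus a b).
by apply/idP/idP; rewrite !inE /annulus/= vw.
Qed.

Let measurable_annulus_fun a b (h : V -> R) : measurable_fun setT h ->
  measurable_fun setT (fun v => (\1_(annulus a b) v * h v)%:E).
Proof.
move=> mh; apply/measurable_EFinP; apply: measurable_funM => //.
by apply: measurable_indic; exact: measurable_annulus.
Qed.

Lemma log_mass_fine a b : 0 < a -> a < b ->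
  exists K : R, [/\ log_mass a b = K%:E, 0 <= K,
    K <= 2 * pi * (ln b - ln a) + 4 * pi &
    2 * pi * (ln b - ln a) - 4 * pi <= K].
Proof.
move=> a0 ab; have up := log_mass_le a0 ab; have lo := log_mass_ge a0 ab.
have K0 : (0 <= log_mass a b)%E.
  by apply: integral_ge0 => v _; rewrite lee_fin mulr_ge0// invr_ge0 normsq_ge0.
have fin : log_mass a b \is a fin_num.
  by rewrite ge0_fin_numE// (le_lt_trans up)// ltry.
exists (fine (log_mass a b)); rewrite fineK//; split => //.
- exact: fine_ge0.
- by rewrite -lee_fin fineK.
- by rewrite lerBlDr -lee_fin EFinD fineK.
Qed.

(** Exchanging the coordinates maps one integral to the other, and the two add up to the integral of
    |v|^-2. *)
Lemma integral_inv_re_sqr a b K : 0 < a -> log_mass a b = K%:E ->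
  (\int[leb2]_v (\1_(annulus a b) v * inv_re v ^+ 2)%:E = (K / 2)%:E)%E /\
  (\int[leb2]_v (\1_(annulus a b) v * inv_im v ^+ 2)%:E = (K / 2)%:E)%E.
Proof.
move=> a0 KE.
have mre : measurable_fun setT (fun v => inv_re v ^+ 2).
  by apply: measurable_funX; exact: measurable_inv_re.
have mim : measurable_fun setT (fun v => inv_im v ^+ 2).
  by apply: measurable_funX; exact: measurable_inv_im.
have re0 v : (0 <= (\1_(annulus a b) v * inv_re v ^+ 2)%:E)%E.
  by rewrite lee_fin mulr_ge0// sqr_ge0.
have im0 v : (0 <= (\1_(annulus a b) v * inv_im v ^+ 2)%:E)%E.
  by rewrite lee_fin mulr_ge0// sqr_ge0.
have same : (\int[leb2]_v (\1_(annulus a b) v * inv_im v ^+ 2)%:E =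
    \int[leb2]_v (\1_(annulus a b) v * inv_re v ^+ 2)%:E)%E.
  rewrite -(integral_plane_swap (measurable_annulus_fun a b mre) re0).
  apply: eq_integral => v _; rewrite /inv_re /inv_im sqrrN/=.
  have vw : normsq (v.2, v.1) = normsq v by rewrite /normsq/= addrC.
  by rewrite vw (indic_annulus a b vw).
rewrite same.
have sumK : (\int[leb2]_v (\1_(annulus a b) v * inv_re v ^+ 2)%:E +
    \int[leb2]_v (\1_(annulus a b) v * inv_re v ^+ 2)%:E = K%:E)%E.
  rewrite -{2}same -KE /log_mass -ge0_integralD//.
  - by apply: eq_integral => v _; rewrite -EFinD -mulrDr inv_sqr_sum.
  - exact: measurable_annulus_fun.
  - exact: measurable_annulus_fun.
suff -> : (\int[leb2]_v (\1_(annulus a b) v * inv_re v ^+ 2)%:E = (K / 2)%:E)%E by [].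
move: sumK; set I := (\int[leb2]_v _)%E.
case: I => [r|//|//]; rewrite -EFinD => -[<-]; congr EFin; by field.
Qed.

(** The reflection in the first coordinate exchanges the positive and negative parts of the product.
    They are kept apart because the comparison with [mu] is available for nonnegative functions; the
    common value [J] cancels later. *)
Lemma integral_inv_reM_im a b K : 0 < a -> log_mass a b = K%:E ->
  exists J : R, [/\ 0 <= J, J <= K,
  (\int[leb2]_v (\1_(annulus a b) v * Num.max (inv_re v * inv_im v) 0)%:E = J%:E)%E &
  (\int[leb2]_v (\1_(annulus a b) v * Num.max (- (inv_re v * inv_im v)) 0)%:E = J%:E)%E].
Proof.
move=> a0 KE; pose h v := inv_re v * inv_im v.
have mh : measurable_fun setT h.
  by apply: measurable_funM; [exact: measurable_inv_re|exact: measurable_inv_im].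
have mpos : measurable_fun setT (fun v => Num.max (h v) 0) by exact: measurable_maxr.
have mneg : measurable_fun setT (fun v => Num.max (- h v) 0).
  by apply: measurable_maxr => //; exact: measurableT_comp.
have pos0 v : (0 <= (\1_(annulus a b) v * Num.max (h v) 0)%:E)%E.
  by rewrite lee_fin mulr_ge0// le_max lexx orbT.
have neg0 v : (0 <= (\1_(annulus a b) v * Num.max (- h v) 0)%:E)%E.
  by rewrite lee_fin mulr_ge0// le_max lexx orbT.
have same : (\int[leb2]_v (\1_(annulus a b) v * Num.max (- h v) 0)%:E =
    \int[leb2]_v (\1_(annulus a b) v * Num.max (h v) 0)%:E)%E.
  rewrite -(integral_plane_reflect (measurable_annulus_fun a b mpos) pos0).
  apply: eq_integral => v _; rewrite /h /inv_re /inv_im/=.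
  have vw : normsq (- v.1, v.2) = normsq v by rewrite /normsq/= sqrrN.
  rewrite vw (indic_annulus a b vw).
  by rewrite [- v.1 / _]mulNr [in RHS]mulNr.
have leK : (\int[leb2]_v (\1_(annulus a b) v * Num.max (h v) 0)%:E <= K%:E)%E.
  rewrite -KE; apply: ge0_le_integral => //.
  - exact: measurable_annulus_fun.
  - by apply: measurable_annulus_fun; exact: measurable_inv_normsq.
  - move=> v _; rewrite lee_fin ler_wpM2l// ge_max invr_ge0 normsq_ge0 andbT.
    by rewrite (le_trans (ler_norm _))// inv_reM_im_le.
have ge0 : (0 <= \int[leb2]_v (\1_(annulus a b) v * Num.max (h v) 0)%:E)%E.
  by apply: integral_ge0 => v _.
rewrite -/h; have fin : (\int[leb2]_v (\1_(annulus a b) v * Num.max (h v) 0)%:E)%E \is a fin_num.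
  by rewrite ge0_fin_numE// (le_lt_trans leK)// ltry.
exists (fine (\int[leb2]_v (\1_(annulus a b) v * Num.max (h v) 0)%:E)%E); split.
- exact: fine_ge0.
- by rewrite -lee_fin fineK.
- by rewrite fineK.
- by rewrite same fineK.
Qed.

Section law.
Variables (mu : probability R[i] R) (u0 : R[i]) (delta : R) (p : R[i] -> R).
Hypothesis delta0 : 0 < delta.
Hypothesis hp : has_density_on (closed_disk u0 delta) mu p.
Hypothesis cp : {for u0, continuous (p : R[i]^o -> R)}.
Local Notation toV := (to_plane u0).

Let mtoV : measurable_fun setT toV := measurable_to_plane u0.

Definition far (a : R) : set R[i] := [set z | a ^+ 2 <= normsq (toV z)].

Lemma measurable_far a : measurable (far a).
Proof.
apply: measurable_set_le => //.
exact: (measurableT_comp (@measurable_normsq R) mtoV).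
Qed.

Let law_compareR e : 0 < e -> exists2 rho : R, 0 < rho &
  forall (f : V -> R) I, bounded_measurable f -> (forall v, 0 <= f v) ->
    (forall v, rho ^+ 2 < normsq v -> f v = 0) ->
    (\int[leb2]_v (f v)%:E = I%:E)%E ->
    (p u0 - e) * I <= \int[mu]_z f (toV z) <= (p u0 + e) * I.
Proof.
move=> e0; have [rho rho0 H] := law_compare delta0 hp cp e0.
exists rho => // f I [mf [M fM]] f0 frho fI.
have mfE : measurable_fun setT (fun v => (f v)%:E) by exact/measurable_EFinP.
have [||h1 h2] := H (fun v => (f v)%:E) mfE.
- by move=> v; rewrite lee_fin.
- by move=> v rv; rewrite frho.
have bf : bounded_measurable (fun z => f (toV z)).
  by split; [exact: (measurableT_comp mf mtoV)|exists M].
have IE : (\int[mu]_z (f (toV z))%:E = (\int[mu]_z f (toV z))%:E)%E.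
  by rewrite fineK//; apply: integrable_fin_num => //; exact: bounded_measurable_integrable.
rewrite fI IE -?EFinM -?EFinD !lee_fin in h1 h2.
by rewrite h1 andbT mulrBl lerBlDr.
Qed.

Let Rintegral_far a (h : V -> R) : \int[mu]_(z in far a) h (toV z) =
  \int[mu]_z (\1_(far a) z * h (toV z)).
Proof.
rewrite Rintegral_mkcond; apply: eq_Rintegral => z _.
by rewrite patchE indicE; case: ifP; rewrite ?mul1r ?mul0r.
Qed.

(** Beyond [rho] the integrand is at most rho^-2 and [mu] is a probability; so only the annulus,
    where the density governs, matters as [a] tends to 0. *)
Let far_split a rho (h : V -> R) : 0 < a -> a < rho -> measurable_fun setT h ->
  (forall v, `|h v| <= (normsq v)^-1) ->
  `|\int[mu]_(z in far a) h (toV z) -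
    \int[mu]_z (\1_(annulus a rho) (toV z) * h (toV z))| <= (rho ^+ 2)^-1.
Proof.
move=> a0 ar mh hN; have rho0 := lt_trans a0 ar.
have mhV : measurable_fun setT (fun z => h (toV z)) by exact: (measurableT_comp mh mtoV).
have m1 : measurable_fun setT (fun z => \1_(annulus a rho) (toV z) : R).
  have mi : measurable_fun setT (\1_(annulus a rho) : V -> R).
    by apply: measurable_indic; exact: measurable_annulus.
  exact: (measurableT_comp mi mtoV).
have hb v : a ^+ 2 <= normsq v -> `|h v| <= (a ^+ 2)^-1.
  move=> av; apply: (le_trans (hN v)).
  by rewrite lef_pV2// posrE ?exprn_gt0// (lt_le_trans _ av)// exprn_gt0.
have b1 : bounded_measurable (fun z => \1_(far a) z * h (toV z)).
  split; first by apply: measurable_funM => //; apply: measurable_indic; exact: measurable_far.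
  exists (a ^+ 2)^-1 => z; have [fz|nfz] := pselect (far a z).
    by rewrite (indic_mem fz) mul1r hb.
  by rewrite (indic_nmem nfz) mul0r normr0 invr_ge0 sqr_ge0.
have b2 : bounded_measurable (fun z => \1_(annulus a rho) (toV z) * h (toV z)).
  split; first exact: measurable_funM.
  exists (a ^+ 2)^-1 => z; have [fz|nfz] := pselect (annulus a rho (toV z)).
    by rewrite (indic_mem fz) mul1r hb//; case: fz.
  by rewrite (indic_nmem nfz) mul0r normr0 invr_ge0 sqr_ge0.
rewrite Rintegral_far -RintegralB//; try exact: bounded_measurable_integrable.
apply: normr_Rintegral_le.
  by apply: measurable_funB; [case: b1|case: b2].
move=> z; have r20 : 0 <= (rho ^+ 2)^-1 by rewrite invr_ge0 sqr_ge0.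
have [fz|nfz] := pselect (far a z); last first.
  rewrite (indic_nmem nfz) (@indic_nmem _ (annulus a rho)) ?mul0r ?subrr ?normr0//.
  by case.
rewrite (indic_mem fz) mul1r; have [nr|nr] := leP (normsq (toV z)) (rho ^+ 2).
  by rewrite (@indic_mem _ (annulus a rho)) ?mul1r ?subrr ?normr0.
rewrite (@indic_nmem _ (annulus a rho)); last by case=> _; rewrite leNgt nr.
rewrite mul0r subr0 (le_trans (hN _))// lef_pV2 ?posrE ?exprn_gt0//.
  exact: ltW.
by rewrite (lt_trans _ nr)// exprn_gt0.
Qed.

Let bounded_annulus_fun a rho (h : V -> R) : 0 < a -> measurable_fun setT h ->
  (forall v, `|h v| <= (normsq v)^-1) ->
  bounded_measurable (fun v => \1_(annulus a rho) v * h v).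
Proof.
move=> a0 mh hN; split.
  apply: measurable_funM => //; apply: measurable_indic; exact: measurable_annulus.
exists (a ^+ 2)^-1 => v; have [fv|nfv] := pselect (annulus a rho v); last first.
  by rewrite (indic_nmem nfv) mul0r normr0 invr_ge0 sqr_ge0.
rewrite (indic_mem fv) mul1r (le_trans (hN v))//.
have [av _] := fv.
by rewrite lef_pV2// posrE ?exprn_gt0// (lt_le_trans _ av)// exprn_gt0.
Qed.

Let annulus_out a rho (v : V) : rho ^+ 2 < normsq v -> \1_(annulus a rho) v = 0 :> R.
Proof. by move=> rv; apply: indic_nmem; case=> _; rewrite leNgt rv. Qed.

Let small_a (M : R) : exists2 a0 : R, 0 < a0 & forall a, 0 < a -> a < a0 -> M <= - ln a.
Proof.
exists (expR (- M)); first exact: expR_gt0.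
by move=> a a0 aM; rewrite lerNr -[leRHS]expRK ler_ln ?posrE ?expR_gt0// ltW.
Qed.

(** On the annulus from [a] to a fixed [rho] each square integrates to half of 2 pi ln (rho / a), up
    to a bounded error, and [mu] multiplies this by nearly p u0. For the product, the equal positive
    and negative parts leave only the error of that comparison. *)
Lemma second_moment e : 0 < e -> exists2 a0 : R, 0 < a0 & forall a, 0 < a -> a < a0 ->
  [/\ `|\int[mu]_(z in far a) (inv_re (toV z) ^+ 2) - pi * p u0 * (- ln a)| <= e * (- ln a),
      `|\int[mu]_(z in far a) (inv_im (toV z) ^+ 2) - pi * p u0 * (- ln a)| <= e * (- ln a) &
      `|\int[mu]_(z in far a) (inv_re (toV z) * inv_im (toV z))| <= e * (- ln a)].
Proof.
move=> e0; have p0 := density_at_center_ge0 delta0 hp.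
have pi0 : 0 < pi :> R by exact: pi_gt0.
(* The covariance decides the constant: its two parts cost 2 e1 J with J at most about 2 pi L, hence
   4 pi e1 L, which has to equal half of e L. *)
pose e1 := e / (8 * pi); have e10 : 0 < e1 by rewrite divr_gt0// mulr_gt0.
have aux (x : R) : x != 0 -> 8 * (e / (8 * x) * x) = e by move=> x0; field.
have e1E : 8 * (e1 * pi) = e by apply: aux; rewrite gt_eqF.
have e1p : 4 * (e1 * pi) <= e / 2 by lra.
have e1p2 : e1 * pi <= e / 2 by lra.
have [rho rho0 H] := law_compareR e10.
pose lr := `|ln rho|.
(* All errors that stay bounded as [a] tends to 0; the other half of e L absorbs them. *)
pose B := (p u0 + e1) * (pi * lr + 2 * pi) + (rho ^+ 2)^-1 +
   2 * e1 * (2 * pi * lr + 4 * pi).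
have [a1 a10 ha1] := small_a (2 * B / e).
have [a2 a20 ha2] := small_a 0.
exists (Num.min (Num.min a1 a2) rho); first by rewrite !lt_min a10 a20.
move=> a a0; rewrite !lt_min => /andP[/andP[aa1 aa2] arho].
have L1 := ha1 a a0 aa1; have L2 := ha2 a a0 aa2.
set L := - ln a in L1 L2 *.
have BL : B <= e / 2 * L.
  have : 2 * B / e * (e / 2) <= L * (e / 2) by rewrite ler_wpM2r// divr_ge0// ltW.
  by rewrite (_ : 2 * B / e * (e / 2) = B) 1?mulrC//; field; rewrite gt_eqF.
have [K [KE K0 K1 K2]] := log_mass_fine a0 arho.
have lnr : - lr <= ln rho <= lr by rewrite -ler_norml lexx.
have [lr1 lr2] := andP lnr.
have KL1 : K <= 2 * pi * (lr + L) + 4 * pi.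
  apply: (le_trans K1); rewrite lerD2r ler_pM2l ?mulr_gt0// /L; lra.
have KL2 : 2 * pi * (L - lr) - 4 * pi <= K.
  apply: le_trans K2; rewrite lerD2r ler_pM2l ?mulr_gt0// /L; lra.
have hK1 : K / 2 <= pi * (lr + L) + 2 * pi by lra.
have hK2 : pi * (L - lr) - 2 * pi <= K / 2 by lra.
have r20 : 0 <= (rho ^+ 2)^-1 by rewrite invr_ge0 sqr_ge0.
have lr0 : 0 <= pi * lr + 2 * pi.
  by apply: addr_ge0; apply: mulr_ge0; rewrite ?normr_ge0 ?(ltW pi0).
have elr0 : 0 <= e1 * (pi * lr + 2 * pi) by rewrite mulr_ge0// ltW.
have plr0 : 0 <= p u0 * (pi * lr + 2 * pi) by rewrite mulr_ge0.
have sq (h : V -> R) : measurable_fun setT h -> (forall v, h v ^+ 2 <= (normsq v)^-1) ->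
   (\int[leb2]_v (\1_(annulus a rho) v * h v ^+ 2)%:E = (K / 2)%:E)%E ->
   `|\int[mu]_(z in far a) (h (toV z) ^+ 2) - pi * p u0 * L| <= e * L.
  move=> mh hN hI; have mh2 : measurable_fun setT (fun v => h v ^+ 2) by exact: measurable_funX.
  have hN2 v : `|h v ^+ 2| <= (normsq v)^-1 by rewrite ger0_norm ?sqr_ge0.
  have s1 := far_split a0 arho mh2 hN2.
  have s2 := H _ _ (bounded_annulus_fun rho a0 mh2 hN2)
    (fun v => mulr_ge0 (indic_ge0 _ _ _) (sqr_ge0 _))
    (fun v rv => etrans (congr1 (fun t => t * _) (annulus_out a rv)) (mul0r _)) hI.
  move: s1 s2; set A1 := \int[mu]_(z in far a) _; set A2 := \int[mu]_z _.
  rewrite ler_norml => /andP[s11 s12] /andP[s21 s22].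
  have t1 : (p u0 + e1) * (K / 2) <= (p u0 + e1) * (pi * (lr + L) + 2 * pi).
    by rewrite ler_wpM2l ?addr_ge0 ?(ltW e10).
  have t2 : p u0 * (pi * (L - lr) - 2 * pi) <= p u0 * (K / 2).
    by rewrite ler_wpM2l.
  have t3 : e1 * (K / 2) <= e1 * (pi * (lr + L) + 2 * pi).
    by rewrite ler_wpM2l ?(ltW e10).
  have eL : e1 * pi * L <= e / 2 * L by rewrite ler_wpM2r.
  rewrite /B in BL; rewrite ler_norml.
  clear - r20 lr0 elr0 plr0 s11 s12 s21 s22 t1 t2 t3 eL BL.
  by apply/andP; split; lra.
have [Ire Iim] := integral_inv_re_sqr a0 KE.
split.
- by apply: sq Ire; [exact: measurable_inv_re|exact: inv_re_sqr_le].
- by apply: sq Iim; [exact: measurable_inv_im|exact: inv_im_sqr_le].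
have [J [J0 JK Jp Jm]] := integral_inv_reM_im a0 KE.
pose h v := inv_re v * inv_im v.
have mh : measurable_fun setT h.
  by apply: measurable_funM; [exact: measurable_inv_re|exact: measurable_inv_im].
have mpos : measurable_fun setT (fun v => Num.max (h v) 0) by exact: measurable_maxr.
have mneg : measurable_fun setT (fun v => Num.max (- h v) 0).
  by apply: measurable_maxr => //; exact: measurableT_comp.
have posN v : `|Num.max (h v) 0| <= (normsq v)^-1.
  apply: le_trans (inv_reM_im_le v); rewrite -/(h v).
  by have [?|?] := leP (h v) 0; rewrite ?normr0.
have negN v : `|Num.max (- h v) 0| <= (normsq v)^-1.
  apply: le_trans (inv_reM_im_le v); rewrite -/(h v).
  by have [?|?] := leP (- h v) 0; rewrite ?normr0 ?normrN.
have s1 := far_split a0 arho mh inv_reM_im_le.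
have max0 (t : R) : 0 <= Num.max t 0 by rewrite le_max lexx orbT.
have bp := bounded_annulus_fun rho a0 mpos posN.
have bm := bounded_annulus_fun rho a0 mneg negN.
have s2 := H _ _ bp
  (fun v => mulr_ge0 (indic_ge0 _ _ _) (max0 _))
  (fun v rv => etrans (congr1 (fun t => t * _) (annulus_out a rv)) (mul0r _)) Jp.
have s3 := H _ _ bm
  (fun v => mulr_ge0 (indic_ge0 _ _ _) (max0 _))
  (fun v rv => etrans (congr1 (fun t => t * _) (annulus_out a rv)) (mul0r _)) Jm.
have comp (g : V -> R) : bounded_measurable g -> mu.-integrable setT (EFin \o (fun z => g (toV z))).
  move=> [mg [M gM]]; apply: bounded_measurable_integrable; split; last by exists M.
  exact: (measurableT_comp mg mtoV).
have hsplit : \int[mu]_z (\1_(annulus a rho) (toV z) * h (toV z)) =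
    \int[mu]_z (\1_(annulus a rho) (toV z) * Num.max (h (toV z)) 0) -
    \int[mu]_z (\1_(annulus a rho) (toV z) * Num.max (- h (toV z)) 0).
  rewrite -RintegralB//; [|exact: comp bp|exact: comp bm].
  apply: eq_Rintegral => z _; rewrite -mulrBr; congr (_ * _).
  have [h0|h0] := leP (h (toV z)) 0.
    by rewrite max_l ?oppr_ge0// sub0r opprK.
  by rewrite max_r ?subr0// oppr_le0 ltW.
rewrite hsplit in s1.
move: s1 s2 s3; rewrite -/(h _).
set A1 := \int[mu]_(z in far a) _; set A2 := \int[mu]_z _; set A3 := \int[mu]_z _.
rewrite ler_norml => /andP[s11 s12] /andP[s21 s22] /andP[s31 s32].
have t3 : e1 * J <= e1 * (2 * pi * (lr + L) + 4 * pi).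
  by rewrite ler_wpM2l ?(ltW e10)//; exact: le_trans JK KL1.
have eL : 4 * (e1 * pi * L) <= e / 2 * L.
  by rewrite mulrA ler_wpM2r.
rewrite /B in BL; rewrite ler_norml.
clear - r20 lr0 elr0 plr0 s11 s12 s21 s22 s31 s32 t3 eL BL.
by apply/andP; split; lra.
Qed.

End law.
End moments.

(** * Mass and moments of the inverse distance *)

Section singular_moments.
Context (R : realType).
Local Notation mR := (measurableTypeR R).
Local Notation V := (mR * mR)%type.
Local Notation leb := (@lebesgue_measure R).
Local Notation leb2 := (leb \x leb)%E.

Definition inv_abs (v : V) : R := Num.sqrt (normsq v)^-1.

Lemma inv_abs_ge0 v : 0 <= inv_abs v.
Proof. exact: sqrtr_ge0. Qed.

Lemma inv_abs_sqr v : inv_abs v ^+ 2 = (normsq v)^-1.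
Proof. by rewrite sqr_sqrtr// invr_ge0 normsq_ge0. Qed.

Lemma measurable_inv_abs : measurable_fun setT inv_abs.
Proof.
have ms : measurable_fun setT (@Num.sqrt R).
  by apply: continuous_measurable_fun; exact: sqrt_continuous.
exact: (measurableT_comp ms (@measurable_inv_normsq R)).
Qed.

Lemma inv_abs_le (v : V) (a : R) : 0 < a -> a ^+ 2 <= normsq v -> inv_abs v <= a^-1.
Proof.
move=> a0 av; rewrite -(@ler_pXn2r _ 2)// ?nnegrE ?inv_abs_ge0 ?invr_ge0 ?(ltW a0)//.
by rewrite inv_abs_sqr exprVn lef_pV2// posrE ?exprn_gt0// (lt_le_trans _ av)// exprn_gt0.
Qed.

Lemma inv_abs_gt (v : V) (t : R) : 0 < t -> t < inv_abs v -> normsq v <= (t^-1) ^+ 2.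
Proof.
move=> t0 tv; have [n0|n0] := leP (normsq v) 0.
  by rewrite (le_trans n0)// sqr_ge0.
rewrite leNgt; apply/negP => h; move: tv; rewrite ltNge => /negP; apply.
by rewrite -[leRHS]invrK inv_abs_le ?invr_gt0// ltW.
Qed.

Lemma leb2_disk_le a : 0 < a ->
  (leb2 [set v : V | (normsq v <= a ^+ 2)%R] <= (4 * a ^+ 2)%:E)%E.
Proof.
move=> a0; pose I : set mR := `[- a, a]%classic.
have mI : measurable I by exact: measurable_itv.
have LI : leb I = (2 * a)%:E.
  rewrite /I lebesgue_measure_itv/= lte_fin gtrN// -EFinD; congr EFin; ring.
have -> : (4 * a ^+ 2)%:E = leb2 (I `*` I).
  rewrite product_measure1E//; rewrite [RHS](congr2 mule LI LI) -EFinM.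
  by congr EFin; ring.
apply: le_measure; rewrite ?inE.
- by apply: measurable_set_le => //; exact: measurable_normsq.
- exact: measurableX.
- move=> v /= nv; have sq (x : R) : x ^+ 2 <= a ^+ 2 -> x \in `[- a, a].
    move=> h; rewrite in_itv/= -ler_norml -(@ler_pXn2r _ 2)// ?nnegrE ?(ltW a0)//.
    by rewrite -normrX ger0_norm ?sqr_ge0.
  split; apply: sq; apply: le_trans nv; rewrite /normsq.
    by rewrite lerDl sqr_ge0.
  by rewrite lerDr sqr_ge0.
Qed.

Section law.
Variables (mu : probability R[i] R) (u0 : R[i]) (delta : R) (p : R[i] -> R).
Hypothesis delta0 : 0 < delta.
Hypothesis hp : has_density_on (closed_disk u0 delta) mu p.
Hypothesis cp : {for u0, continuous (p : R[i]^o -> R)}.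
Local Notation toV := (to_plane u0).

Let mtoV : measurable_fun setT toV := measurable_to_plane u0.

Let mN : measurable_fun setT (fun z => normsq (toV z)).
Proof. exact: (measurableT_comp (@measurable_normsq R) mtoV). Qed.

(** Small radii are compared with Lebesgue measure; beyond [rho] the trivial bound 1 <= a^2 / rho^2
    is enough, so that one constant serves all radii. *)
Lemma disk_mass : exists2 C : R, 0 < C & forall a, 0 < a ->
  (mu [set z | (normsq (toV z) <= a ^+ 2)%R] <= (C * a ^+ 2)%:E)%E.
Proof.
have [rho rho0 H] := law_compare delta0 hp cp (@ltr01 R).
have p0 := density_at_center_ge0 delta0 hp.
have C1 : 0 <= 4 * (p u0 + 1) by rewrite mulr_ge0 ?addr_ge0.
have C2 : 0 < (rho ^+ 2)^-1 by rewrite invr_gt0 exprn_gt0.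
exists (4 * (p u0 + 1) + (rho ^+ 2)^-1); first by rewrite ltr_wpDl.
move=> a a0; have a20 : 0 <= a ^+ 2 by exact: sqr_ge0.
have [ar|ra] := leP a rho; last first.
  apply: (@le_trans _ _ 1%E); first exact: probability_le1 (measurable_set_le mN (measurable_cst _)).
  rewrite lee_fin (@le_trans _ _ ((rho ^+ 2)^-1 * a ^+ 2))//; last first.
    by rewrite ler_wpM2r// lerDr.
  rewrite ler_pdivlMl ?exprn_gt0// mulr1 lerXn2r ?nnegrE ?ltW//.
have mD : measurable [set v : V | normsq v <= a ^+ 2].
  by apply: measurable_set_le => //; exact: measurable_normsq.
have [|||+ _] := H (fun v => (\1_[set v | normsq v <= a ^+ 2] v)%:E).
- exact/measurable_EFinP/measurable_indic.
- by move=> v; rewrite lee_fin.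
- move=> v rv; rewrite indic_nmem//= => va.
  by move: rv; rewrite ltNge (le_trans va)// lerXn2r// nnegrE ltW.
have mA : measurable [set z | normsq (toV z) <= a ^+ 2].
  exact: measurable_set_le mN (measurable_cst _).
have I1 := etrans (integral_indic mu measurableT mA) (congr1 _ (setIT _)).
have I2 := etrans (integral_indic leb2 measurableT mD) (congr1 _ (setIT _)).
move=> h; apply: (@le_trans _ _ ((p u0 + 1)%:E *
  leb2 [set v : V | (normsq v <= a ^+ 2)%R])%E).
  by rewrite -I1 -I2.
apply: (@le_trans _ _ ((p u0 + 1)%:E * (4 * a ^+ 2)%:E)%E).
  by rewrite lee_wpmul2l ?lee_fin ?addr_ge0// leb2_disk_le.
rewrite -EFinM lee_fin mulrA ler_wpM2r// [leLHS]mulrC lerDl; exact: ltW.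
Qed.

Section tail.
Variable C : R.
Hypothesis C0 : 0 < C.
Hypothesis HC : forall a, 0 < a ->
  (mu [set z | (normsq (toV z) <= a ^+ 2)%R] <= (C * a ^+ 2)%:E)%E.

Let near_fun (a : R) (z : R[i]) : R := \1_(~` far u0 a) z * inv_abs (toV z).

Let measurable_near_fun a : measurable_fun setT (near_fun a).
Proof.
apply: measurable_funM.
  by apply: measurable_indic; apply: measurableC; exact: measurable_far.
exact: (measurableT_comp measurable_inv_abs mtoV).
Qed.

HB.instance Definition _ a :=
  isMeasurableFun.Build _ _ _ _ (near_fun a) (measurable_near_fun a).

(* Layer-cake: the tail of inv_abs at height t is at most C * min (a^2, t^-2). *)
Lemma near_moment a : 0 < a ->
  (\int[mu]_z (\1_(~` far u0 a) z * inv_abs (toV z))%:E <= (2 * C * a)%:E)%E.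
Proof.
move=> a0; have X0 z : 0 <= near_fun a z by rewrite mulr_ge0// inv_abs_ge0.
pose X : {RV mu >-> R} := near_fun a.
have /= := @ge0_expectation_ccdf _ _ _ mu X X0.
rewrite unlock => ->.
have cc t : 0 < t -> (ccdf X t <= (C * t ^- 2)%:E)%E.
  move=> t0; rewrite -exprVn; apply: le_trans (HC _); last by rewrite invr_gt0.
  rewrite /ccdf /distribution /pushforward; apply: le_measure; rewrite ?inE.
  - by rewrite -[X in measurable X]setTI; exact: measurable_near_fun.
  - by apply: measurable_set_le mN _; exact: measurable_cst.
  - move=> z /=; rewrite in_itv/= andbT => tz; apply: inv_abs_gt => //.
    apply: (lt_le_trans tz).
    change (\1_(~` far u0 a) z * inv_abs (toV z) <= inv_abs (toV z)).
    by rewrite ler_piMl ?inv_abs_ge0// indicE lern1 leq_b1.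
have ca t : 0 <= t -> (ccdf X t <= (C * a ^+ 2)%:E)%E.
  move=> t0; apply: le_trans (HC a0).
  rewrite /ccdf /distribution /pushforward; apply: le_measure; rewrite ?inE.
  - by rewrite -[X in measurable X]setTI; exact: measurable_near_fun.
  - by apply: measurable_set_le mN _; exact: measurable_cst.
  - move=> z /=; rewrite in_itv/= andbT /near_fun => tz.
    have [fz|/negP] := pselect (far u0 a z); last by rewrite -ltNge => /ltW.
    move: tz; rewrite (@indic_nmem _ (~` far u0 a)) ?mul0r; last exact.
    by rewrite ltNge t0.
have mc : measurable_fun setT (ccdf X) by exact: ccdf_measurable.
have cge0 t : (0 <= ccdf X t)%E by exact: measure_ge0.
have -> : `[0, +oo[%classic = `[0, a^-1[%classic `|` `[a^-1, +oo[%classic :> set mR.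
  by rewrite -itv_bndbnd_setU// ?bnd_simp ?invr_ge0 ltW.
rewrite ge0_integral_setU//=; last 2 first.
- exact: measurable_funTS.
- apply/disj_setPS => t [/=]; rewrite !in_itv/= => /andP[_ ta] /andP[at_ _].
  by move: ta; rewrite ltNge at_.
rewrite (_ : 2 * C * a = C * a + C * a); last by ring.
have mi : measurable_fun setT (fun t : mR => (t ^- 2)%:E).
  apply/measurable_EFinP; apply: (measurableT_comp (@measurable_invr R)).
  exact: measurable_funX.
rewrite EFinD; apply: leeD.
- apply: (@le_trans _ _ (\int[leb]_(r in `[0%R, a^-1%R[) (C * a ^+ 2)%:E)%E).
    apply: ge0_le_integral => //.
    + exact: measurable_funTS.
    + by move=> t /=; rewrite in_itv/= => /andP[t0 _]; exact: ca.
  rewrite integral_cst//= lebesgue_measure_itv/= lte_fin invr_gt0 a0 sube0 -EFinM.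
  by rewrite lee_fin expr2 !mulrA mulfK ?gt_eqF.
- apply: (@le_trans _ _ (\int[leb]_(r in `[a^-1%R, +oo[) (C%:E * (r ^- 2)%R%:E))%E).
    apply: ge0_le_integral => //.
    + exact: measurable_funTS.
    + by apply: measurable_funTS; exact: emeasurable_funM.
    + move=> t /=; rewrite in_itv/= andbT => at_; rewrite -EFinM; apply: cc.
      by rewrite (lt_le_trans _ at_)// invr_gt0.
  rewrite ge0_integralZl//; last 3 first.
  + exact: measurable_funTS.
  + by move=> t _; rewrite lee_fin invr_ge0 sqr_ge0.
  + by rewrite lee_fin ltW.
  by rewrite integral_inv_sqr ?invr_gt0// invrK -EFinM.
Qed.

(** Outside the unit disk the inverse distance is at most 1, inside it [near_moment] applies. This
    makes the Cauchy--Stieltjes transform meaningful at the center. *)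
Lemma inv_abs_integrable : mu.-integrable setT (fun z => (inv_abs (toV z))%:E).
Proof.
have mm : measurable_fun setT (fun z => (inv_abs (toV z))%:E).
  by apply/measurable_EFinP; exact: (measurableT_comp measurable_inv_abs mtoV).
apply/integrableP; split => //.
apply: (@le_lt_trans _ _ (\int[mu]_z ((\1_(~` far u0 1) z * inv_abs (toV z))%:E + 1))%E).
  apply: ge0_le_integral => //.
  - exact: measurableT_comp.
  - apply: emeasurable_funD => //; apply/measurable_EFinP; exact: measurable_near_fun.
  - move=> z _; rewrite abse_EFin lee_fin ger0_norm ?inv_abs_ge0//.
    have [fz|nfz] := pselect (far u0 1 z).
      rewrite (@indic_nmem _ (~` far u0 1)) ?mul0r ?add0r; last exact.
      by rewrite -[leRHS]invr1; exact: inv_abs_le.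
    by rewrite indic_mem// mul1r lerDl.
rewrite ge0_integralD//; last 2 first.
- by move=> z _; rewrite lee_fin mulr_ge0// inv_abs_ge0.
- by apply/measurable_EFinP; exact: measurable_near_fun.
have I1 : (\int[mu]_z 1 = 1)%E.
  by rewrite integral_cst// mul1e; exact: probability_setT.
apply: (@le_lt_trans _ _ ((2 * C * 1)%:E + 1)%E); last by rewrite ltry.
by apply: leeD; [exact: near_moment|rewrite I1].
Qed.


Lemma near_moment_le a : 0 < a -> \int[mu]_(z in ~` far u0 a) inv_abs (toV z) <= 2 * C * a.
Proof.
move=> a0; have h := near_moment a0.
have -> : \int[mu]_(z in ~` far u0 a) inv_abs (toV z) =
    fine (\int[mu]_z (\1_(~` far u0 a) z * inv_abs (toV z))%:E).
  rewrite /Rintegral integral_mkcond; congr fine; apply: eq_integral => z _.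
  by rewrite patchE indicE; case: ifP; rewrite ?mul1r ?mul0r.
have I0 : (0 <= \int[mu]_z (\1_(~` far u0 a) z * inv_abs (toV z))%:E)%E.
  by apply: integral_ge0 => z _; rewrite lee_fin mulr_ge0// inv_abs_ge0.
rewrite -lee_fin fineK// ge0_fin_numE//; exact: le_lt_trans h (ltry _).
Qed.

End tail.

Lemma far_sqr_le : exists2 C2 : R, 0 < C2 & exists2 a0 : R, 0 < a0 & forall a, 0 < a -> a < a0 ->
  \int[mu]_(z in far u0 a) (inv_abs (toV z) ^+ 2) <= C2 * (- ln a).
Proof.
have [a0 a00 H] := second_moment delta0 hp cp (@ltr01 R).
have p0 := density_at_center_ge0 delta0 hp.
exists (2 * (pi * p u0 + 1)).
  by rewrite mulr_gt0// ltr_wpDl// mulr_ge0// pi_ge0.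
exists a0 => // a a1 a2; have [h1 h2 _] := H a a1 a2.
have bnd (h : V -> R) : measurable_fun setT h -> (forall v, h v ^+ 2 <= (normsq v)^-1) ->
    mu.-integrable (far u0 a) (fun z => (h (toV z) ^+ 2)%:E).
  move=> mh hN.
  have ib : mu.-integrable setT (EFin \o (fun z => \1_(far u0 a) z * h (toV z) ^+ 2)).
    apply: bounded_measurable_integrable; split.
      apply: measurable_funM; first by apply: measurable_indic; exact: measurable_far.
      by apply: measurable_funX; exact: (measurableT_comp mh mtoV).
    exists (a^-1 ^+ 2) => z; rewrite ger0_norm; last exact: mulr_ge0 (indic_ge0 _ _ _) (sqr_ge0 _).
    have [fz|nfz] := pselect (far u0 a z); last by rewrite (indic_nmem nfz) mul0r sqr_ge0.
    rewrite (indic_mem fz) mul1r (le_trans (hN _))// -inv_abs_sqr.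
    by rewrite lerXn2r ?nnegrE ?inv_abs_ge0 ?invr_ge0 ?(ltW a1)// inv_abs_le.
  have := integrableS measurableT (measurable_far u0 a) (@subsetT _ _) ib.
  apply: eq_integrable; first exact: measurable_far.
  by move=> z fz /=; rewrite indicE fz mul1r.
have -> : \int[mu]_(z in far u0 a) (inv_abs (toV z) ^+ 2) =
    \int[mu]_(z in far u0 a) (inv_re (toV z) ^+ 2) +
    \int[mu]_(z in far u0 a) (inv_im (toV z) ^+ 2).
  rewrite -RintegralD; [|exact: measurable_far| |].
  - by apply: eq_Rintegral => z _; rewrite inv_sqr_sum inv_abs_sqr.
  - by apply: bnd; [exact: measurable_inv_re|exact: inv_re_sqr_le].
  - by apply: bnd; [exact: measurable_inv_im|exact: inv_im_sqr_le].
move: h1 h2; rewrite !ler_norml => /andP[_ h1] /andP[_ h2]; lra.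
Qed.

End law.
End singular_moments.

(** * Normalization and cutoff *)

Section scales.
Context (R : realType).

Definition scale (n : nat) : R := Num.sqrt (n%:R * ln n%:R).

(* Atoms within [cutoff n] of u0 are absent with high probability, while on the
   complement the scaled summands are bounded by 1. *)
Definition cutoff (n : nat) : R := 2 / scale n.

Lemma near_ln_ge (M : R) : \forall n \near \oo, M <= ln n%:R.
Proof.
near=> n; have Mn : expR M <= n%:R by near: n; exact: nbhs_infty_ger.
by rewrite -[leLHS]expRK ler_ln ?posrE ?expR_gt0// (lt_le_trans _ Mn)// expR_gt0.
Unshelve. all: by end_near. Qed.

Lemma scale_sqr n : 0 <= ln n%:R :> R -> scale n ^+ 2 = n%:R * ln n%:R.
Proof. by move=> l0; rewrite sqr_sqrtr// mulr_ge0. Qed.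

Lemma near_scale_ge (M : R) : \forall n \near \oo, M <= scale n.
Proof.
near=> n; have n1 : 1 <= n%:R :> R by near: n; exact: nbhs_infty_ger.
have Mn : M ^+ 2 <= ln n%:R by near: n; exact: near_ln_ge.
have l0 : 0 <= ln n%:R :> R by apply: le_trans Mn; exact: sqr_ge0.
rewrite (le_trans (ler_norm _))// -sqrtr_sqr ler_sqrt ?mulr_ge0//.
by rewrite (le_trans Mn)// ler_peMl.
Unshelve. all: by end_near. Qed.

Lemma near_cutoff a0 : 0 < a0 -> \forall n \near \oo, 0 < cutoff n /\ cutoff n < a0.
Proof.
move=> a00; near=> n.
have h : 3 / a0 <= scale n by near: n; exact: near_scale_ge.
have s0 : 0 < scale n by rewrite (lt_le_trans _ h)// divr_gt0.
split; first by rewrite divr_gt0.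
move: h; rewrite ler_pdivrMr// ltr_pdivrMr//; lra.
Unshelve. all: by end_near. Qed.

(** Minus the logarithm of the cutoff is (ln n + ln ln n) / 2 - ln 2. The limit 1 / 2 accounts for
    the half in the limiting variance of each coordinate. *)
Lemma cutoff_ratio : - ln (cutoff n) / ln n%:R @[n --> \oo] --> (2^-1 : R).
Proof.
apply/cvgrPdist_le => e e0; near=> n.
have n0 : 0 < n%:R :> R by near: n; exact: nbhs_infty_gtr.
have l1 : 1 <= ln n%:R :> R by near: n; exact: near_ln_ge.
have le : (e^-1 * 2) ^+ 2 <= ln n%:R :> R by near: n; exact: near_ln_ge.
have l2 : 2 * ln 2 / e <= ln n%:R :> R by near: n; exact: near_ln_ge.
set l := ln n%:R in l1 le l2 *; have l0 : 0 < l by rewrite (lt_le_trans ltr01).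
have s0 : 0 < scale n by rewrite sqrtr_gt0 mulr_gt0.
have s2 : 2 * ln (scale n) = l + ln l.
  have := lnXn 2 s0; rewrite scale_sqr ?(ltW l0)// lnM ?posrE// => ->.
  by rewrite mulr_natl.
have sl0 : 0 < Num.sqrt l by rewrite sqrtr_gt0.
have sll : Num.sqrt l * Num.sqrt l = l by rewrite -expr2 sqr_sqrtr// ltW.
(* Sublinearity of the logarithm at the square root of [l], which makes ln ln n negligible against
   ln n. *)
have ll : ln l < 2 * Num.sqrt l.
  rewrite -{1}sll lnM ?posrE//; have := ln_sublinear sl0; lra.
have ll0 : 0 <= ln l by exact: ln_ge0.
have esl : e^-1 * 2 <= Num.sqrt l.
  rewrite -[leLHS]ger0_norm ?mulr_ge0 ?invr_ge0 ?(ltW e0)// -sqrtr_sqr.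
  by rewrite ler_sqrt// ltW.
have esl2 : 2 <= e * Num.sqrt l by rewrite -ler_pdivrMl.
have ln20 : 0 <= ln 2 :> R by apply: ln_ge0; rewrite ler1n.
have eln : 2 * ln 2 <= e * l by move: l2; rewrite ler_pdivrMr// [l * e]mulrC.
have -> : - ln (cutoff n) = ln (scale n) - ln 2.
  by rewrite /cutoff ln_div ?posrE// opprB.
have -> : 2^-1 - (ln (scale n) - ln 2) / l = (2 * ln 2 - ln l) / (2 * l).
  have -> : ln (scale n) = (l + ln l) / 2 by rewrite -s2; field.
  by field; rewrite gt_eqF.
rewrite normrM [ `|(2 * l)^-1|]gtr0_norm ?invr_gt0 ?mulr_gt0//.
rewrite ler_pdivrMr ?mulr_gt0//.
have : 2 * Num.sqrt l <= e * l.
  by rewrite -[X in _ <= e * X]sll mulrA ler_wpM2r// ltW.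
rewrite ler_norml; move=> h; apply/andP; split; lra.
Unshelve. all: by end_near. Qed.

End scales.

Section truncated_moments.
Context (R : realType).
Local Notation mR := (measurableTypeR R).
Local Notation V := (mR * mR)%type.
Variables (mu : probability R[i] R) (u0 : R[i]) (delta : R) (p : R[i] -> R).
Hypothesis delta0 : 0 < delta.
Hypothesis hp : has_density_on (closed_disk u0 delta) mu p.
Hypothesis cp : {for u0, continuous (p : R[i]^o -> R)}.
Local Notation toV := (to_plane u0).

Let mtoV : measurable_fun setT toV := measurable_to_plane u0.

Lemma far_integrable a (h : V -> R) M : measurable_fun setT h ->
  (forall v, a ^+ 2 <= normsq v -> `|h v| <= M) ->
  mu.-integrable (far u0 a) (EFin \o (fun z => h (toV z))).
Proof.
move=> mh hM; have [[v av]|no] := pselect (exists v : V, a ^+ 2 <= normsq v); last first.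
  have -> : far u0 a = set0.
    by apply/seteqP; split=> // z fz; case: no; exists (toV z).
  exact: integrable_set0.
have M0 : 0 <= M by rewrite (le_trans _ (hM v av)).
have ib : mu.-integrable setT (EFin \o (fun z => \1_(far u0 a) z * h (toV z))).
  apply: bounded_measurable_integrable; split.
    apply: measurable_funM; first by apply: measurable_indic; exact: measurable_far.
    exact: (measurableT_comp mh mtoV).
  exists M => z; rewrite indicE; have [/set_mem fz|_] := boolP (z \in _).
    by rewrite mul1r hM.
  by rewrite mul0r normr0.
have := integrableS measurableT (measurable_far u0 a) (@subsetT _ _) ib.
apply: eq_integrable; first exact: measurable_far.
by move=> z fz /=; rewrite indicE fz mul1r.
Qed.

(** The bound 1 / a on one of the three factors gives only O(- ln a). The small factor comes from a
    second radius K a: up to it the mass is O(K^2 a^2) and the cube at most a^-3, a bounded total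
    after multiplication by [a]; beyond it one factor is at most 1 / (K a). *)
Lemma far_cube_le eta : 0 < eta -> exists2 a0 : R, 0 < a0 & forall a, 0 < a -> a < a0 ->
  a * \int[mu]_(z in far u0 a) (inv_abs (toV z) ^+ 3) <= eta * (- ln a).
Proof.
move=> eta0; have [C2 C20 [a1 a10 H2]] := far_sqr_le delta0 hp cp.
have [C C0 HC] := disk_mass delta0 hp cp.
pose K := 2 * C2 / eta; have K0 : 0 < K by rewrite divr_gt0// mulr_gt0.
pose L0 := 2 * (C * K ^+ 2) / eta.
exists (Num.min a1 (expR (- L0))); first by rewrite lt_min a10 expR_gt0.
move=> a a0; rewrite lt_min => /andP[aa1 aL].
have LL : L0 <= - ln a by rewrite lerNr -[leRHS]expRK ler_ln ?posrE ?expR_gt0// ltW.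
have ai0 : 0 <= a^-1 by rewrite invr_ge0 ltW.
pose b := K * a; have b0 : 0 < b by rewrite mulr_gt0.
pose D : set V := [set v | normsq v <= b ^+ 2].
have mD : measurable D by apply: measurable_set_le => //; exact: measurable_normsq.
have mE : measurable (toV @^-1` D) by rewrite -[X in measurable X]setTI; exact: mtoV.
have mabs := @measurable_inv_abs R.
have m1 : measurable_fun setT (\1_D : V -> R) by exact: measurable_indic.
have i1 := @far_integrable a (\1_D) 1 m1.
have i2 : mu.-integrable (far u0 a) (EFin \o (fun z => (inv_abs (toV z)) ^+ 2)).
  apply: (@far_integrable a (fun v => inv_abs v ^+ 2) (a^-1 ^+ 2)).
    exact: measurable_funX.
  move=> v av; rewrite ger0_norm ?sqr_ge0// lerXn2r ?nnegrE ?inv_abs_ge0//.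
  exact: inv_abs_le.
have i3 : mu.-integrable (far u0 a) (EFin \o (fun z => (inv_abs (toV z)) ^+ 3)).
  apply: (@far_integrable a (fun v => inv_abs v ^+ 3) (a^-1 ^+ 3)).
    exact: measurable_funX.
  move=> v av; rewrite ger0_norm ?exprn_ge0 ?inv_abs_ge0// lerXn2r ?nnegrE ?inv_abs_ge0//.
  exact: inv_abs_le.
have {}i1 : mu.-integrable (far u0 a) (EFin \o (fun z => \1_D (toV z) : R)).
  by apply: i1 => v _; rewrite indicE ger0_norm// lern1 leq_b1.
have mf := measurable_far u0 a.
have le : \int[mu]_(z in far u0 a) (inv_abs (toV z) ^+ 3) <=
    \int[mu]_(z in far u0 a) (a^-1 ^+ 3 * \1_D (toV z) + b^-1 * inv_abs (toV z) ^+ 2).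
  apply: le_Rintegral => //.
    rewrite (_ : (EFin \o _) = (fun z => ((a^-1 ^+ 3)%:E * (\1_D (toV z))%:E) +
       ((b^-1)%:E * (inv_abs (toV z) ^+ 2)%:E))%E); last first.
      by apply/funext => z /=; rewrite EFinD !EFinM.
    by apply: integrableD => //; exact: integrableZl.
  move=> z fz; have [Dz|nDz] := pselect (D (toV z)).
    rewrite indicE mem_set// mulr1 (le_trans (y := a^-1 ^+ 3))//.
      by rewrite lerXn2r ?nnegrE ?inv_abs_ge0// inv_abs_le.
    by rewrite lerDl mulr_ge0 ?sqr_ge0// invr_ge0 ltW.
  rewrite indicE memNset// mulr0 add0r exprS ler_wpM2r ?sqr_ge0//.
  by rewrite inv_abs_le// ltW// ltNge; exact/negP.
rewrite RintegralD// in le; last 2 first.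
- exact: (integrableZl mf _ i1).
- exact: (integrableZl mf _ i2).
rewrite !RintegralZl// in le.
have I1 : \int[mu]_(z in far u0 a) \1_D (toV z) <= C * b ^+ 2.
  have -> : \int[mu]_(z in far u0 a) \1_D (toV z) = fine (mu (toV @^-1` D `&` far u0 a)).
    by rewrite /Rintegral; congr fine; exact: integral_indic.
  have mEf : measurable (toV @^-1` D `&` far u0 a) by exact: measurableI.
  rewrite -lee_fin fineK ?fin_num_measure//.
  apply: le_trans (HC _ b0); apply: le_measure; last by move=> z [].
    exact: mem_set.
  exact: mem_set.
have I2 := H2 a a0 aa1.
have bE : b ^+ 2 = K ^+ 2 * a ^+ 2 by rewrite /b exprMn.
have e1 : a * (a^-1 ^+ 3 * (C * b ^+ 2)) = C * K ^+ 2.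
  by rewrite bE; field; rewrite gt_eqF.
have e2 : a * (b^-1 * (C2 * - ln a)) = eta / 2 * (- ln a).
  by rewrite /b /K; field; rewrite !gt_eqF.
apply: (@le_trans _ _ (a * (a^-1 ^+ 3 * (C * b ^+ 2)) + a * (b^-1 * (C2 * - ln a)))).
  rewrite -mulrDr ler_wpM2l ?(ltW a0)// (le_trans le)//.
  apply: lerD.
    by rewrite ler_wpM2l// exprn_ge0.
  by rewrite ler_wpM2l// invr_ge0 ltW.
rewrite e1 e2; move: LL; rewrite /L0 ler_pdivrMr//; lra.
Qed.

End truncated_moments.

(** * Lindeberg's conditions for the inverse summands *)

Section inverse_clt.
Context (R : realType).
Local Notation mR := (measurableTypeR R).
Local Notation V := (mR * mR)%type.
Variables (mu : probability R[i] R) (u0 : R[i]) (delta : R) (p : R[i] -> R).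
Hypothesis delta0 : 0 < delta.
Hypothesis hp : has_density_on (closed_disk u0 delta) mu p.
Hypothesis cp : {for u0, continuous (p : R[i]^o -> R)}.
Local Notation toV := (to_plane u0).
Local Notation fars n := (far u0 (cutoff R n)).

Let mtoV : measurable_fun setT toV := measurable_to_plane u0.

Lemma dominated_inv_integrable (h : V -> R) : measurable_fun setT h ->
  (forall v, `|h v| <= inv_abs v) -> mu.-integrable setT (EFin \o (fun z => h (toV z))).
Proof.
move=> mh hm; have [C C0 HC] := disk_mass delta0 hp cp.
apply: le_integrable (inv_abs_integrable C0 HC) => //.
  by apply/measurable_EFinP; exact: (measurableT_comp mh mtoV).
by move=> z _ /=; rewrite lee_fin [leRHS]ger0_norm ?inv_abs_ge0.
Qed.

Section second.
Variables (h1 h2 : V -> R) (c1 c2 q : R).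
Hypotheses (mh1 : measurable_fun setT h1) (mh2 : measurable_fun setT h2).
Hypotheses (h1m : forall v, `|h1 v| <= inv_abs v) (h2m : forall v, `|h2 v| <= inv_abs v).
Hypothesis hq : forall e, 0 < e -> exists2 a0 : R, 0 < a0 & forall a, 0 < a -> a < a0 ->
  `|\int[mu]_(z in far u0 a) (h1 (toV z) * h2 (toV z)) - q * (- ln a)| <= e * (- ln a).

Let far_expand a : 0 < a ->
  \int[mu]_(z in far u0 a) ((h1 (toV z) - c1) * (h2 (toV z) - c2)) =
  \int[mu]_(z in far u0 a) (h1 (toV z) * h2 (toV z)) -
  c2 * \int[mu]_(z in far u0 a) h1 (toV z) - c1 * \int[mu]_(z in far u0 a) h2 (toV z) +
  c1 * c2 * fine (mu (far u0 a)).
Proof.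
move=> a0; have mf := measurable_far u0 a; have ai0 : 0 <= a^-1 by rewrite invr_ge0 ltW.
have i1 : mu.-integrable (far u0 a) (EFin \o (fun z => h1 (toV z))).
  by apply: (far_integrable mu u0 (M := a^-1)) => // v av; rewrite (le_trans (h1m v))// inv_abs_le.
have i2 : mu.-integrable (far u0 a) (EFin \o (fun z => h2 (toV z))).
  by apply: (far_integrable mu u0 (M := a^-1)) => // v av; rewrite (le_trans (h2m v))// inv_abs_le.
have i12 : mu.-integrable (far u0 a) (EFin \o (fun z => h1 (toV z) * h2 (toV z))).
  apply: (far_integrable mu u0 (h := fun v => h1 v * h2 v) (M := a^-1 * a^-1)).
    exact: measurable_funM.
  by move=> v av; rewrite normrM ler_pM// (le_trans (h1m v), le_trans (h2m v))// inv_abs_le.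
have ic : mu.-integrable (far u0 a) (EFin \o (fun z : R[i] => c1 * c2)).
  by apply: (far_integrable mu u0 (h := fun=> c1 * c2) (M := `|c1 * c2|)).
have iZ1 : mu.-integrable (far u0 a) (EFin \o (fun z => c2 * h1 (toV z))).
  exact: (integrableZl mf _ i1).
have iZ2 : mu.-integrable (far u0 a) (EFin \o (fun z => c1 * h2 (toV z))).
  exact: (integrableZl mf _ i2).
have iB1 : mu.-integrable (far u0 a) (EFin \o (fun z => h1 (toV z) * h2 (toV z) - c2 * h1 (toV z))).
  exact: (integrableB mf i12 iZ1).
have iB2 : mu.-integrable (far u0 a) (EFin \o
    (fun z => h1 (toV z) * h2 (toV z) - c2 * h1 (toV z) - c1 * h2 (toV z))).
  exact: (integrableB mf iB1 iZ2).
transitivity (\int[mu]_(z in far u0 a)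
   (h1 (toV z) * h2 (toV z) - c2 * h1 (toV z) - c1 * h2 (toV z) + c1 * c2)).
  by apply: eq_Rintegral => z _; ring.
rewrite RintegralD// RintegralB// RintegralB//.
rewrite (RintegralZl c2 mf i1) (RintegralZl c1 mf i2).
by congr (_ + _); rewrite /Rintegral integral_cst// fineM//; exact: fin_num_measure.
Qed.

(** Since scale^2 = n ln n, only a division by ln n remains. It kills the centering terms, which
    stay bounded because the inverse distance is integrable, and turns q (- ln cutoff) into q /
    2. *)
Lemma cutoff_covariance :
  n%:R * \int[mu]_(z in fars n) ((h1 (toV z) - c1) / scale R n * ((h2 (toV z) - c2) / scale R n))
    @[n --> \oo] --> q / 2.
Proof.
apply/cvgrPdist_le => e e0.
have [C C0 HC] := disk_mass delta0 hp cp.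
have iabs := inv_abs_integrable C0 HC.
pose I := \int[mu]_z inv_abs (toV z).
have I1 (h : V -> R) a : measurable_fun setT h -> (forall v, `|h v| <= inv_abs v) ->
    `|\int[mu]_(z in far u0 a) h (toV z)| <= I.
  move=> mh hm; have ih := dominated_inv_integrable mh hm.
  have mf := measurable_far u0 a.
  have ihf := integrableS measurableT mf (@subsetT _ _) ih.
  have iaf := integrableS measurableT mf (@subsetT _ _) iabs.
  apply: (le_trans (le_normr_Rintegral mf ihf)).
  apply: (@le_trans _ _ (\int[mu]_(z in far u0 a) inv_abs (toV z))).
    by apply: le_Rintegral => //; exact: integrable_norm.
  rewrite /I /Rintegral; apply: fine_le.
  - exact: integrable_fin_num.
  - exact: integrable_fin_num.
  - apply: ge0_subset_integral => //.
    by move: iabs => /integrableP[].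
    by move=> z _; rewrite lee_fin inv_abs_ge0.
pose K := `|c2| * I + `|c1| * I + `|c1 * c2|.
have e30 : 0 < e / 3 by rewrite divr_gt0.
have [a0 a00 Ha] := hq e30.
have ratio := @cutoff_ratio R.
have e1 : 0 < Num.min 2^-1 (e / 3 / (`|q| + 1)).
  by rewrite lt_min invr_gt0 ltr0n/= divr_gt0 ?divr_gt0// ltr_wpDl.
have /cvgrPdist_le /(_ _ e1) rat := ratio.
near=> n.
have n0 : 0 < n%:R :> R by near: n; exact: nbhs_infty_gtr.
have l1 : 1 <= ln n%:R :> R by near: n; exact: near_ln_ge.
have lK : 3 * K / e <= ln n%:R :> R by near: n; exact: near_ln_ge.
have s1 : 1 <= scale R n by near: n; exact: near_scale_ge.
have s2 := @scale_sqr R n (le_trans ler01 l1).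
have [a1 a2] : 0 < cutoff R n /\ cutoff R n < a0 by near: n; exact: near_cutoff.
have r : `|2^-1 - - ln (cutoff R n) / ln n%:R| <= Num.min 2^-1 (e / 3 / (`|q| + 1)).
  by near: n.
have := Ha _ a1 a2; set a := cutoff R n in a1 a2 r *.
set L := - ln a in r *; set l := ln n%:R in l1 lK s2 r *.
have l0 : 0 < l by rewrite (lt_le_trans ltr01).
have s0 : 0 < scale R n by rewrite (lt_le_trans ltr01).
move: r; rewrite le_min => /andP[r1 r2].
have rL : L / l <= 1.
  by move: r1; rewrite ler_norml => /andP[+ _]; lra.
set J := \int[mu]_(z in far u0 a) (h1 (toV z) * h2 (toV z)) => HJ.
have -> : n%:R * \int[mu]_(z in far u0 a)
   ((h1 (toV z) - c1) / scale R n * ((h2 (toV z) - c2) / scale R n)) =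
   l^-1 * \int[mu]_(z in far u0 a) ((h1 (toV z) - c1) * (h2 (toV z) - c2)).
  transitivity (n%:R * \int[mu]_(z in far u0 a)
      ((scale R n ^+ 2)^-1 * ((h1 (toV z) - c1) * (h2 (toV z) - c2)))).
    congr (_ * _); apply: eq_Rintegral => z _.
    by rewrite mulrACA mulrC -expr2 exprVn.
  have ai0 : 0 <= a^-1 by rewrite invr_ge0 ltW.
  rewrite RintegralZl//; last 2 first.
  - exact: measurable_far.
  - apply: (far_integrable mu u0 (h := fun v => (h1 v - c1) * (h2 v - c2))
      (M := (a^-1 + `|c1|) * (a^-1 + `|c2|))).
      by apply: measurable_funM; exact: measurable_funB.
    move=> v av; rewrite normrM ler_pM//.
      by rewrite (le_trans (ler_normB _ _))// lerD2r (le_trans (h1m v))// inv_abs_le.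
    by rewrite (le_trans (ler_normB _ _))// lerD2r (le_trans (h2m v))// inv_abs_le.
  by rewrite s2 mulrA; congr (_ * _); rewrite invfM mulrA divff ?mul1r// gt_eqF.
rewrite far_expand// -/J.
set X1 := \int[mu]_(z in _) h1 _; set X2 := \int[mu]_(z in _) h2 _; set m := fine _.
have x1 : `|X1| <= I by exact: I1.
have x2 : `|X2| <= I by exact: I1.
have m1 : `|m| <= 1.
  rewrite ger0_norm ?fine_ge0// -lee_fin fineK ?fin_num_measure//; last exact: measurable_far.
  exact: probability_le1 (measurable_far _ _).
pose E := - c2 * X1 - c1 * X2 + c1 * c2 * m.
have EK : `|E| <= K.
  rewrite /E /K (le_trans (ler_normD _ _))// lerD//; last first.
    by rewrite [leLHS]normrM -[leRHS]mulr1 ler_wpM2l.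
  rewrite (le_trans (ler_normB _ _))// !normrM normrN lerD// ler_wpM2l//.
have -> : q / 2 - l^-1 * (J - c2 * X1 - c1 * X2 + c1 * c2 * m) =
    q * (2^-1 - L / l) - l^-1 * (J - q * L) - l^-1 * E.
  by rewrite /E; field; rewrite gt_eqF.
have t1 : `|q * (2^-1 - L / l)| <= e / 3.
  rewrite normrM (@le_trans _ _ ((`|q| + 1) * (e / 3 / (`|q| + 1))))//.
    by rewrite ler_pM// lerDl.
  by rewrite mulrC divfK// gt_eqF// ltr_wpDl.
have li : 0 < l^-1 by rewrite invr_gt0.
have t2 : `|l^-1 * (J - q * L)| <= e / 3.
  rewrite normrM gtr0_norm// (@le_trans _ _ (l^-1 * (e / 3 * L)))//.
    by rewrite ler_wpM2l// ltW.
  by rewrite mulrCA [l^-1 * L]mulrC ler_piMr// ltW.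
have t3 : `|l^-1 * E| <= e / 3.
  rewrite normrM gtr0_norm// (@le_trans _ _ (l^-1 * K))//.
    by rewrite ler_wpM2l// ltW.
  by rewrite ler_pdivrMl//; move: lK; rewrite ler_pdivrMr//; lra.
rewrite (le_trans (ler_normB _ _))// (_ : e = e / 3 + e / 3 + e / 3); last by field.
by rewrite lerD// (le_trans (ler_normB _ _))// lerD.
Unshelve. all: by end_near. Qed.

End second.

Section higher.
Variables c1 c2 : R.
Let A n z := (inv_re (toV z) - c1) / scale R n.
Let B n z := (inv_im (toV z) - c2) / scale R n.
Let F := `|c1| + `|c2|.

Let AB_le n z : 0 < scale R n ->
  `|A n z| + `|B n z| <= (2 * inv_abs (toV z) + F) / scale R n.
Proof.
move=> s0; rewrite /A /B !normrM [ `|_^-1|]ger0_norm ?invr_ge0 ?(ltW s0)//.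
rewrite -mulrDl ler_wpM2r ?invr_ge0 ?(ltW s0)//.
have := ler_normB (inv_re (toV z)) c1; have := ler_normB (inv_im (toV z)) c2.
have := inv_re_le (toV z); have := inv_im_le (toV z).
rewrite -/(inv_abs _) /F; lra.
Qed.

Let mAB n (D : set R[i]) : measurable_fun D (fun z => `|A n z| + `|B n z|).
Proof.
apply: measurable_funTS; apply: measurable_funD; apply: measurableT_comp => //.
  apply: measurable_funM => //; apply: measurable_funB => //.
  exact: (measurableT_comp (@measurable_inv_re R) mtoV).
apply: measurable_funM => //; apply: measurable_funB => //.
exact: (measurableT_comp (@measurable_inv_im R) mtoV).
Qed.

(** As n scale^-3 = cutoff / (2 ln n), the claim is [far_cube_le] at the cutoff, whose factor [eta]
    is free. *)
Lemma cutoff_third_moment :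
  n%:R * \int[mu]_(z in fars n) (`|A n z| + `|B n z|) ^+ 3 @[n --> \oo] --> (0 : R).
Proof.
apply/cvgrPdist_le => e e0.
have eta0 : 0 < e / 32 by rewrite divr_gt0.
have [a0 a00 Ha] := far_cube_le delta0 hp cp eta0.
have /cvgrPdist_le rat := @cutoff_ratio R.
have h0 : 0 < 2^-1 :> R by [].
near=> n.
have n0 : 0 < n%:R :> R by near: n; exact: nbhs_infty_gtr.
have l1 : 1 <= ln n%:R :> R by near: n; exact: near_ln_ge.
have lK : 8 * F ^+ 3 / e <= ln n%:R :> R by near: n; exact: near_ln_ge.
have s1 : 1 <= scale R n by near: n; exact: near_scale_ge.
have s2 := @scale_sqr R n (le_trans ler01 l1).
have [a1 a2] : 0 < cutoff R n /\ cutoff R n < a0 by near: n; exact: near_cutoff.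
have r : `|2^-1 - - ln (cutoff R n) / ln n%:R| <= 2^-1 by near: n; exact: rat.
have := Ha _ a1 a2; have := erefl (cutoff R n); rewrite {2}/cutoff.
set a := cutoff R n in a1 a2 r *; move=> aE.
set L := - ln a in r *; set l := ln n%:R in l1 lK s2 r *.
have l0 : 0 < l by rewrite (lt_le_trans ltr01).
have s0 : 0 < scale R n by rewrite (lt_le_trans ltr01).
have si0 : 0 <= (scale R n)^-1 by rewrite invr_ge0 ltW.
have ai0 : 0 <= a^-1 by rewrite invr_ge0 ltW.
have rL : L <= l.
  have : L / l <= 1 by move: r; rewrite ler_norml => /andP[+ _]; lra.
  by rewrite ler_pdivrMr// mul1r.
set J := \int[mu]_(z in far u0 a) _ => HJ.
have mf := measurable_far u0 a.
have F0 : 0 <= F by rewrite addr_ge0.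
have i3 : mu.-integrable (far u0 a) (EFin \o (fun z => inv_abs (toV z) ^+ 3)).
  apply: (far_integrable mu u0 (h := fun v => inv_abs v ^+ 3) (M := a^-1 ^+ 3)).
    by apply: measurable_funX; exact: measurable_inv_abs.
  move=> v av; rewrite ger0_norm ?exprn_ge0 ?inv_abs_ge0// lerXn2r ?nnegrE ?inv_abs_ge0//.
  exact: inv_abs_le.
have ic : mu.-integrable (far u0 a) (EFin \o (fun z : R[i] => 4 * F ^+ 3)).
  by apply: (far_integrable mu u0 (h := fun=> 4 * F ^+ 3) (M := `|4 * F ^+ 3|)).
have iZ : mu.-integrable (far u0 a) (EFin \o (fun z => 32 * inv_abs (toV z) ^+ 3)).
  exact: (integrableZl mf _ i3).
have iD : mu.-integrable (far u0 a) (EFin \o (fun z => 32 * inv_abs (toV z) ^+ 3 + 4 * F ^+ 3)).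
  exact: (integrableD mf iZ ic).
have iU : mu.-integrable (far u0 a) (EFin \o (fun z =>
    (scale R n)^-1 ^+ 3 * (32 * inv_abs (toV z) ^+ 3 + 4 * F ^+ 3))).
  exact: (integrableZl mf _ iD).
have AB0 z : 0 <= `|A n z| + `|B n z| by exact: addr_ge0.
have cube z : (`|A n z| + `|B n z|) ^+ 3 <=
    (scale R n)^-1 ^+ 3 * (32 * inv_abs (toV z) ^+ 3 + 4 * F ^+ 3).
  have h := AB_le z s0; have m0 := inv_abs_ge0 (toV z).
  apply: (@le_trans _ _ (((2 * inv_abs (toV z) + F) / scale R n) ^+ 3)).
    by rewrite lerXn2r ?nnegrE// (le_trans (AB0 z)).
  rewrite exprMn mulrC ler_wpM2l ?exprn_ge0//.
  set m := inv_abs _ in m0 *.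
  (* This is (x + y)^3 <= 4 (x^3 + y^3) for x = 2 m and y = F, with an explicit difference. *)
  rewrite -subr_ge0 (_ : _ - _ = 3 * ((2 * m + F) * (2 * m - F) ^+ 2)); last by ring.
  by rewrite mulr_ge0// mulr_ge0 ?sqr_ge0// addr_ge0// mulr_ge0.
have iA : mu.-integrable (far u0 a) (EFin \o (fun z => (`|A n z| + `|B n z|) ^+ 3)).
  apply: le_integrable iU => //.
    by apply/measurable_EFinP; apply: measurable_funX; exact: mAB.
  move=> z _; rewrite /= lee_fin ger0_norm ?exprn_ge0//.
  by rewrite (le_trans (cube z))// ler_norm.
have le := le_Rintegral mf iA iU (fun z _ => cube z).
rewrite RintegralZl// RintegralD// (RintegralZl 32 mf i3) -/J in le.
have Ic : \int[mu]_(z in far u0 a) (4 * F ^+ 3) <= 4 * F ^+ 3.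
  rewrite /Rintegral integral_cst// -lee_fin fineK.
    rewrite -[leRHS]mule1 lee_wpmul2l ?lee_fin ?mulr_ge0 ?exprn_ge0//.
    exact: probability_le1.
  by rewrite fin_numM// fin_num_measure.
rewrite sub0r normrN ger0_norm; last first.
  by rewrite mulr_ge0// Rintegral_ge0// => z _; rewrite exprn_ge0.
apply: (@le_trans _ _ (n%:R * ((scale R n)^-1 ^+ 3 * (32 * J + 4 * F ^+ 3)))).
  rewrite ler_pM2l// (le_trans le)// ler_wpM2l ?exprn_ge0//; lra.
have -> : n%:R * ((scale R n)^-1 ^+ 3 * (32 * J + 4 * F ^+ 3)) =
    l^-1 * (16 * (a * J) + 4 * F ^+ 3 / scale R n).
  rewrite aE /cutoff exprS [_^-1 ^+ 2]exprVn s2; field.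
  by rewrite !gt_eqF.
rewrite ler_pdivrMl//.
have fs : 4 * F ^+ 3 / scale R n <= 4 * F ^+ 3.
  by rewrite ler_piMr ?mulr_ge0 ?exprn_ge0// invf_le1.
have eL : e / 32 * L <= e / 32 * l by rewrite ler_wpM2l// ltW.
move: lK; rewrite ler_pdivrMr//; move=> lK; lra.
Unshelve. all: by end_near. Qed.

(** Both the mass of the small disk and the scaled first moment over it are of order cutoff^2 = 4 /
    (n ln n); the logarithm in the scale makes n times this vanish. *)
Lemma cutoff_tail :
  n%:R * \int[mu]_(z in ~` fars n) (1 + `|A n z| + `|B n z|) @[n --> \oo] --> (0 : R).
Proof.
apply/cvgrPdist_le => e e0.
have [C C0 HC] := disk_mass delta0 hp cp.
have iabs := inv_abs_integrable C0 HC.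
near=> n.
have n0 : 0 < n%:R :> R by near: n; exact: nbhs_infty_gtr.
have l1 : 1 <= ln n%:R :> R by near: n; exact: near_ln_ge.
have lK : 16 * C / e <= ln n%:R :> R by near: n; exact: near_ln_ge.
have s1 : 1 + F <= scale R n by near: n; exact: near_scale_ge.
have s2 := @scale_sqr R n (le_trans ler01 l1).
have F0 : 0 <= F by rewrite addr_ge0.
have s0 : 0 < scale R n by rewrite (lt_le_trans _ s1)// ltr_pwDl.
have := erefl (cutoff R n); rewrite {2}/cutoff.
set a := cutoff R n => aE; have a0 : 0 < a by rewrite aE divr_gt0.
set l := ln n%:R in l1 lK s2; have l0 : 0 < l by rewrite (lt_le_trans ltr01).
have mN : measurable (~` far u0 a) by apply: measurableC; exact: measurable_far.
have iN := integrableS measurableT mN (@subsetT _ _) iabs.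
pose U z := 2 + 2 / scale R n * inv_abs (toV z).
have i2 : mu.-integrable (~` far u0 a) (EFin \o (fun z : R[i] => 2 : R)).
  apply: (integrableS measurableT mN (@subsetT _ _)).
  by apply: bounded_measurable_integrable; exact: bounded_measurable_cst.
have iZ : mu.-integrable (~` far u0 a) (EFin \o (fun z => 2 / scale R n * inv_abs (toV z))).
  exact: (integrableZl mN _ iN).
have iU : mu.-integrable (~` far u0 a) (EFin \o U) by exact: (integrableD mN i2 iZ).
have leU z : 1 + `|A n z| + `|B n z| <= U z.
  have := AB_le z s0; rewrite mulrDl /U.
  have : F / scale R n <= 1 by rewrite ler_pdivrMr// mul1r; lra.
  rewrite (_ : 2 / scale R n * inv_abs (toV z) = 2 * inv_abs (toV z) / scale R n); last by rewrite mulrAC.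
  lra.
have AB0 z : 0 <= 1 + `|A n z| + `|B n z| by rewrite !addr_ge0.
have iA : mu.-integrable (~` far u0 a) (EFin \o (fun z => 1 + `|A n z| + `|B n z|)).
  apply: le_integrable iU => //.
    apply/measurable_EFinP; under eq_fun do rewrite -addrA.
    by apply: measurable_funD => //; exact: mAB.
  by move=> z _; rewrite /= lee_fin ger0_norm// (le_trans (leU z))// ler_norm.
have le := le_Rintegral mN iA iU (fun z _ => leU z).
have UE := etrans (RintegralD mN i2 iZ) (congr1 _ (RintegralZl (2 / scale R n) mN iN)).
rewrite /U UE in le.
have I1 := near_moment_le C0 HC a0.
have I2 : \int[mu]_(z in ~` far u0 a) 2 <= 2 * (C * a ^+ 2).
  rewrite /Rintegral integral_cst// -lee_fin fineK.
    rewrite EFinM lee_wpmul2l// (le_trans _ (HC a a0))//.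
    apply: le_measure; rewrite ?inE//.
      apply: measurable_set_le => //.
      exact: (measurableT_comp (@measurable_normsq R) mtoV).
    by move=> z /= /negP; rewrite -ltNge => /ltW.
  by rewrite fin_numM// fin_num_measure.
rewrite sub0r normrN ger0_norm; last first.
  by rewrite mulr_ge0// Rintegral_ge0.
apply: (@le_trans _ _ (n%:R * (2 * (C * a ^+ 2) + 2 / scale R n * (2 * C * a)))).
  rewrite ler_pM2l//; apply: (le_trans le); apply: lerD => //.
  by apply: ler_wpM2l => //; rewrite divr_ge0// ltW.
have -> : n%:R * (2 * (C * a ^+ 2) + 2 / scale R n * (2 * C * a)) = l^-1 * (16 * C).
  transitivity (n%:R / scale R n ^+ 2 * (16 * C)).
    by rewrite aE; field; rewrite gt_eqF.
  by rewrite s2 -/l; field; rewrite !gt_eqF.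
by rewrite ler_pdivrMl// -ler_pdivrMr.
Unshelve. all: by end_near. Qed.

End higher.

Let c1 := \int[mu]_z inv_re (toV z).
Let c2 := \int[mu]_z inv_im (toV z).

Definition scaled_inv_re n z := (inv_re (toV z) - c1) / scale R n.
Definition scaled_inv_im n z := (inv_im (toV z) - c2) / scale R n.

Let scaled_inv (h : V -> R) n : measurable_fun setT h ->
  (forall v, `|h v| <= inv_abs v) ->
  let A z := (h (toV z) - \int[mu]_z h (toV z)) / scale R n in
  [/\ measurable_fun setT A, mu.-integrable setT (EFin \o A) & \int[mu]_z A z = 0].
Proof.
move=> mh hm A; have ih := dominated_inv_integrable mh hm.
have ic c : mu.-integrable setT (EFin \o (fun _ : R[i] => c : R)).
  by apply: bounded_measurable_integrable; exact: bounded_measurable_cst.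
have iB : mu.-integrable setT (EFin \o (fun z => h (toV z) - \int[mu]_z h (toV z))).
  exact: (integrableB measurableT ih (ic _)).
have AE : A = (fun z => (scale R n)^-1 * (h (toV z) - \int[mu]_z h (toV z))).
  by apply/funext => z; rewrite mulrC.
rewrite AE; split.
- apply: measurable_funM => //; apply: measurable_funB => //.
  exact: (measurableT_comp mh mtoV).
- exact: (integrableZl measurableT _ iB).
- rewrite RintegralZl// RintegralB// Rintegral_prob_cst subrr mulr0//.
Qed.

Lemma scaled_inverse_clt psi psi1 psi2 phi phi1 phi2 C :
  taylor3 psi psi1 psi2 C -> taylor3 phi phi1 phi2 C ->
  (forall x, 0 <= psi x) -> (forall x, 0 <= phi x) ->
  iter n (averaging mu (plane_shift scaled_inv_re scaled_inv_im n)) (tensor psi phi) (0, 0)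
    @[n --> \oo] --> \int[gaussian_plane (pi * p u0 / 2)]_v tensor psi phi v.
Proof.
have p0 := density_at_center_ge0 delta0 hp.
have mre := @measurable_inv_re R; have mim := @measurable_inv_im R.
apply: (@iter_averaging_clt _ _ _ mu _ _ (fun n => fars n)).
- by move=> n; have [] := scaled_inv n mre (@inv_re_le R).
- by move=> n; have [] := scaled_inv n mim (@inv_im_le R).
- by move=> n; have [] := scaled_inv n mre (@inv_re_le R).
- by move=> n; have [] := scaled_inv n mim (@inv_im_le R).
- by move=> n; have [] := scaled_inv n mre (@inv_re_le R).
- by move=> n; have [] := scaled_inv n mim (@inv_im_le R).
- by move=> n; exact: measurable_far.
- near=> n => z fz.
  have s1 : 2 * `|c1| + 2 * `|c2| + 1 <= scale R n by near: n; exact: near_scale_ge.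
  have s0 : 0 < scale R n by rewrite (lt_le_trans _ s1)// ltr_wpDl// addr_ge0// mulr_ge0.
  have a0 : 0 < cutoff R n by rewrite divr_gt0.
  (* The 2 in the cutoff: half of the scale bounds the inverse, the other half is left for the
     mean. *)
  have m2 : inv_abs (toV z) <= scale R n / 2.
    by rewrite (le_trans (inv_abs_le a0 fz))// /cutoff invf_div.
  have c10 := normr_ge0 c1; have c20 := normr_ge0 c2.
  rewrite /scaled_inv_re /scaled_inv_im !normrM [ `|_^-1|]gtr0_norm ?invr_gt0//.
  rewrite !ler_pdivrMr// !mul1r; split.
    have := ler_normB (inv_re (toV z)) c1; have := inv_re_le (toV z).
    rewrite -/(inv_abs _); lra.
  have := ler_normB (inv_im (toV z)) c2; have := inv_im_le (toV z).
  rewrite -/(inv_abs _); lra.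
- by rewrite divr_ge0// mulr_ge0// pi_ge0.
- under eq_fun do under eq_Rintegral do rewrite expr2.
  apply: cutoff_covariance => //; try exact: inv_re_le.
  move=> e e0; have [a0 a00 H] := second_moment delta0 hp cp e0.
  by exists a0 => // a a1 a2; have [] := H a a1 a2.
- under eq_fun do under eq_Rintegral do rewrite expr2.
  apply: cutoff_covariance => //; try exact: inv_im_le.
  move=> e e0; have [a0 a00 H] := second_moment delta0 hp cp e0.
  by exists a0 => // a a1 a2; have [] := H a a1 a2.
- rewrite -[X in _ --> X](mul0r 2^-1).
  apply: cutoff_covariance => //; try exact: inv_re_le; try exact: inv_im_le.
  move=> e e0; have [a0 a00 H] := second_moment delta0 hp cp e0.
  by exists a0 => // a a1 a2; have [_ _] := H a a1 a2; rewrite mul0r subr0.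
- exact: cutoff_third_moment.
- exact: cutoff_tail.
Unshelve. all: by end_near. Qed.

End inverse_clt.

(** * Critical points in a small disk *)

Section complex_modulus.
Context (R : realType).
Import Normc.
Implicit Types x y z : R[i].

Lemma normc_ReIm z : normc z = Num.sqrt (complex.Re z ^+ 2 + complex.Im z ^+ 2).
Proof. by case: z. Qed.

Lemma normc_ge0 z : 0 <= normc z.
Proof. by rewrite normc_ReIm sqrtr_ge0. Qed.

Lemma normc_triangle x y : normc (x + y) <= normc x + normc y.
Proof. exact: le_normcD. Qed.

Lemma normc_opp x : normc (- x) = normc x.
Proof. exact: normcN. Qed.

Lemma normc_distC x y : normc (x - y) = normc (y - x).
Proof. by rewrite -normc_opp opprB. Qed.

Lemma normc_triangleB x y z : normc (x - z) <= normc (x - y) + normc (y - z).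
Proof. by rewrite -{1}(subrK y x) -addrA normc_triangle. Qed.

Lemma le_normc_sum n (F : nat -> R[i]) :
  normc (\sum_(k < n) F k) <= \sum_(k < n) normc (F k).
Proof.
elim: n => [|n ih]; first by rewrite !big_ord0 normc0.
by rewrite !big_ord_recr/= (le_trans (normc_triangle _ _))// lerD2r.
Qed.

Lemma normc_eq0 x : (normc x == 0) = (x == 0).
Proof. by apply/eqP/eqP => [/eq0_normc//|->]; rewrite normc0. Qed.

Lemma normc_gt0 x : (0 < normc x) = (x != 0).
Proof. by rewrite lt0r normc_eq0 normc_ge0 andbT. Qed.

Lemma normc_le_ReIm z : normc z <= `|complex.Re z| + `|complex.Im z|.
Proof.
rewrite normc_ReIm -[leRHS]ger0_norm ?addr_ge0// -sqrtr_sqr ler_sqrt ?sqr_ge0//.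
rewrite sqrrD !real_normK ?num_real// lerD2r lerDl.
by rewrite mulrn_wge0// mulr_ge0.
Qed.

Lemma Re_le_normc z : `|complex.Re z| <= normc z.
Proof. by rewrite normc_ReIm -sqrtr_sqr ler_sqrt ?addr_ge0 ?sqr_ge0// lerDl sqr_ge0. Qed.

Lemma Im_le_normc z : `|complex.Im z| <= normc z.
Proof. by rewrite normc_ReIm -sqrtr_sqr ler_sqrt ?addr_ge0 ?sqr_ge0// lerDr sqr_ge0. Qed.

Lemma closed_disk_normc u r z : closed_disk u r z <-> normc (z - u) <= r.
Proof. by rewrite /closed_disk/= normc_def lecR normc_ReIm. Qed.

End complex_modulus.

Section geometric_steps.
Context (R : realType).
Import Normc.

Lemma geometric_steps_cvg (x : nat -> R) c :
  (forall j, `|x j.+1 - x j| <= c * 2^-1 ^+ j) -> exists l : R, x n @[n --> \oo] --> l.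
Proof.
move=> xc; have g1 : `|2^-1| < 1 :> R by rewrite ger0_norm// invf_lt1// ltr1n.
have c0 : 0 <= c by have := xc 0%N; rewrite expr0 mulr1; exact: le_trans.
have gc : cvgn (series (geometric c 2^-1)) by exact: is_cvg_geometric_series.
have nc : cvgn [normed series (fun j => x j.+1 - x j)].
  apply: (series_le_cvg _ _ _ gc) => j //=.
  by rewrite mulr_ge0// exprn_ge0.
have /cvg_ex[l xl] := normed_cvg nc.
have xE n : x n = series (fun j => x j.+1 - x j) n + x 0%N.
  by rewrite /series/= telescope_sumr// subrK.
exists (l + x 0%N); rewrite (eq_cvg _ _ xE).
exact: (cvgD xl (cvg_cst (x 0%N))).
Qed.

(** Banach's theorem. Completeness is applied to the real and imaginary parts of the iterates
    separately, and closedness of [D] is stated by sequences in the real-valued modulus. *)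
Lemma complex_contraction_fixed_point (D : set R[i]) (g : R[i] -> R[i]) (z0 : R[i]) :
  D z0 -> (forall z, D z -> D (g z)) ->
  (forall (z : nat -> R[i]) l, (forall j, D (z j)) ->
     normc (z j - l) @[j --> \oo] --> (0 : R) -> D l) ->
  (forall z w, D z -> D w -> normc (g z - g w) <= 2^-1 * normc (z - w)) ->
  exists2 z, D z & g z = z.
Proof.
move=> Dz0 Dg Dcl glip; pose z j := iter j g z0.
have Dz j : D (z j) by elim: j => // j ih; exact: Dg.
pose c := normc (g z0 - z0).
have step j : normc (z j.+1 - z j) <= c * 2^-1 ^+ j.
  elim: j => [|j ih]; first by rewrite expr0 mulr1.
  rewrite (le_trans (glip _ _ (Dz j.+1) (Dz j)))// exprS mulrCA ler_wpM2l//.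
have [a za] : exists a : R, complex.Re (z n) @[n --> \oo] --> a.
  apply: (@geometric_steps_cvg _ c) => j; rewrite (le_trans _ (step j))//.
  by rewrite (le_trans _ (Re_le_normc _))//; case: (z j.+1); case: (z j).
have [b zb] : exists b : R, complex.Im (z n) @[n --> \oo] --> b.
  apply: (@geometric_steps_cvg _ c) => j; rewrite (le_trans _ (step j))//.
  by rewrite (le_trans _ (Im_le_normc _))//; case: (z j.+1); case: (z j).
have zl : normc (z j - (a +i* b)) @[j --> \oo] --> (0 : R).
  apply: (@squeeze_cvgr _ _ _ _ (fun=> 0)
    (fun j => `|complex.Re (z j) - a| + `|complex.Im (z j) - b|)).
  - near=> j; rewrite normc_ge0/= (le_trans (normc_le_ReIm _))//.
    by case: (z j).
  - exact: cvg_cst.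
  - rewrite -[X in _ --> X](addr0 (0 : R)); apply: cvgD.
      by apply/norm_cvg0P; rewrite -(subrr a); apply: cvgB => //; exact: cvg_cst.
    by apply/norm_cvg0P; rewrite -(subrr b); apply: cvgB => //; exact: cvg_cst.
have Dl : D (a +i* b) by apply: Dcl zl.
exists (a +i* b) => //; apply/eqP; rewrite -subr_eq0 -normc_eq0.
rewrite eq_le normc_ge0 andbT; apply/ler_addgt0Pl => e e0; rewrite addr0.
have e20 : 0 < e / 2 by rewrite divr_gt0.
have /cvgrPdist_le /(_ _ e20) ze := zl.
have /cvgrPdist_le /(_ _ e20) zeS : normc (z j.+1 - (a +i* b)) @[j --> \oo] --> (0 : R).
  by rewrite (cvg_shiftS (fun j => normc (z j - (a +i* b)))).
near \oo => j.
have h1 : normc (z j - (a +i* b)) <= e / 2.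
  have : `|0 - normc (z j - (a +i* b))| <= e / 2 by near: j.
  by rewrite sub0r normrN ger0_norm ?normc_ge0.
have h2 : normc (z j.+1 - (a +i* b)) <= e / 2.
  have : `|0 - normc (z j.+1 - (a +i* b))| <= e / 2.
    by near: j.
  by rewrite sub0r normrN ger0_norm ?normc_ge0.
rewrite (le_trans (normc_triangleB _ (z j.+1) _))// (splitr e) lerD//.
rewrite (le_trans (glip _ _ Dl (Dz j)))// normc_distC.
rewrite (@le_trans _ _ (normc (z j - (a +i* b))))// ler_piMl ?normc_ge0//.
by rewrite invf_le1// ler1n.
Unshelve. all: by end_near. Qed.

End geometric_steps.

(** * Critical points as fixed points of a contraction *)

Section critical_points.
Context (R : realType).
Import Normc.
Variables (n : nat) (x : nat -> R[i]) (u : R[i]).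

Definition inverse_sum (z : R[i]) : R[i] := \sum_(k < n) (z - x k)^-1.
Definition inverse_square_sum : R := \sum_(k < n) normc (u - x k)^-1 ^+ 2.
Local Notation S := inverse_sum.
Local Notation Q := inverse_square_sum.

Lemma deriv_prod_root z : (forall k, (k < n)%N -> z != x k) ->
  (\prod_(k < n) ('X - (x k)%:P))^`().[z] = \prod_(k < n) (z - x k) * S z.
Proof.
rewrite /inverse_sum; elim: n => [|m ih] zx.
  by rewrite !big_ord0 mulr0 -[1]/(1%:P) derivC horner0.
rewrite !big_ord_recr/= derivM derivXsubC mulr1 hornerD hornerM ih; last first.
  by move=> k km; apply: zx; exact: ltnW.
rewrite hornerXsubC horner_prod.
have -> : \prod_(k < m) ('X - (x k)%:P).[z] = \prod_(k < m) (z - x k).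
  by apply: eq_bigr => k _; rewrite hornerXsubC.
have zm : z - x m != 0 by rewrite subr_eq0 zx.
by move: (z - x m) zm => t t0; rewrite mulrDr mulfK// mulrAC.
Qed.

(** The logarithmic derivative of the product is [inverse_sum], so away from the zeros criticality
    means (z - u) S(z) = -1. *)
Lemma deriv_poly_with_zeros z : (forall k, (k < n)%N -> z != x k) ->
  (poly_with_zeros u x n)^`().[z] = \prod_(k < n) (z - x k) * (1 + (z - u) * S z).
Proof.
move=> zx; rewrite /poly_with_zeros derivM derivXsubC mul1r hornerD hornerM hornerXsubC.
rewrite deriv_prod_root// horner_prod mulrDr mulr1 mulrCA; congr (_ + _).
by apply: eq_bigr => k _; rewrite hornerXsubC.
Qed.

(** [F] stands for n |f(u0)|. The hypotheses say that S(u) has nearly this size, that S varies by at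
    most a quarter of it over the disk, and that the expected displacement 1 / F fits well inside
    the disk. *)
Variables (r F : R).
Hypothesis r0 : 0 < r.
Hypothesis far_roots : forall k, (k < n)%N -> 2 * r < normc (u - x k).
Hypothesis SF : 3 / 4 * F <= normc (S u).
Hypothesis rQ : r * Q <= F / 8.
Hypothesis rF : 4 <= r * F.

Let F0 : 0 < F.
Proof. by rewrite -(pmulr_rgt0 _ r0) (lt_le_trans _ rF). Qed.

Let D z := normc (z - u) <= r.

Let Du : D u.
Proof. by rewrite /D subrr normc0 ltW. Qed.

Let Q0 : 0 <= Q.
Proof. by apply: sumr_ge0 => k _; exact: sqr_ge0. Qed.

Let root_neq z k : D z -> (k < n)%N -> z != x k.
Proof.
move=> Dz kn; apply/eqP => zx; have := far_roots kn.
have := Dz; rewrite /D normc_distC -zx; have := r0; lra.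
Qed.

Let inv_le z k : D z -> (k < n)%N -> normc (z - x k)^-1 <= 2 * normc (u - x k)^-1.
Proof.
move=> Dz kn; have fk := far_roots kn.
have h : normc (u - x k) / 2 <= normc (z - x k).
  have := normc_triangleB u z (x k); have := Dz; rewrite /D [normc (z - u)]normc_distC.
  have := r0; lra.
have p0 : 0 < normc (u - x k) by rewrite (lt_trans _ fk)// mulr_gt0.
rewrite !normcV -[leRHS]invrK invfM invrK lef_pV2 ?posrE//.
- by rewrite mulrC.
- by rewrite (lt_le_trans _ h)// divr_gt0.
- by rewrite mulr_gt0.
Qed.

Let inv_sub z w k : z != x k -> w != x k ->
  (z - x k)^-1 - (w - x k)^-1 = (w - z) * ((z - x k)^-1 * (w - x k)^-1).
Proof.
rewrite -!(subr_eq0 _ (x k)) => zx wx.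
rewrite (_ : w - z = (w - x k) - (z - x k)); last by ring.
by rewrite mulrBl mulrCA mulfV// mulr1 mulrA mulfV// mul1r.
Qed.

(** Stated with [c] to serve twice: c = 2 at any point of the disk and c = 1 at the center, which
    saves a factor 2 in [inverse_sum_lip]. *)
Let sum_lip z w c : D z -> D w ->
  (forall k, (k < n)%N -> normc (w - x k)^-1 <= c * normc (u - x k)^-1) ->
  normc (S z - S w) <= 2 * c * Q * normc (z - w).
Proof.
move=> Dz Dw wc; rewrite /inverse_sum -sumrB.
rewrite (le_trans (le_normc_sum _ (fun k => (z - x k)^-1 - (w - x k)^-1)))//.
rewrite /inverse_square_sum mulr_sumr mulr_suml; apply: ler_sum => k _.
rewrite inv_sub; [|exact: root_neq|exact: root_neq].
rewrite !normcM normc_distC mulrC ler_wpM2r ?normc_ge0//.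
rewrite (_ : 2 * c * _ = (2 * normc (u - x k)^-1) * (c * normc (u - x k)^-1)); last by ring.
by rewrite ler_pM ?normc_ge0 ?wc// inv_le.
Qed.

Let S_lip z w : D z -> D w -> normc (S z - S w) <= 4 * Q * normc (z - w).
Proof.
move=> Dz Dw; rewrite (_ : 4 = 2 * 2); last by ring.
by apply: sum_lip => // k kn; exact: inv_le.
Qed.

Lemma inverse_sum_lip z : normc (z - u) <= r ->
  normc (S z - S u) <= 2 * Q * normc (z - u).
Proof.
move=> Dz; rewrite (_ : 2 = 2 * 1); last by rewrite mulr1.
by apply: sum_lip => // k kn; rewrite mul1r.
Qed.

Let S_ge z : D z -> F / 2 <= normc (S z).
Proof.
move=> Dz; have h := inverse_sum_lip Dz.
have h2 : 2 * Q * normc (z - u) <= F / 4.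
  rewrite (@le_trans _ _ (2 * Q * r))//; first by rewrite ler_wpM2l// mulr_ge0.
  by have := rQ; lra.
have := normc_triangle (S z) (S u - S z); rewrite subrKC [normc (S u - _)]normc_distC.
have := SF; lra.
Qed.

Let S_neq0 z : D z -> S z != 0.
Proof.
by move=> Dz; rewrite -normc_gt0 (lt_le_trans _ (S_ge Dz))// divr_gt0.
Qed.

Let inv_S_le z : D z -> normc (S z)^-1 <= 2 / F.
Proof.
move=> Dz; rewrite normcV -[2 / F]invf_div lef_pV2 ?posrE ?S_ge ?divr_gt0//.
by rewrite normc_gt0 S_neq0.
Qed.

Let step z := u - (S z)^-1.

Let D_step z : D z -> D (step z).
Proof.
move=> Dz; rewrite /D /step addrAC subrr sub0r normc_opp.
rewrite (le_trans (inv_S_le Dz))// ler_pdivrMr//; have := rF; lra.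
Qed.

Let step_lip z w : D z -> D w -> normc (step z - step w) <= 2^-1 * normc (z - w).
Proof.
move=> Dz Dw.
have -> : step z - step w = (S z - S w) * ((S z)^-1 * (S w)^-1).
  by rewrite /step; field; rewrite !S_neq0.
rewrite !normcM (@le_trans _ _ (4 * Q * normc (z - w) * (2 / F * (2 / F))))//.
  by rewrite ler_pM ?mulr_ge0 ?normc_ge0 ?S_lip ?ler_pM ?normc_ge0 ?inv_S_le.
rewrite mulrAC ler_wpM2r ?normc_ge0//.
rewrite (_ : 4 * Q * _ = 16 * Q / F ^+ 2); last by field; rewrite gt_eqF.
rewrite ler_pdivrMr ?exprn_gt0//.
(* The Lipschitz constant is 16 Q / F^2 = 16 (r Q) / (F (r F)), at most 16 / (8 * 4) = 1 / 2 by [rQ]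
   and [rF]. *)
have h : 8 * (r * Q) * 4 <= F * (r * F).
  by rewrite ler_pM// ?mulr_ge0// ?(ltW r0)//; have := rQ; lra.
have h2 : r * (32 * Q) <= r * F ^+ 2 by move: h; rewrite expr2; lra.
by rewrite ler_pM2l// in h2; lra.
Qed.

Lemma critical_in_diskE z :
  critical_in_disk (poly_with_zeros u x n) u r z <-> D z /\ z - u = - (S z)^-1.
Proof.
have key : D z -> (is_critical_point (poly_with_zeros u x n) z <-> z - u = - (S z)^-1).
  move=> Dz; rewrite /is_critical_point deriv_poly_with_zeros; last first.
    by move=> k kn; exact: root_neq.
  have pn0 : \prod_(k < n) (z - x k) != 0.
    by apply/prodf_neq0 => k _; rewrite subr_eq0 root_neq.
  have S0 := S_neq0 Dz; split=> [/eqP|zu].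
    rewrite mulf_eq0 (negbTE pn0)/= addrC addr_eq0 => /eqP h.
    by apply: (mulIf S0); rewrite h mulNr mulVf.
  by rewrite zu mulNr mulVf// subrr mulr0.
split=> -[].
  by move=> /closed_disk_normc Dz /key; auto.
by move=> Dz zu; split; [exact/closed_disk_normc|exact/key].
Qed.

Lemma unique_critical_in_disk : exists! z, critical_in_disk (poly_with_zeros u x n) u r z.
Proof.
have Dcl (z : nat -> R[i]) l : (forall j, D (z j)) ->
     normc (z j - l) @[j --> \oo] --> (0 : R) -> D l.
  move=> Dz zl; apply/ler_addgt0Pl => e e0.
  have /cvgrPdist_le /(_ _ e0) ze := zl.
  near \oo => j.
  have : `|0 - normc (z j - l)| <= e by near: j.
  rewrite sub0r normrN ger0_norm ?normc_ge0// => h.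
  rewrite (le_trans (normc_triangleB _ (z j) _))// lerD//; first by rewrite normc_distC.
  exact: Dz.
have [z Dz zz] := complex_contraction_fixed_point Du D_step Dcl step_lip.
exists z; split.
  by apply/critical_in_diskE; split=> //; rewrite -{1}zz /step addrAC subrr sub0r.
move=> w /critical_in_diskE[Dw wu].
have ww : step w = w by rewrite /step -wu addrC subrK.
apply/eqP; rewrite -subr_eq0 -normc_eq0 eq_le normc_ge0 andbT.
have := step_lip Dz Dw; rewrite zz ww; have := normc_ge0 (z - w); lra.
Unshelve. all: by end_near. Qed.

(** Membership in the disk only gives distance [r]; the fixed-point equation improves it to 2 / F,
    of order 1 / n, and this makes S(z) - S(u) negligible. *)
Lemma critical_in_disk_dist z : critical_in_disk (poly_with_zeros u x n) u r z ->
  [/\ normc (z - u) <= 2 / F, z - u = - (S z)^-1, F / 2 <= normc (S z) &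
    normc (S z - S u) <= 4 * Q / F].
Proof.
move=> /critical_in_diskE[Dz zu].
have h : normc (z - u) <= 2 / F by rewrite zu normc_opp inv_S_le.
split=> //; first exact: S_ge.
rewrite (le_trans (inverse_sum_lip Dz))// (@le_trans _ _ (2 * Q * (2 / F)))//.
  by rewrite ler_wpM2l// mulr_ge0.
by rewrite (_ : 2 * Q * (2 / F) = 4 * Q / F)//; ring.
Qed.

End critical_points.

(** * Measurability of the critical point *)

Section random_zeros.
Context (R : realType) d (T : measurableType d).
Local Notation mR := (measurableTypeR R).
Local Notation V := (R * R)%type.

(* Rational points near K detect a zero in K, by compactness. *)
Lemma measurable_exists_zero (K : set V) (h : T -> V -> R) : compact K ->
  (forall w, continuous (h w)) -> (forall v, measurable_fun setT (h^~ v)) ->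
  measurable [set w | exists2 v, K v & h w v = 0].
Proof.
move=> cK ch mh.
pose q2 (q : rat * rat) : V := (ratr q.1, ratr q.2).
pose E (m : nat) := \bigcup_q [set w | (exists2 v, K v & ball v m.+1%:R^-1 (q2 q)) /\
  `|h w (q2 q)| < m.+1%:R^-1].
have mE m : measurable (E m).
  apply: countable_bigcupT_measurable => // q.
  have [Kq|nKq] := pselect (exists2 v, K v & ball v m.+1%:R^-1 (q2 q)); last first.
    by rewrite (_ : [set w | _] = set0)//; apply/seteqP; split=> // w [].
  rewrite (_ : [set w | _] = [set w | `|h w (q2 q)| < m.+1%:R^-1]).
    by apply: measurable_set_lt => //; exact: measurableT_comp.
  by apply/seteqP; split=> w // [].
suff -> : [set w | exists2 v, K v & h w v = 0] = \bigcap_m E m.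
  exact: bigcapT_measurable.
apply/seteqP; split=> w /=.
  move=> [v Kv hv] m _.
  have m0 : 0 < m.+1%:R^-1 :> R by rewrite invr_gt0.
  have /cvgrPdist_lt /(_ _ m0) /nbhs_ballP[e /= e0 ev] := ch w v.
  pose e' := Num.min e m.+1%:R^-1; have e'0 : 0 < e' by rewrite lt_min e0.
  have rq (a : R) : exists q : rat, `|a - ratr q| < e'.
    have [|q] := @rat_in_itvoo R (a - e') (a + e'); first by rewrite ltrD2l gtrN.
    rewrite in_itv/= => /andP[q1 q2']; exists q; rewrite ltr_norml; apply/andP; split; lra.
  have [q1 hq1] := rq v.1; have [q2' hq2] := rq v.2.
  have bv : ball v e' (q2 (q1, q2')) by split.
  exists (q1, q2') => //; split.
    by exists v => //; apply: le_ball bv; rewrite ge_min lexx orbT.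
  have := ev (q2 (q1, q2')); rewrite hv sub0r normrN; apply.
  by apply: le_ball bv; rewrite ge_min lexx.
move=> Ew.
have /choice[q hq] : forall m : nat, exists q : rat * rat,
    (exists2 v, K v & ball v m.+1%:R^-1 (q2 q)) /\ `|h w (q2 q)| < m.+1%:R^-1.
  by move=> m; have [q _ hq] := Ew m I; exists q.
have /choice[k hk] : forall m, exists v, K v /\ ball v m.+1%:R^-1 (q2 (q m)).
  by move=> m; have [[v Kv bv] _] := hq m; exists v.
have kK : \forall m \near \oo, K (k m) by apply: nearW => m; exact: (hk m).1.
have [v [Kv clv]] := cK (k @ \oo) _ kK.
exists v => //; apply/eqP; apply/negP => /negP hv0.
have hv : 0 < `|h w v| / 2 by rewrite divr_gt0// normr_gt0.
have /cvgrPdist_lt /(_ _ hv) /nbhs_ballP[e /= e0 ev] := ch w v.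
have e20 : 0 < e / 2 by rewrite divr_gt0.
have small : \forall m \near \oo, m.+1%:R^-1 < Num.min (e / 2) (`|h w v| / 2) :> R.
  by apply: near_infty_natSinv_lt (PosNum _); rewrite lt_min e20.
have := clv [set v' | exists2 m, v' = k m & m.+1%:R^-1 < Num.min (e / 2) (`|h w v| / 2)]
  (ball v (e / 2)).
case.
- have : \forall m \near \oo, exists2 m', k m = k m' & m'.+1%:R^-1 < Num.min (e / 2) (`|h w v| / 2).
    by near=> m; exists m => //; near: m.
  exact.
- exact: nbhsx_ballx.
move=> _ [[m -> ]]; rewrite lt_min => /andP[m1 m2] bk.
have bq : ball v e (q2 (q m)).
  rewrite (splitr e); apply: ball_triangle bk _; apply: le_ball (hk m).2; exact: ltW.
have h2 : `|h w v - h w (q2 (q m))| < `|h w v| / 2 := ev _ bq.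
have h1 := lt_trans (hq m).2 m2.
have := ler_normD (h w v - h w (q2 (q m))) (h w (q2 (q m))); rewrite subrK => h3.
have := le_lt_trans h3 (ltrD h2 h1); rewrite -splitr ltxx.
Unshelve. all: by end_near. Qed.

End random_zeros.

(** * Measurability and continuity of the random polynomial *)

Section random_polynomial.
Context (R : realType) d (T : measurableType d).
Local Notation mR := (measurableTypeR R).
Import Normc.

Lemma measurable_complexD (f g : T -> R[i]) : measurable_fun setT f ->
  measurable_fun setT g -> measurable_fun setT (fun w => f w + g w).
Proof.
move=> mf mg; apply: measurable_complex.
- rewrite (_ : (fun w => _) = (fun w => complex.Re (f w) + complex.Re (g w))); last first.
    by apply/funext => w; case: (f w); case: (g w).
  by apply: measurable_funD; apply: measurableT_comp => //; exact: measurable_Re.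
- rewrite (_ : (fun w => _) = (fun w => complex.Im (f w) + complex.Im (g w))); last first.
    by apply/funext => w; case: (f w); case: (g w).
  by apply: measurable_funD; apply: measurableT_comp => //; exact: measurable_Im.
Qed.

Lemma measurable_complexM (f g : T -> R[i]) : measurable_fun setT f ->
  measurable_fun setT g -> measurable_fun setT (fun w => f w * g w).
Proof.
move=> mf mg.
have mre := @measurable_Re R; have mim := @measurable_Im R.
apply: measurable_complex.
- rewrite (_ : (fun w => _) = (fun w => complex.Re (f w) * complex.Re (g w) -
    complex.Im (f w) * complex.Im (g w))); last first.
    by apply/funext => w; case: (f w); case: (g w).
  by apply: measurable_funB; apply: measurable_funM; apply: measurableT_comp.
- rewrite (_ : (fun w => _) = (fun w => complex.Re (f w) * complex.Im (g w) +
    complex.Im (f w) * complex.Re (g w))); last first.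
    by apply/funext => w; case: (f w); case: (g w).
  by apply: measurable_funD; apply: measurable_funM; apply: measurableT_comp.
Qed.

Lemma measurable_normc : measurable_fun setT (fun z : R[i] => normc z).
Proof.
have ms : measurable_fun setT (@Num.sqrt R).
  by apply: continuous_measurable_fun; exact: sqrt_continuous.
under eq_fun do rewrite normc_ReIm.
apply: (measurableT_comp ms); apply: measurable_funD; apply: measurable_funX.
  exact: measurable_Re.
exact: measurable_Im.
Qed.

(** Product and derivative are treated together because the product rule expresses each new
    derivative through both. *)
Lemma measurable_deriv_prod_root (xi : nat -> T -> R[i]) n z :
  (forall k, measurable_fun setT (xi k)) ->
  measurable_fun setT (fun w => \prod_(k < n) (z - xi k w)) /\
  measurable_fun setT (fun w => (\prod_(k < n) ('X - (xi k w)%:P))^`().[z]).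
Proof.
move=> mxi.
have mB k : measurable_fun setT (fun w => z - xi k w).
  rewrite (_ : (fun w => _) = (fun w => z + (-1) * xi k w)).
    by apply: measurable_complexD => //; exact: measurable_complexM.
  by apply/funext => w; rewrite mulN1r.
elim: n => [|n [ih1 ih2]].
  split.
    rewrite (_ : (fun w => _) = cst 1); first exact: measurable_cst.
    by apply/funext => w; rewrite big_ord0.
  rewrite (_ : (fun w => _) = cst 0); first exact: measurable_cst.
  by apply/funext => w; rewrite big_ord0 -[1]/(1%:P) derivC horner0.
split; first by under eq_fun do rewrite big_ord_recr/=; exact: measurable_complexM.
rewrite (_ : (fun w => _) = (fun w => (\prod_(k < n) ('X - (xi k w)%:P))^`().[z] *
   (z - xi n w) + \prod_(k < n) (z - xi k w))).
  by apply: measurable_complexD => //; exact: measurable_complexM.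
apply/funext => w; rewrite big_ord_recr/= derivM derivXsubC mulr1 hornerD hornerM.
rewrite hornerXsubC horner_prod; congr (_ + _).
by apply: eq_bigr => k _; rewrite hornerXsubC.
Qed.

Lemma measurable_deriv_poly_with_zeros (xi : nat -> T -> R[i]) n u z :
  (forall k, measurable_fun setT (xi k)) ->
  measurable_fun setT (fun w => (poly_with_zeros u (fun k => xi k w) n)^`().[z]).
Proof.
move=> mxi; have [m1 m2] := measurable_deriv_prod_root n z mxi.
rewrite (_ : (fun w => _) = (fun w => \prod_(k < n) (z - xi k w) +
   (z - u) * (\prod_(k < n) ('X - (xi k w)%:P))^`().[z])).
  by apply: measurable_complexD => //; exact: measurable_complexM.
apply/funext => w; rewrite /poly_with_zeros derivM derivXsubC mul1r hornerD hornerM.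
rewrite hornerXsubC horner_prod; congr (_ + _).
by apply: eq_bigr => k _; rewrite hornerXsubC.
Qed.

Lemma continuous_of_reim : continuous ((fun v : R * R => v.1 +i* v.2) : R * R -> R[i]^o).
Proof.
move=> v; apply/cvgrPdist_lt => e; rewrite ltcE/= => /andP[/eqP ei e0].
have -> : e = (complex.Re e)%:C by rewrite [LHS]complexE ei mulr0 addr0.
have e20 : 0 < complex.Re e / 2 by rewrite divr_gt0.
exists (ball v.1 (complex.Re e / 2), ball v.2 (complex.Re e / 2)) => /=.
  by split; exact: nbhsx_ballx.
move=> -[a b] [/= h1 h2].
rewrite normc_def ltcR -normc_ReIm (le_lt_trans (normc_le_ReIm _))//=.
by rewrite (splitr (complex.Re e)) ltrD.
Qed.

Let continuous_horner_ReIm (p : {poly R[i]}) :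
  continuous ((fun v => complex.Re p.[v.1 +i* v.2]) : R * R -> R) /\
  continuous ((fun v => complex.Im p.[v.1 +i* v.2]) : R * R -> R).
Proof.
elim/poly_ind: p => [|p c [ihr ihi]].
  by split=> v; rewrite /continuous_at; under eq_fun do rewrite horner0;
    rewrite horner0; exact: cvg_cst.
split=> v; rewrite /continuous_at.
- have E (y : R * R) : complex.Re (p * 'X + c%:P).[y.1 +i* y.2] =
    complex.Re p.[y.1 +i* y.2] * y.1 - complex.Im p.[y.1 +i* y.2] * y.2 + complex.Re c.
    by rewrite hornerMXaddC; case: p.[_] => a b; case: c.
  under eq_fun do rewrite E; rewrite E.
  apply: cvgD; last exact: cvg_cst.
  apply: cvgB; apply: cvgM; [exact: ihr|exact: cvg_fst|exact: ihi|exact: cvg_snd].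
- have E (y : R * R) : complex.Im (p * 'X + c%:P).[y.1 +i* y.2] =
    complex.Re p.[y.1 +i* y.2] * y.2 + complex.Im p.[y.1 +i* y.2] * y.1 + complex.Im c.
    by rewrite hornerMXaddC; case: p.[_] => a b; case: c.
  under eq_fun do rewrite E; rewrite E.
  apply: cvgD; last exact: cvg_cst.
  apply: cvgD; apply: cvgM; [exact: ihr|exact: cvg_snd|exact: ihi|exact: cvg_fst].
Qed.

Lemma continuous_horner_plane (p : {poly R[i]}) :
  continuous ((fun v : R * R => normc p.[v.1 +i* v.2]) : R * R -> R).
Proof.
have [cr ci] := continuous_horner_ReIm p.
move=> v; rewrite /continuous_at; under eq_fun do rewrite normc_ReIm !expr2.
rewrite normc_ReIm !expr2.
have c2 : {for v, continuous (fun v : R * R => complex.Re p.[v.1 +i* v.2] *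
    complex.Re p.[v.1 +i* v.2] + complex.Im p.[v.1 +i* v.2] * complex.Im p.[v.1 +i* v.2])}.
  by apply: cvgD; apply: cvgM; [exact: cr|exact: cr|exact: ci|exact: ci].
exact: (continuous_comp c2 (@sqrt_continuous R _)).
Qed.

End random_polynomial.

(** * Measurability of the unique critical point *)

Section measurable_critical_points.
Context (R : realType) d (T : measurableType d).
Local Notation mR := (measurableTypeR R).
Import Normc.
Variables (xi : nat -> T -> R[i]) (n : nat) (u : R[i]) (r : R).
Hypothesis mxi : forall k, measurable_fun setT (xi k).

Let crit w := critical_in_disk (poly_with_zeros u (fun k => xi k w) n) u r.

Let disk : set (R * R) := [set v | normc ('X - u%:P).[v.1 +i* v.2] <= r].

Let compact_disk : compact disk.
Proof.
pose box (a : R) := `[a - r, a + r]%classic : set R.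
have cb : compact (box (complex.Re u) `*` box (complex.Im u)).
  by apply: compact_setX; exact: segment_compact.
apply: subclosed_compact cb _.
  rewrite (_ : disk = (fun v : R * R => normc ('X - u%:P).[v.1 +i* v.2]) @^-1` [set x | x <= r])//.
  by apply: preimage_closed; [move=> v _; exact: continuous_horner_plane|exact: closed_le].
move=> [a b]; rewrite /disk/= hornerXsubC => abr.
have h1 := le_trans (Re_le_normc _) abr; have h2 := le_trans (Im_le_normc _) abr.
by split; rewrite /box/= in_itv/= -ler_distlC distrC; [move: h1|move: h2]; case: (u).
Qed.

Lemma measurable_critical_in (C : set (R * R)) : closed C ->
  measurable [set w | exists2 z, crit w z & C (complex.Re z, complex.Im z)].
Proof.
move=> clC; pose h (w : T) (v : R * R) :=
  normc (poly_with_zeros u (fun k => xi k w) n)^`().[v.1 +i* v.2].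
rewrite (_ : [set w | _] = [set w | exists2 v, (disk `&` C) v & h w v = 0]).
  apply: measurable_exists_zero.
  - exact: compact_closedI compact_disk clC.
  - by move=> w; exact: continuous_horner_plane.
  - move=> v; apply: (measurableT_comp (@measurable_normc R)).
    exact: measurable_deriv_poly_with_zeros.
apply/seteqP; split=> w /=.
  move=> [[a b] [zd zc] Cz]; exists (a, b) => /=.
    by split=> //; rewrite /disk/= hornerXsubC; apply/closed_disk_normc.
  by rewrite /h/= zc normc0.
move=> [[a b] [Dv Cv] hv]; exists (a +i* b) => //; split.
  by apply/closed_disk_normc; move: Dv; rewrite /disk/= hornerXsubC.
exact: eq0_normc.
Qed.

Let closed_coord_le (f : R * R -> R) q : continuous f -> closed [set v | f v <= q].
Proof.
move=> cf; rewrite (_ : [set v | _] = f @^-1` [set x | x <= q])//.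
by apply: preimage_closed; [move=> v _; exact: cf|exact: closed_le].
Qed.

Let closed_coord_ge (f : R * R -> R) q : continuous f -> closed [set v | q <= f v].
Proof.
move=> cf; rewrite (_ : [set v | _] = f @^-1` [set x | q <= x])//.
by apply: preimage_closed; [move=> v _; exact: cf|exact: closed_ge].
Qed.

(** Two critical points with different values of [f] are separated by two rationals; this turns
    non-uniqueness into a countable union of events about zeros in compact sets. *)
Let separated (f : R * R -> R) := \bigcup_(q : rat * rat)
  ([set w | exists2 z, crit w z & (f (complex.Re z, complex.Im z) <= ratr q.1)] `&`
   [set w | q.1 < q.2 /\ exists2 z, crit w z & (ratr q.2 <= f (complex.Re z, complex.Im z))]).

Let measurable_separated f : continuous f -> measurable (separated f).
Proof.
move=> cf; apply: countable_bigcupT_measurable => // -[q1 q2]; apply: measurableI.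
  by apply: (@measurable_critical_in [set v | f v <= ratr q1]); exact: closed_coord_le.
have [q12|nq] := boolP (q1 < q2); last first.
  by rewrite (_ : [set w | _] = set0)//; apply/seteqP; split=> // w [].
rewrite (_ : [set w | _] = [set w | exists2 z, crit w z &
   (ratr q2 <= f (complex.Re z, complex.Im z))]).
  by apply: (@measurable_critical_in [set v | ratr q2 <= f v]); exact: closed_coord_ge.
by apply/seteqP; split=> w //= [].
Qed.

Let separatedP f w z1 z2 : crit w z1 -> crit w z2 ->
  f (complex.Re z1, complex.Im z1) < f (complex.Re z2, complex.Im z2) -> separated f w.
Proof.
move=> c1 c2 f12; have [q2] := rat_in_itvoo f12; rewrite in_itv/= => /andP[fq qf].
have [q1] := rat_in_itvoo fq; rewrite in_itv/= => /andP[fq1 q1q].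
exists (q1, q2) => //=; split; first by exists z1 => //=; exact: ltW.
by split; [rewrite ltr_rat in q1q|exists z2 => //; exact: ltW].
Qed.

(** Uniqueness means that a critical point exists and that no two of them differ in real or in
    imaginary part. *)
Lemma measurable_unique_critical : measurable [set w | exists! z, crit w z].
Proof.
have cf1 : continuous (fst : R * R -> R) by move=> v; exact: cvg_fst.
have cf2 : continuous (snd : R * R -> R) by move=> v; exact: cvg_snd.
rewrite (_ : [set w | _] = [set w | exists2 z, crit w z & setT (complex.Re z, complex.Im z)]
   `\` (separated fst `|` separated snd)).
  apply: measurableD; first exact: measurable_critical_in closedT.
  by apply: measurableU; exact: measurable_separated.
apply/seteqP; split=> w /=.
  move=> [z [cz uz]]; split; first by exists z.
  by move=> [|] [[q1 q2] _ /= [[z1 c1 h1] [q12 [z2 c2 h2]]]];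
    move: q12; apply/negP; rewrite -leNgt -(@ler_rat R);
    rewrite -(uz _ c2) in h2; rewrite -(uz _ c1) in h1; exact: le_trans h1.
move=> [[z cz _] nsep]; exists z; split=> // z' cz'.
apply: contrapT => zz'; apply: nsep.
have [e1|n1] := eqVneq (complex.Re z) (complex.Re z').
  have n2 : complex.Im z != complex.Im z'.
    apply/eqP => e2; apply: zz'; case: z z' e1 e2 {cz cz'} => a b [a' b'] /= -> -> //.
  by right; move: n2; rewrite neq_lt => /orP[h|h];
    [apply: (separatedP cz cz')|apply: (separatedP cz' cz)].
by left; move: n1; rewrite neq_lt => /orP[h|h];
  [apply: (separatedP cz cz')|apply: (separatedP cz' cz)].
Qed.

Let good := [set w | exists! z, crit w z].

(** Where the critical point is unique, its coordinate is at least c exactly when some critical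
    point of the disk has coordinate at least c, which is a measurable event; so no measurable
    selection theorem is involved. *)
Lemma measurable_critical_choice (eta zeta : T -> R[i]) : measurable_fun setT eta ->
  (forall w, good w -> crit w (zeta w)) -> (forall w, ~ good w -> zeta w = eta w) ->
  measurable_fun setT zeta.
Proof.
move=> meta zc ze.
have mg : measurable good := measurable_unique_critical.
have cf1 : continuous (fst : R * R -> R) by move=> v; exact: cvg_fst.
have cf2 : continuous (snd : R * R -> R) by move=> v; exact: cvg_snd.
have key (f : R * R -> R) : continuous f ->
    measurable_fun setT (fun w => f (complex.Re (eta w), complex.Im (eta w)) : mR) ->
    measurable_fun setT (fun w => f (complex.Re (zeta w), complex.Im (zeta w)) : mR).
  move=> cf mf; apply: (measurability (@RGenCInfty.G R)).
    exact: RGenCInfty.measurableE.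
  move=> _ [_ [c ->] <-]; rewrite setTI.
  rewrite (_ : _ @^-1` _ = (good `&` [set w | exists2 z, crit w z & (c <= f (complex.Re z, complex.Im z))])
     `|` (~` good `&` [set w | c <= f (complex.Re (eta w), complex.Im (eta w))])).
    apply: measurableU; apply: measurableI => //.
    - by apply: (@measurable_critical_in [set v | c <= f v]); exact: closed_coord_ge.
    - exact: measurableC.
    - exact: measurable_set_le.
  apply/seteqP; split=> w /=; rewrite in_itv/= andbT.
    have [gw|nw] := pselect (good w).
      by move=> h; left; split=> //; exists (zeta w) => //; exact: zc.
    by rewrite ze//; right.
  move=> [[gw [z cz h]]|[nw]]; last by rewrite ze.
  by have [z0 [_ u0]] := gw; rewrite -(u0 _ (zc _ gw)) (u0 _ cz).
by apply: measurable_complex; [apply: (key fst)|apply: (key snd)] => //=;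
  [exact: measurableT_comp (@measurable_Re R) meta|exact: measurableT_comp (@measurable_Im R) meta].
Qed.

End measurable_critical_points.

(** * Events of high probability *)

Section likely.
Context d (T : measurableType d) (R : realType) (P : probability T R).

(* Convergence to one of the (inner) probability of E n; E n need not be measurable. *)
Definition likely (E : nat -> set T) : Prop := forall e : R, 0 < e ->
  \forall n \near \oo, exists2 B, measurable B /\ (P B <= e%:E)%E & ~` B `<=` E n.

Lemma likelyI E F : likely E -> likely F -> likely (fun n => E n `&` F n).
Proof.
move=> hE hF e e0; have e20 : 0 < e / 2 by rewrite divr_gt0.
have nE := hE _ e20; have nF := hF _ e20.
near=> n.
have [B [mB PB] BE] : exists2 B, measurable B /\ (P B <= (e / 2)%:E)%E & ~` B `<=` E n by near: n.
have [C [mC PC] CF] : exists2 B, measurable B /\ (P B <= (e / 2)%:E)%E & ~` B `<=` F n by near: n.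
exists (B `|` C).
  split; first exact: measurableU.
  apply: (le_trans (measureU2 P mB mC)).
  by rewrite (splitr e) EFinD leeD.
by rewrite setCU => w [nB nC]; split; [exact: BE|exact: CF].
Unshelve. all: by end_near. Qed.

Lemma likelyS E F : likely E -> (\forall n \near \oo, E n `<=` F n) -> likely F.
Proof.
move=> hE EF e e0; have nE := hE _ e0.
near=> n.
have [B mB BE] : exists2 B, measurable B /\ (P B <= e%:E)%E & ~` B `<=` E n by near: n.
exists B => //; apply: subset_trans BE _; near: n; exact: EF.
Unshelve. all: by end_near. Qed.

Lemma likely_cvg1 E : (forall n, measurable (E n)) -> likely E -> P (E n) @[n --> \oo] --> 1%E.
Proof.
move=> mE hE.
have fE n : P (E n) = (fine (P (E n)))%:E by rewrite fineK// fin_num_measure.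
under eq_fun do rewrite fE.
apply: cvg_EFin; first by near=> n.
apply/cvgrPdist_le => e e0; have nE := hE _ e0.
near=> n.
have [B [mB PB] BE] : exists2 B, measurable B /\ (P B <= e%:E)%E & ~` B `<=` E n by near: n.
have le1 : fine (P (E n)) <= 1 by rewrite -lee_fin -fE probability_le1.
rewrite ger0_norm ?subr_ge0// lerBlDr -lerBlDl -lee_fin EFinB -fE.
apply: (@le_trans _ _ (P (~` B))).
  by rewrite probability_setC// leeD2l// leeN2.
by apply: le_measure; rewrite ?inE//; exact: measurableC.
Unshelve. all: by end_near. Qed.

Lemma likely_markov (g : nat -> T -> R) (t m : nat -> R) :
  (forall n, bounded_measurable (g n)) -> (forall n w, 0 <= g n w) ->
  (\forall n \near \oo, 0 < t n /\ \int[P]_w g n w <= m n * t n) ->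
  m n @[n --> \oo] --> (0 : R) ->
  likely (fun n => [set w | g n w <= t n]).
Proof.
move=> bg g0 gt /cvgrPdist_le m0 e e0; have me := m0 _ e0.
near=> n.
have [t0 gm] : 0 < t n /\ \int[P]_w g n w <= m n * t n by near: n.
have mne : `|0 - m n| <= e by near: n.
have [mg _] := bg n.
exists [set w | t n < g n w]; last by move=> w /= /negP; rewrite -leNgt.
have mB : measurable [set w | t n < g n w] by exact: measurable_set_lt.
split=> //; have [p pE] : exists p, P [set w | t n < g n w] = p%:E.
  by exists (fine (P [set w | t n < g n w])); rewrite fineK// fin_num_measure.
have h : t n * p <= \int[P]_w g n w.
  rewrite -lee_fin /Rintegral fineK; last first.
    by apply: integrable_fin_num => //; exact: bounded_measurable_integrable.
  rewrite EFinM -pE -[in leLHS](setIT [set w | _]) -integral_indic//.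
  have mI : measurable_fun setT (fun w => (\1_[set w | t n < g n w] w)%:E : \bar R).
    by apply/measurable_EFinP; exact: measurable_indic.
  have tE0 : (0 <= (t n)%:E)%E by rewrite lee_fin ltW.
  rewrite -ge0_integralZl//.
  apply: ge0_le_integral => //.
  - by move=> w _; rewrite mule_ge0// lee_fin indicE.
  - exact: emeasurable_funM.
  - exact/measurable_EFinP.
  - move=> w _; rewrite -EFinM lee_fin indicE.
    have [/set_mem/= /ltW|_] := boolP (w \in _); first by rewrite mulr1.
    by rewrite mulr0.
rewrite pE lee_fin -(ler_pM2l t0) (le_trans h)// (le_trans gm)// mulrC ler_pM2l//.
by rewrite sub0r normrN in mne; exact: le_trans (ler_norm _) mne.
Unshelve. all: by end_near. Qed.

Local Notation mR := (measurableTypeR R).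
Local Notation V := (mR * mR)%type.
Variable nu : probability V R.

(** On the likely event the Lipschitz constant of the spline controls the difference; on the
    exceptional set it is at most twice the bound of the spline, times a small probability. *)
Lemma cvg_mean_slutsky (X Y : nat -> T -> V) c a b :
  (forall n, measurable_fun setT (X n)) -> (forall n, measurable_fun setT (Y n)) ->
  cvg_mean P X nu (spline2 c a b) ->
  (forall eta : R, 0 < eta -> likely (fun n => [set w |
     `|(X n w).1 - (Y n w).1| <= eta /\ `|(X n w).2 - (Y n w).2| <= eta])) ->
  cvg_mean P Y nu (spline2 c a b).
Proof.
move=> mX mY [bF cX] XY; split=> //.
have [k k0 bk] : exists2 k : R, 0 < k & forall x y,
    `|bspline x| <= k /\ `|bspline y - bspline x| <= k * `|y - x|.
  exists (3 * 100); first by rewrite mulr_gt0.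
  move=> x y; split; first by have [] := bspline_bounds x; lra.
  by have := taylor3_lipschitz x y (taylor3_bspline R); lra.
have bb x : `|bspline x| <= k by have [] := bk x x.
have lip (x y : R) : `|bspline y - bspline x| <= k * `|y - x| by have [] := bk x y.
pose L := 2 * k ^+ 2 * (`|c| + 1).
have L0 : 0 < L by rewrite !mulr_gt0 ?exprn_gt0// ltr_wpDl.
have lip2 v w eta : 0 <= eta -> `|v.1 - w.1| <= eta -> `|v.2 - w.2| <= eta ->
    `|spline2 c a b v - spline2 c a b w| <= L * eta.
  move=> eta0 h1 h2; rewrite /spline2.
  set p := bspline _; set q := bspline _; set p' := bspline _; set q' := bspline _.
  have -> : p * q - p' * q' = (p - p') * q + p' * (q - q') by ring.
  have l1 : `|p - p'| <= k * (`|c| * eta).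
    rewrite (le_trans (lip _ _))// ler_pM2l//.
    rewrite (_ : c * v.1 - a - (c * w.1 - a) = c * (v.1 - w.1)); last by ring.
    by rewrite normrM ler_wpM2l.
  have l2 : `|q - q'| <= k * (`|c| * eta).
    rewrite (le_trans (lip _ _))// ler_pM2l//.
    rewrite (_ : c * v.2 - b - (c * w.2 - b) = c * (v.2 - w.2)); last by ring.
    by rewrite normrM ler_wpM2l.
  rewrite (le_trans (ler_normD _ _))// !normrM.
  apply: (@le_trans _ _ (k * (`|c| * eta) * k + k * (k * (`|c| * eta)))).
    by apply: lerD; apply: ler_pM => //; exact: bb.
  rewrite (_ : _ + _ = 2 * k ^+ 2 * `|c| * eta); last by ring.
  apply: ler_wpM2r => //; apply: ler_wpM2l; last by rewrite lerDl.
  by rewrite mulr_ge0// sqr_ge0.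
have b2 v : `|spline2 c a b v| <= k ^+ 2.
  by rewrite /spline2 normrM expr2 ler_pM// bb.
have bc (Z : nat -> T -> V) n : (forall n, measurable_fun setT (Z n)) ->
    bounded_measurable (fun w => spline2 c a b (Z n w)).
  move=> mZ; split; last by exists (k ^+ 2).
  by have [mF _] := bF; exact: (measurableT_comp mF (mZ n)).
apply/cvgrPdist_le => e e0.
have e20 : 0 < e / 3 by rewrite divr_gt0.
move/cvgrPdist_le : cX => /(_ _ e20) cX.
have eta0 : 0 < e / 3 / L by rewrite divr_gt0.
have e40 : 0 < e / (6 * k ^+ 2) by rewrite divr_gt0// mulr_gt0// exprn_gt0.
have lk := XY _ eta0 _ e40.
near=> n.
have h1 : `|\int[nu]_v spline2 c a b v - \int[P]_w spline2 c a b (X n w)| <= e / 3 by near: n.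
have [B [mB PB] BE] : exists2 B, measurable B /\ (P B <= (e / (6 * k ^+ 2))%:E)%E &
   ~` B `<=` [set w | `|(X n w).1 - (Y n w).1| <= e / 3 / L /\
      `|(X n w).2 - (Y n w).2| <= e / 3 / L] by near: n.
have bX := bc X n mX; have bY := bc Y n mY.
have iX := bounded_measurable_integrable P bX; have iY := bounded_measurable_integrable P bY.
have bB : bounded_measurable (fun w => \1_B w : R).
  by split; [exact: measurable_indic|exists 1 => w; rewrite indicE ger0_norm// lern1 leq_b1].
have bU : bounded_measurable (fun w => e / 3 + (2 * k ^+ 2) * \1_B w).
  have [m1 [M hM]] := bB; split.
    by apply: measurable_funD => //; exact: measurable_funM.
  exists (e / 3 + 2 * k ^+ 2) => w; rewrite ger0_norm; last first.
    by rewrite addr_ge0 ?(ltW e20)// !mulr_ge0 ?exprn_ge0 ?(ltW k0)// indicE.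
  by rewrite lerD2l ler_piMr// ?mulr_ge0 ?exprn_ge0 ?(ltW k0)// indicE lern1 leq_b1.
have h2 : `|\int[P]_w spline2 c a b (X n w) - \int[P]_w spline2 c a b (Y n w)| <= 2 * (e / 3).
  rewrite -RintegralB//.
  have iD := bounded_measurable_integrable P (bounded_measurableB bX bY).
  apply: (le_trans (le_normr_Rintegral measurableT iD)).
  apply: (@le_trans _ _ (\int[P]_w (e / 3 + (2 * k ^+ 2) * \1_B w))).
    apply: le_Rintegral => //.
    - exact: integrable_norm.
    - exact: bounded_measurable_integrable bU.
    - move=> w _; have [Bw|nBw] := pselect (B w).
        rewrite indicE mem_set// mulr1 (le_trans (ler_normB _ _))//.
        rewrite (le_trans (lerD (b2 _) (b2 _)))// -mulr2n -[_ *+ 2]mulr_natl.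
        by rewrite lerDr ltW.
      rewrite indicE memNset// mulr0 addr0; have [w1 w2] := BE w nBw.
      by rewrite (le_trans (lip2 _ _ _ (ltW eta0) w1 w2))// mulrC divfK// gt_eqF.
  have iB := bounded_measurable_integrable P bB.
  have iZ : P.-integrable setT (EFin \o (fun w => (2 * k ^+ 2) * \1_B w)).
    exact: (integrableZl measurableT _ iB).
  have ic : P.-integrable setT (EFin \o (fun _ : T => e / 3)).
    by apply: bounded_measurable_integrable; exact: bounded_measurable_cst.
  rewrite (RintegralD measurableT ic iZ) (RintegralZl _ measurableT iB) Rintegral_prob_cst.
  have -> : \int[P]_w \1_B w = fine (P B).
    by rewrite /Rintegral integral_indic// setIT.
  have kE : 2 * k ^+ 2 * (e / (6 * k ^+ 2)) = e / 3 by field; rewrite gt_eqF.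
  have PB' : fine (P B) <= e / (6 * k ^+ 2) by rewrite -lee_fin fineK// fin_num_measure.
  rewrite (_ : 2 * (e / 3) = e / 3 + e / 3); last by ring.
  by rewrite lerD2l -[leRHS]kE ler_pM2l// mulr_gt0// exprn_gt0.
rewrite -(subrKA (\int[P]_w spline2 c a b (X n w))) (le_trans (ler_normD _ _))//.
by rewrite [leRHS](_ : e = e / 3 + 2 * (e / 3)); [exact: lerD|field].
Unshelve. all: by end_near. Qed.

(** Spline convergence passes to all bounded continuous functions, hence to the ramp [g] that
    vanishes on a square heavy for [nu] and equals 1 outside a slightly larger one; its mean bounds
    the escaping mass. *)
Lemma likely_tight (X : nat -> T -> V) (t : nat -> R) :
  (forall n, measurable_fun setT (X n)) ->
  (forall c a b, 0 < c -> cvg_mean P X nu (spline2 c a b)) ->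
  (forall K, \forall n \near \oo, K <= t n) ->
  likely (fun n => [set w | `|(X n w).1| <= t n /\ `|(X n w).2| <= t n]).
Proof.
move=> mX cX tn e e0; have e20 : 0 < e / 2 by rewrite divr_gt0.
have [K K0 nuK] := exists_heavy_square nu e20.
pose g (v : R * R) : R := Num.min (Num.max (Num.max `|v.1| `|v.2| - K) 0) 1.
have g0 v : 0 <= g v by rewrite le_min le_max lexx orbT ler01.
have g1 v : g v <= 1 by rewrite ge_min lexx orbT.
have cg : continuous g.
  move=> v; rewrite /continuous_at /g.
  apply: (@continuous_min _ (R * R)%type (fun v => Num.max (Num.max `|v.1| `|v.2| - K) 0) (cst 1)).
    apply: (@continuous_max _ (R * R)%type (fun v => Num.max `|v.1| `|v.2| - K) (cst 0)).
      apply: cvgB; last exact: cvg_cst.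
      apply: (@continuous_max _ (R * R)%type (fun v => `|v.1|) (fun v => `|v.2|)).
        by apply: cvg_norm; exact: cvg_fst.
      by apply: cvg_norm; exact: cvg_snd.
    exact: cvg_cst.
  exact: cvg_cst.
have gb v : `|g v| <= 1 by rewrite ger0_norm.
have [bg cgm] := cvg_mean_continuous mX cX cg gb.
move/cvgrPdist_le : cgm => /(_ _ e20) cgm.
near=> n.
have h1 : `|\int[nu]_v g v - \int[P]_w g (X n w)| <= e / 2 by near: n.
have tK : K + 1 <= t n by near: n; exact: tn.
pose G := [set w | `|(X n w).1| <= K + 1 /\ `|(X n w).2| <= K + 1].
have mp1 : measurable_fun setT (fun w => `|(X n w).1| : mR).
  apply: measurableT_comp => //; exact: measurableT_comp (@measurable_fst _ _ mR mR) (mX n).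
have mp2 : measurable_fun setT (fun w => `|(X n w).2| : mR).
  apply: measurableT_comp => //; exact: measurableT_comp (@measurable_snd _ _ mR mR) (mX n).
have mG : measurable G.
  rewrite (_ : G = [set w | `|(X n w).1| <= K + 1] `&` [set w | `|(X n w).2| <= K + 1])//.
  by apply: measurableI; exact: measurable_set_le.
exists (~` G); last by rewrite setCK => w [? ?]; split; exact: le_trans tK.
split; first exact: measurableC.
pose D : set V := ~` [set v | `|v.1| <= K /\ `|v.2| <= K].
have mD : measurable D.
  apply: measurableC.
  rewrite (_ : [set v | _] = [set v : V | `|v.1| <= K] `&` [set v : V | `|v.2| <= K])//.
  have m1 : measurable_fun setT (fun v : V => `|v.1| : mR).
    exact: (measurableT_comp (@normr_measurable R setT) (@measurable_fst _ _ mR mR)).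
  have m2 : measurable_fun setT (fun v : V => `|v.2| : mR).
    exact: (measurableT_comp (@normr_measurable R setT) (@measurable_snd _ _ mR mR)).
  by apply: measurableI; exact: measurable_set_le.
have bind d' (S : measurableType d') (A : set S) : measurable A ->
    bounded_measurable (fun w => \1_A w : R).
  by split; [exact: measurable_indic|exists 1 => w; rewrite indicE ger0_norm// lern1 leq_b1].
have h2 : \int[nu]_v g v <= e / 2.
  apply: le_trans nuK; rewrite -/D.
  have <- : \int[nu]_v \1_D v = fine (nu D) by rewrite /Rintegral integral_indic// setIT.
  apply: le_Rintegral => //.
  - exact: bounded_measurable_integrable.
  - by apply: bounded_measurable_integrable; exact: bind.
  - move=> v _; rewrite indicE; have [_|/negP vD] := boolP (v \in D); first exact: g1.
    have [v1 v2] : `|v.1| <= K /\ `|v.2| <= K.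
      by apply: contrapT => nv; apply: vD; exact: mem_set.
    rewrite /g ge_min ge_max lexx andbT; apply/orP; left.
    by rewrite subr_le0 ge_max v1.
have bgX : bounded_measurable (fun w => g (X n w)).
  by have [mg _] := bg; split; [exact: (measurableT_comp mg (mX n))|exists 1].
have mCG : measurable (~` G) by exact: measurableC.
have h3 : fine (P (~` G)) <= \int[P]_w g (X n w).
  have <- : \int[P]_w \1_(~` G) w = fine (P (~` G)) by rewrite /Rintegral integral_indic// setIT.
  apply: le_Rintegral => //.
  - by apply: bounded_measurable_integrable; exact: bind.
  - exact: bounded_measurable_integrable.
  - move=> w _; rewrite indicE; have [/set_mem nG|_] := boolP (w \in ~` G); last exact: g0.
    rewrite /g le_min lexx andbT le_max; apply/orP; left.
    rewrite lerBrDl leNgt gt_max; apply/negP => /andP[v1 v2]; apply: nG.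
    by split; exact: ltW.
rewrite -(fineK (fin_num_measure P _ mCG)) lee_fin.
move: h1; rewrite ler_norml => /andP[h1 _]; lra.
Unshelve. all: by end_near. Qed.

End likely.

(** * The critical point near the center *)

Section complex_inverse.
Context (R : realType).
Import Normc.
Implicit Types u z : R[i].

Lemma inv_to_plane u z :
  (u - z)^-1 = inv_re (to_plane u z) +i* inv_im (to_plane u z).
Proof. by case: u z => a b [c e]; rewrite /inv_re /inv_im /normsq. Qed.

Lemma normc_to_plane u z : normc (u - z) = Num.sqrt (normsq (to_plane u z)).
Proof. by case: u z => a b [c e]. Qed.

Lemma normc_inv_to_plane u z : normc (u - z)^-1 = inv_abs (to_plane u z).
Proof. by rewrite normcV normc_to_plane /inv_abs sqrtrV// normsq_ge0. Qed.

Lemma complex_sum n (F G : nat -> R) :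
  \sum_(k < n) (F k +i* G k) = (\sum_(k < n) F k) +i* (\sum_(k < n) G k).
Proof.
elim: n => [|n ih]; first by rewrite !big_ord0.
by rewrite !big_ord_recr/= ih.
Qed.

End complex_inverse.

(** * Sums over the random zeros *)

Section sampling.
Context (R : realType) d (T : measurableType d) (P : probability T R).
Local Notation mR := (measurableTypeR R).
Local Notation V := (mR * mR)%type.
Import Normc.
Variables (xi : nat -> {RV P >-> R[i]}) (u0 : R[i]) (delta : R) (p : R[i] -> R).
Hypothesis indX : mutually_independent xi.
Hypothesis idX : identically_distributed xi.
Let mu : probability R[i] R := distribution P (xi 0%N).
Hypothesis delta0 : 0 < delta.
Hypothesis hp : has_density_on (closed_disk u0 delta) mu p.
Hypothesis cp : {for u0, continuous (p : R[i]^o -> R)}.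
Local Notation toV := (to_plane u0).

Let mtoV : measurable_fun setT toV := measurable_to_plane u0.

Lemma Rintegral_sample (phi : R[i] -> R) k : bounded_measurable phi ->
  \int[P]_w phi (xi k w) = \int[mu]_z phi z.
Proof.
move=> bphi; have [mphi [M pM]] := bphi.
transitivity (\int[distribution P (xi k)]_z phi z).
  rewrite /Rintegral (@integral_distribution _ _ _ _ _ _ _ (EFin \o phi))//.
    exact/measurable_EFinP.
  apply: bounded_measurable_integrable; split; first exact: measurableT_comp.
  by exists M.
by rewrite /Rintegral; congr fine; apply: eq_measure_integral => A mA _; exact: idX.
Qed.

Lemma cauchy_stieltjesE : cauchy_stieltjes P (xi 0%N) u0 =
  (\int[mu]_z inv_re (toV z)) +i* (\int[mu]_z inv_im (toV z)).
Proof.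
have key (h : V -> R) : measurable_fun setT h -> (forall v, `|h v| <= inv_abs v) ->
    \int[P]_w h (toV (xi 0%N w)) = \int[mu]_z h (toV z).
  move=> mh hm; have ih := dominated_inv_integrable delta0 hp cp mh hm.
  rewrite /Rintegral (@integral_distribution _ _ _ _ _ _ _ (EFin \o (fun z => h (toV z))))//.
    by apply/measurable_EFinP; exact: (measurableT_comp mh mtoV).
  have /integrableP[mi fi] := ih; apply/integrableP; split.
    by apply: (measurableT_comp mi).
  move: fi; rewrite ge0_integral_distribution//.
  exact: measurableT_comp.
rewrite /cauchy_stieltjes /complex_expectation.
rewrite -(key _ (@measurable_inv_re R) (@inv_re_le R)).
rewrite -(key _ (@measurable_inv_im R) (@inv_im_le R)).
by congr (_ +i* _); apply: eq_Rintegral => w _; rewrite inv_to_plane.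
Qed.

(** The coordinates of (S_n(u0) - n f(u0)) / sqrt (n ln n). The index [n] sets both the scale of the
    steps and their number. *)
Definition inverse_walk n : T -> V :=
  walk xi (plane_shift (scaled_inv_re mu u0) (scaled_inv_im mu u0) n) (0, 0) n.

Let measurable_shift n :
  measurable_fun setT (plane_shift (scaled_inv_re mu u0) (scaled_inv_im mu u0) n).
Proof.
apply: measurable_plane_shift => m; apply: measurable_funM => //; apply: measurable_funB => //.
  exact: (measurableT_comp (@measurable_inv_re R) mtoV).
exact: (measurableT_comp (@measurable_inv_im R) mtoV).
Qed.

Lemma measurable_inverse_walk n : measurable_fun setT (inverse_walk n).
Proof. exact: measurable_walk. Qed.

Lemma inverse_sum_walk n w : 0 < scale R n ->
  inverse_sum n (fun k => xi k w) u0 - n%:R * cauchy_stieltjes P (xi 0%N) u0 =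
  (scale R n)%:C * ((inverse_walk n w).1 +i* (inverse_walk n w).2).
Proof.
move=> s0.
have wE m : walk xi (plane_shift (scaled_inv_re mu u0) (scaled_inv_im mu u0) n) (0, 0) m w =
    (\sum_(k < m) scaled_inv_re mu u0 n (xi k w), \sum_(k < m) scaled_inv_im mu u0 n (xi k w)).
  elim: m => [|m ih]; first by rewrite !big_ord0.
  by rewrite !big_ord_recr/= ih.
rewrite /inverse_walk wE/= /inverse_sum cauchy_stieltjesE.
have -> : \sum_(k < n) (u0 - xi k w)^-1 = (\sum_(k < n) inv_re (toV (xi k w))) +i*
    (\sum_(k < n) inv_im (toV (xi k w))).
  rewrite -(complex_sum n (fun k => inv_re (toV (xi k w))) (fun k => inv_im (toV (xi k w)))).
  by apply: eq_bigr => k _; rewrite inv_to_plane.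
have sE (h : V -> R) c : scale R n * \sum_(k < n) ((h (toV (xi k w)) - c) / scale R n) =
    \sum_(k < n) h (toV (xi k w)) - n%:R * c.
  rewrite mulr_sumr (eq_bigr (fun k : 'I_n => h (toV (xi k w)) - c)); last first.
    by move=> k _; rewrite mulrC divfK// gt_eqF.
  by rewrite sumrB sumr_const card_ord mulr_natl.
set a := \int[mu]_z inv_re _; set b := \int[mu]_z inv_im _.
have nC : (n%:R : R[i]) = (n%:R)%:C by rewrite rmorph_nat.
rewrite nC; apply/eqP; rewrite eq_complex /= !mul0r !subr0 !addr0.
by rewrite /scaled_inv_re /scaled_inv_im !sE !eqxx.
Qed.

Lemma inverse_walk_cvg_mean c a b : 0 < c ->
  cvg_mean P inverse_walk (gaussian_plane (pi * p u0 / 2)) (spline2 c a b).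
Proof.
move=> c0; split; first exact: bounded_measurable_spline2.
have E n : \int[P]_w spline2 c a b (inverse_walk n w) = iter n (averaging mu
    (plane_shift (scaled_inv_re mu u0) (scaled_inv_im mu u0) n)) (spline2 c a b) (0, 0).
  apply: (Rintegral_walk _ indX idX (measurable_shift n)).
  exact: bounded_measurable_spline2.
under eq_fun do rewrite E.
have t1 := taylor3_scale c a (ler0n R 100) (taylor3_bspline R).
have t2 := taylor3_scale c b (ler0n R 100) (taylor3_bspline R).
exact: (scaled_inverse_clt delta0 hp cp t1 t2 (fun x => bspline_ge0 _) (fun x => bspline_ge0 _)).
Qed.

Variable r : nat -> R.
Hypothesis r_gt0 : forall n, (0 < n)%N -> 0 < r n.
Hypothesis nr : n%:R * r n @[n --> \oo] --> +oo.
Hypothesis sqrtnr : Num.sqrt n%:R * r n @[n --> \oo] --> (0 : R).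

(** Union bound: n disks of mass at most C (2 r_n)^2 give 4 C (sqrt n r_n)^2, which tends to 0. *)
Lemma likely_isolated :
  likely P (fun n => [set w | forall k, (k < n)%N -> 2 * r n < normc (u0 - xi k w)]).
Proof.
have [C C0 HC] := disk_mass delta0 hp cp.
move=> e e0; have eC : 0 < Num.min 1 (e / (4 * C)) by rewrite lt_min ltr01 divr_gt0// mulr_gt0.
move/cvgrPdist_le : sqrtnr => /(_ _ eC) sq.
near=> n.
have n0 : (0 < n)%N by near: n; exact: nbhs_infty_gt.
have rn0 := r_gt0 n0.
have : `|0 - Num.sqrt n%:R * r n| <= Num.min 1 (e / (4 * C)) by near: n.
rewrite sub0r normrN ger0_norm ?mulr_ge0 ?sqrtr_ge0 ?(ltW rn0)// le_min => /andP[q1 q2].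
pose D := [set z | normsq (toV z) <= (2 * r n) ^+ 2].
have mD : measurable D.
  apply: measurable_set_le => //; exact: (measurableT_comp (@measurable_normsq R) mtoV).
have mA k : measurable (xi k @^-1` D).
  by rewrite -[X in measurable X]setTI; exact: measurable_funP.
exists (\big[setU/set0]_(k < n) (xi k @^-1` D)).
  split; first exact: bigsetU_measurable.
  apply: (le_trans (Boole_inequality P (A := fun k => xi k @^-1` D) (fun k _ => mA k))).
  apply: (@le_trans _ _ (\sum_(k < n) (C * (2 * r n) ^+ 2)%:E)%E).
    apply: lee_sum => k _; rewrite -[leLHS]/(distribution P (xi k) D) idX//.
    by apply: HC; rewrite mulr_gt0.
  rewrite sumEFin lee_fin sumr_const card_ord -[leLHS]mulr_natl.
  have -> : n%:R * (C * (2 * r n) ^+ 2) = 4 * C * (Num.sqrt n%:R * r n) ^+ 2.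
    by rewrite !exprMn sqr_sqrtr//; ring.
  rewrite mulrC -ler_pdivlMr ?mulr_gt0// (le_trans _ q2)//.
  by rewrite expr2 ler_piMr// mulr_ge0 ?sqrtr_ge0// ltW.
move=> w nw k kn; rewrite ltNge; apply/negP => h; apply: nw.
rewrite -(bigcup_mkord n (fun k => xi k @^-1` D)); exists k => //; rewrite /D/=.
move: h; rewrite normc_to_plane => h.
rewrite -(@ler_sqrt _ _ ((2 * r n) ^+ 2)) ?sqr_ge0// sqrtr_sqr ger0_norm// mulr_ge0// ltW//.
Unshelve. all: by end_near. Qed.

(** The squares have infinite mean unless truncated; on the event of [likely_isolated] the
    truncation at 2 r_n changes nothing. The truncated sum has mean O(n ln n), and Markov's
    inequality gains from the extra ln n in the threshold. *)
Lemma likely_square_sum : likely P (fun n => [set w |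
  \sum_(k < n) \1_(far u0 (2 * r n)) (xi k w) * inv_abs (toV (xi k w)) ^+ 2 <=
    n%:R * ln n%:R ^+ 2]).
Proof.
have [C2 C20 [a0 a00 H]] := far_sqr_le delta0 hp cp.
pose phi n (z : R[i]) : R := \1_(far u0 (2 * r n)) z * inv_abs (toV z) ^+ 2.
have bphi0 n : 0 < r n -> forall z, `|phi n z| <= (2 * r n)^-1 ^+ 2.
  move=> rn z; have p0 : 0 < 2 * r n by rewrite mulr_gt0.
  rewrite /phi indicE; have [/set_mem fz|_] := boolP (z \in _); last first.
    by rewrite mul0r normr0 sqr_ge0.
  rewrite mul1r ger0_norm ?sqr_ge0// lerXn2r ?nnegrE ?inv_abs_ge0 ?invr_ge0 ?(ltW p0)//.
  exact: inv_abs_le.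
have mphi n : measurable_fun setT (phi n).
  apply: measurable_funM; first by apply: measurable_indic; exact: measurable_far.
  apply: measurable_funX; exact: (measurableT_comp (@measurable_inv_abs R) mtoV).
have phi0 n z : 0 <= phi n z by rewrite mulr_ge0 ?sqr_ge0// indicE.
have bg n : bounded_measurable (fun w => \sum_(k < n) phi n (xi k w)).
  split.
    by apply: measurable_sum => k; exact: (measurableT_comp (mphi n)).
  case: n => [|n]; first by exists 0 => w; rewrite big_ord0 normr0.
  exists (\sum_(k < n.+1) (2 * r n.+1)^-1 ^+ 2) => w.
  rewrite (le_trans (ler_norm_sum _ _ _))//; apply: ler_sum => k _.
  by apply: bphi0; exact: r_gt0.
apply: (@likely_markov _ _ _ P (fun n w => \sum_(k < n) phi n (xi k w)) _
  (fun n => C2 / ln n%:R)) => //.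
- by move=> n w; apply: sumr_ge0.
- have a01 : 0 < Num.min 1 (a0 / 3) by rewrite lt_min ltr01 divr_gt0.
  move/cvgrPdist_le : sqrtnr => /(_ _ a01) sq.
  move/cvgryPge : nr => /(_ 1) nr1.
  near=> n.
  have n0 : (0 < n)%N by near: n; exact: nbhs_infty_gt.
  have n0R : 0 < n%:R :> R by rewrite ltr0n.
  have n1R : 1 <= n%:R :> R by rewrite ler1n.
  have rn0 := r_gt0 n0.
  have l1 : 1 <= ln n%:R :> R by near: n; exact: near_ln_ge.
  have nr1' : 1 <= n%:R * r n by near: n.
  have : `|0 - Num.sqrt n%:R * r n| <= Num.min 1 (a0 / 3) by near: n.
  rewrite sub0r normrN ger0_norm ?mulr_ge0 ?sqrtr_ge0 ?(ltW rn0)// le_min => /andP[_ q2].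
  have s1 : 1 <= Num.sqrt n%:R :> R by rewrite -[leLHS]sqrtr1 ler_sqrt.
  have rle : r n <= a0 / 3 by rewrite (le_trans _ q2)// ler_peMl// ltW.
  have l0 : 0 < ln n%:R :> R by rewrite (lt_le_trans ltr01).
  split; first by rewrite mulr_gt0// exprn_gt0.
  have bphi : bounded_measurable (phi n).
    by split => //; exists ((2 * r n)^-1 ^+ 2) => z; exact: bphi0.
  have -> : \int[P]_w (\sum_(k < n) phi n (xi k w)) = n%:R * \int[mu]_z phi n z.
    have gen m : \int[P]_w (\sum_(k < m) phi n (xi k w)) = m%:R * \int[mu]_z phi n z /\
        bounded_measurable (fun w => \sum_(k < m) phi n (xi k w)).
      elim: m => [|m [ih bm]].
        split; first by under eq_Rintegral do rewrite big_ord0; rewrite Rintegral_prob_cst mul0r.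
        rewrite (_ : (fun w => _) = cst 0); first exact: bounded_measurable_cst.
        by apply/funext => w; rewrite big_ord0.
      have bk : bounded_measurable (fun w => phi n (xi m w)).
        split; first exact: (measurableT_comp (mphi n)).
        by exists ((2 * r n)^-1 ^+ 2) => w; exact: bphi0.
      have E : (fun w => \sum_(k < m.+1) phi n (xi k w)) =
          (fun w => \sum_(k < m) phi n (xi k w) + phi n (xi m w)).
        by apply/funext => w; rewrite big_ord_recr.
      rewrite E; split.
        rewrite RintegralD//; [|exact: bounded_measurable_integrable..].
        by rewrite ih Rintegral_sample// -natr1 mulrDl mul1r.
      have := bounded_measurableB bm (bounded_measurableB (bounded_measurable_cst T 0) bk).
      by congr bounded_measurable; apply/funext => w /=; rewrite sub0r opprK.
    by have [] := gen n.
  have -> : \int[mu]_z phi n z = \int[mu]_(z in far u0 (2 * r n)) (inv_abs (toV z) ^+ 2).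
    rewrite [RHS]Rintegral_mkcond; apply: eq_Rintegral => z _.
    by rewrite /phi patchE indicE; case: ifP; rewrite ?mul1r ?mul0r.
  have r20 : 0 < 2 * r n by rewrite mulr_gt0.
  have r2a : 2 * r n < a0.
    by have := rle; rewrite ler_pdivlMr//; have := rn0; lra.
  have Hn := H _ r20 r2a.
  (* From n r_n >= 1: the truncation radius is not smaller than 1 / n, so its logarithm costs at
     most ln n. *)
  have lnr : - ln (2 * r n) <= ln n%:R.
    rewrite -lnV ?posrE// ler_ln ?posrE ?invr_gt0//.
    by rewrite -[leRHS]invrK lef_pV2 ?posrE ?invr_gt0// -[leLHS]mulr1 ler_pdivrMl//; move: nr1'; lra.
  rewrite (_ : C2 / ln n%:R * (n%:R * ln n%:R ^+ 2) = n%:R * (C2 * ln n%:R)); last first.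
    by field; rewrite gt_eqF.
  by rewrite ler_pM2l// (le_trans Hn)// ler_pM2l.
- apply/cvgrPdist_le => e e0; near=> n.
  have lK : C2 / e <= ln n%:R :> R by near: n; exact: near_ln_ge.
  have l0 : 0 < ln n%:R :> R by rewrite (lt_le_trans _ lK)// divr_gt0.
  rewrite sub0r normrN ger0_norm ?divr_ge0 ?(ltW C20) ?(ltW l0)//.
  by rewrite ler_pdivrMr// mulrC -ler_pdivrMr.
Unshelve. all: by end_near. Qed.

End sampling.

Section near_ln_cube.
Context (R : realType).

(** One term of the exponential series at l = ln n gives n >= l^7 / 7!, which exceeds M^2 l^6 once l
    >= 7! M^2. *)
Lemma near_ln_cube (M : R) : \forall n \near \oo, M * ln n%:R ^+ 3 <= Num.sqrt n%:R.
Proof.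
near=> n.
have n0 : 0 < n%:R :> R by near: n; exact: nbhs_infty_gtr.
have l1 : 1 <= ln n%:R :> R by near: n; exact: near_ln_ge.
have lM : 7`!%:R * M ^+ 2 <= ln n%:R by near: n; exact: near_ln_ge.
set l := ln n%:R in l1 lM *; have l0 : 0 <= l by rewrite (le_trans ler01).
have f0 : 0 < 7`!%:R :> R by rewrite ltr0n fact_gt0.
rewrite (le_trans (ler_norm _))// -sqrtr_sqr ler_sqrt ?(ltW n0)//.
have h := expR_ge1Dxn 6 l0; rewrite lnK ?posrE// in h.
have {}h : l ^+ 7 / 7`!%:R <= n%:R by apply: le_trans h; rewrite lerDr.
apply: le_trans h.
rewrite ler_pdivlMr// exprMn -exprM (_ : (3 * 2 = 6)%N)// (exprS l 6).
by rewrite mulrAC ler_wpM2r ?exprn_ge0// mulrC.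
Unshelve. all: by end_near. Qed.

End near_ln_cube.

(** * Linearization of the normalized critical point *)

Section linearization.
Context (R : realType).
Import Normc.
(** The deterministic core. [phi] is f(u0), [S] and [S0] are S_n at the critical point and at u0,
    [W] is the scaled walk, l = ln n, c = sqrt (n / l), s = sqrt (n l), and [Q] is the sum of
    squared inverse distances. *)
Variables (phi S S0 W : R[i]) (n l c s Q : R).
Hypotheses (phi0 : phi != 0) (n1 : 1 <= n) (l1 : 1 <= l).
Hypotheses (cn : 0 <= c) (cx : c <= Num.sqrt n) (s0 : 0 <= s) (sx : s <= Num.sqrt n * l).
Hypothesis cs : c * s = n.
Hypothesis SW : S0 - n%:C * phi = s%:C * W.
Hypothesis Wl : normc W <= 2 * l.
Hypothesis Sge : n * normc phi / 2 <= normc S.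
Hypothesis SS0 : normc (S - S0) <= 4 * Q / (n * normc phi).
Hypothesis Ql : Q <= n * l ^+ 2.

Let f := normc phi.

Let n0 : 0 < n. Proof. exact: lt_le_trans ltr01 n1. Qed.

Let f0 : 0 < f. Proof. by rewrite normc_gt0. Qed.

Let x := Num.sqrt n.

Let x0 : 0 < x. Proof. by rewrite sqrtr_gt0. Qed.

Let nE : n = x ^+ 2. Proof. by rewrite sqr_sqrtr// ltW. Qed.

Let normc_real (t : R) : 0 <= t -> normc t%:C = t.
Proof. by move=> t0; rewrite normc_ReIm /= expr0n/= addr0 sqrtr_sqr ger0_norm. Qed.

(** The normalized quantity is phi c (S - n phi) / S. Splitting S - n phi into S - S0 and s W, and
    using c s = n, its main part n phi W / S differs from W by W (S - n phi) / S. Both errors are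
    small because S has size n. *)
Lemma linearization_error :
  normc (phi ^+ 2 * c%:C * (n%:C * - S^-1 + phi^-1) - W) <=
  (16 / f + 16 / f ^+ 2) * (l ^+ 3 / x).
Proof.
have S0' : S != 0.
  by rewrite -normc_gt0 (lt_le_trans _ Sge)// divr_gt0// mulr_gt0.
have nC : n%:C = c%:C * s%:C by rewrite -rmorphM cs.
have -> : phi ^+ 2 * c%:C * (n%:C * - S^-1 + phi^-1) - W =
    phi * c%:C * S^-1 * (S - S0) - S^-1 * (S - S0 + s%:C * W) * W.
  have E : S0 = n%:C * phi + s%:C * W by rewrite -SW addrC subrK.
  rewrite E nC; field; rewrite phi0 S0' //.
have l0 : 0 <= l by rewrite (le_trans ler01).
have d1 : normc (S - S0) <= 4 * l ^+ 2 / f.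
  rewrite (le_trans SS0)// ler_pdivrMr ?mulr_gt0//.
  rewrite (_ : 4 * l ^+ 2 / f * (n * normc phi) = 4 * (n * l ^+ 2)) ?ler_pM2l//.
  by rewrite -/f; field; rewrite gt_eqF.
have d2 : normc S^-1 <= 2 / (n * f).
  rewrite normcV -[leRHS]invf_div lef_pV2 ?posrE ?divr_gt0 ?mulr_gt0//.
  by rewrite normc_gt0.
have d3 : normc (s%:C * W) <= 2 * (x * l ^+ 2).
  rewrite normcM normc_real// (_ : 2 * _ = x * l * (2 * l)); last by ring.
  by rewrite ler_pM ?normc_ge0.
have d4 : normc (S - S0 + s%:C * W) <= 4 * l ^+ 2 / f + 2 * (x * l ^+ 2).
  by rewrite (le_trans (normc_triangle _ _))// lerD.
rewrite (le_trans (normc_triangle _ _))// normc_opp !normcM normc_real//.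
have l2 : 0 <= 4 * l ^+ 2 / f by rewrite divr_ge0 ?mulr_ge0 ?sqr_ge0// ltW.
have p1 : normc phi * c * normc S^-1 * normc (S - S0) <= f * x * (2 / (n * f)) * (4 * l ^+ 2 / f).
  by do 2 (apply: ler_pM; rewrite ?mulr_ge0 ?normc_ge0//); rewrite ler_pM ?normc_ge0.
have p2 : normc S^-1 * normc (S - S0 + s%:C * W) * normc W <=
    2 / (n * f) * (4 * l ^+ 2 / f + 2 * (x * l ^+ 2)) * (2 * l).
  by do 2 (apply: ler_pM; rewrite ?mulr_ge0 ?normc_ge0//).
rewrite (le_trans (lerD p1 p2))// nE.
have -> : f * x * (2 / (x ^+ 2 * f)) * (4 * l ^+ 2 / f) +
  2 / (x ^+ 2 * f) * (4 * l ^+ 2 / f + 2 * (x * l ^+ 2)) * (2 * l) =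
  8 / f * (l ^+ 2 / x) + 16 / f ^+ 2 * (l ^+ 3 / x ^+ 2) + 8 / f * (l ^+ 3 / x).
  by field; rewrite !gt_eqF.
have x1 : 1 <= x by rewrite -[leLHS]sqrtr1 ler_sqrt// ltW.
have xi0 : 0 <= x^-1 by rewrite invr_ge0 ltW.
have q1 : l ^+ 2 / x <= l ^+ 3 / x.
  by rewrite ler_wpM2r// exprS ler_peMl// sqr_ge0.
have q2 : l ^+ 3 / x ^+ 2 <= l ^+ 3 / x.
  rewrite ler_wpM2l ?exprn_ge0// lef_pV2 ?posrE ?exprn_gt0//.
  by rewrite expr2 ler_peMl// ltW.
have g1 : 8 / f * (l ^+ 2 / x) <= 8 / f * (l ^+ 3 / x) by rewrite ler_wpM2l// divr_ge0// ltW.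
have g2 : 16 / f ^+ 2 * (l ^+ 3 / x ^+ 2) <= 16 / f ^+ 2 * (l ^+ 3 / x).
  by rewrite ler_wpM2l// divr_ge0// exprn_ge0// ltW.
lra.
Qed.

End linearization.

Section critical_point_clt.
Context (R : realType) d (T : measurableType d) (P : probability T R).
Local Notation mR := (measurableTypeR R).
Local Notation V := (mR * mR)%type.
Import Normc.
Variables (xi : nat -> {RV P >-> R[i]}) (u0 : R[i]) (delta : R) (p : R[i] -> R).
Variable r : nat -> R.
Hypothesis indX : mutually_independent xi.
Hypothesis idX : identically_distributed xi.
Hypothesis delta0 : 0 < delta.
Hypothesis hp : has_density_on (closed_disk u0 delta) (distribution P (xi 0%N)) p.
Hypothesis cp : {for u0, continuous (p : R[i]^o -> R)}.
Let phi := cauchy_stieltjes P (xi 0%N) u0.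
Hypothesis phi0 : phi != 0.
Hypothesis r_gt0 : forall n, (0 < n)%N -> 0 < r n.
Hypothesis nr : n%:R * r n @[n --> \oo] --> +oo.
Hypothesis sqrtnr : Num.sqrt n%:R * r n @[n --> \oo] --> (0 : R).

Let crit n w := critical_in_disk (poly_with_zeros u0 (fun k => xi k w) n) u0 (r n).
Let W n w : R[i] := (inverse_walk xi u0 n w).1 +i* (inverse_walk xi u0 n w).2.
Let V_ n (z : R[i]) : R[i] :=
  phi ^+ 2 * (Num.sqrt (n%:R / ln n%:R))%:C * (n%:R * (z - u0) + phi^-1).

(** All randomness sits in three likely events: isolated zeros, the bound on the squares, and a walk
    of size at most ln n. On their intersection the argument is deterministic for large [n]. *)
Lemma likely_linearized (eta : R) : 0 < eta -> likely P (fun n => [set w |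
  (exists! z, crit n w z) /\ forall z, crit n w z -> normc (W n w - V_ n z) <= eta]).
Proof.
move=> eta0; have f0 : 0 < normc phi by rewrite normc_gt0.
set f := normc phi in f0.
have tW := likely_tight (@measurable_inverse_walk _ _ _ _ xi u0)
  (fun c a b => inverse_walk_cvg_mean indX idX delta0 hp cp a b) (@near_ln_ge R).
have ev := likelyI (likelyI (likely_isolated idX delta0 hp cp r_gt0 sqrtnr)
  (likely_square_sum idX delta0 hp cp r_gt0 nr sqrtnr)) tW.
apply: (likelyS ev).
move/cvgrPdist_le : sqrtnr => /(_ 1 ltr01) sq.
move/cvgryPge : nr => /(_ (4 / f)) nrf.
near=> n => w [[iso]]; rewrite /mkset => Qle [W1 W2].
have n0 : (0 < n)%N by near: n; exact: nbhs_infty_gt.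
have n1 : 1 <= n%:R :> R by rewrite ler1n.
have nR0 : 0 < n%:R :> R by rewrite ltr0n.
have rn0 := r_gt0 n0.
have l1 : 1 <= ln n%:R :> R by near: n; exact: near_ln_ge.
have nrf' : 4 / f <= n%:R * r n by near: n.
have : `|0 - Num.sqrt n%:R * r n| <= 1 by near: n.
rewrite sub0r normrN ger0_norm ?mulr_ge0 ?sqrtr_ge0 ?(ltW rn0)// => xr.
(* [M1] yields the hypotheses of the contraction argument, [M2] brings the linearization error below
   [eta]. *)
have M1 : 8 / f * ln n%:R ^+ 3 <= Num.sqrt n%:R :> R by near: n; exact: near_ln_cube.
have M2 : (16 / f + 16 / f ^+ 2) / eta * ln n%:R ^+ 3 <= Num.sqrt n%:R :> R.
  by near: n; exact: near_ln_cube.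
set l := ln n%:R in l1 M1 M2 W1 W2 Qle *; set x := Num.sqrt n%:R in xr M1 M2 *.
have l0 : 0 < l by rewrite (lt_le_trans ltr01).
have x0 : 0 < x by rewrite sqrtr_gt0.
have xx : x ^+ 2 = n%:R by rewrite sqr_sqrtr// ltW.
have s2 := @scale_sqr R n (ltW l0); rewrite -/l in s2.
have s0 : 0 < scale R n by rewrite sqrtr_gt0 mulr_gt0.
have sx : scale R n <= x * l.
  rewrite -(@ler_pXn2r _ 2)// ?nnegrE ?mulr_ge0 ?(ltW s0) ?(ltW x0) ?(ltW l0)//.
  by rewrite s2 exprMn xx ler_pM2l// expr2 ler_peMl// ltW.
have M1' : 8 * l ^+ 2 <= x * f.
  rewrite -ler_pdivrMr// (le_trans _ M1)// mulrAC ler_wpM2l// ?divr_ge0 ?(ltW f0)//.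
  by rewrite exprS ler_peMl// sqr_ge0.
have WE := @inverse_sum_walk _ _ _ P xi u0 delta p delta0 hp cp n w s0.
rewrite -/phi -/(W n w) in WE.
have Wl : normc (W n w) <= 2 * l.
  by rewrite (le_trans (normc_le_ReIm _))//=; rewrite /W/=; lra.
pose y k := xi k w.
have QE : \sum_(k < n) \1_(far u0 (2 * r n)) (xi k w) * inv_abs (to_plane u0 (xi k w)) ^+ 2 =
    inverse_square_sum n y u0.
  apply: eq_bigr => k _; rewrite indicE mem_set ?mul1r -?normc_inv_to_plane//.
  have := iso k (ltn_ord k); rewrite normc_to_plane => h.
  rewrite /far/= -(@ler_sqrt _ _ (normsq _)) ?normsq_ge0// sqrtr_sqr ger0_norm ?ltW//.
  by rewrite mulr_gt0.
rewrite QE in Qle.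
pose F := n%:R * f.
have nC : (n%:R : R[i]) = (n%:R)%:C by rewrite rmorph_nat.
have cR (t : R) : 0 <= t -> normc t%:C = t.
  by move=> t0; rewrite normc_ReIm /= expr0n/= addr0 sqrtr_sqr ger0_norm.
(* The deviation from n f(u0) is s |W| <= 2 sqrt n l^2, which [M1'] bounds by F / 4. *)
have SF : 3 / 4 * F <= normc (inverse_sum n y u0).
  have := normc_triangle (inverse_sum n y u0) (n%:R * phi - inverse_sum n y u0).
  rewrite subrKC [normc (_ - inverse_sum _ _ _)]normc_distC WE !normcM nC !cR//; last exact: ltW.
  rewrite -/f -/F => h.
  have : scale R n * normc (W n w) <= x * l * (2 * l).
    by rewrite ler_pM ?normc_ge0// ltW.
  have : x * (8 * l ^+ 2) <= x * (x * f) by rewrite ler_pM2l.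
  rewrite /F -xx in h *; rewrite !expr2 in h *; lra.
have rF : 4 <= r n * F.
  by move: nrf'; rewrite ler_pdivrMr// /F; lra.
(* With sqrt n r_n <= 1 the left side is at most sqrt n l^2, which [M1'] bounds by F / 8. *)
have rQ : r n * inverse_square_sum n y u0 <= F / 8.
  apply: (@le_trans _ _ (r n * (n%:R * l ^+ 2))); first by rewrite ler_pM2l.
  have h1 : x * r n * (x * (8 * l ^+ 2)) <= 1 * (x * (x * f)).
    apply: ler_pM => //; last by rewrite ler_pM2l.
      by rewrite mulr_ge0// ltW.
    by rewrite mulr_ge0 ?(ltW x0)// mulr_ge0// sqr_ge0.
  by rewrite /F -xx; rewrite !expr2 in h1 *; lra.
split; first exact: (unique_critical_in_disk rn0 iso SF rQ rF).
move=> z cz.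
have [_ zu Sge SS0] := critical_in_disk_dist rn0 iso SF rQ rF cz.
have li0 : 0 <= l^-1 by rewrite invr_ge0 ltW.
rewrite normc_distC /V_ zu nC.
apply: (@le_trans _ _ ((16 / f + 16 / f ^+ 2) * (l ^+ 3 / x))).
  apply: (linearization_error (s := scale R n) (S0 := inverse_sum n y u0)
    (Q := inverse_square_sum n y u0)) => //.
  - by rewrite ler_sqrt ?(ltW nR0)// ler_piMr ?(ltW nR0)// invf_le1.
  - exact: ltW.
  - rewrite /scale -/l -sqrtrM ?divr_ge0 ?(ltW nR0) ?(ltW l0)//.
    rewrite (_ : n%:R / l * (n%:R * l) = n%:R ^+ 2); last by field; rewrite gt_eqF.
    by rewrite sqrtr_sqr ger0_norm// ltW.
  - by rewrite -nC.
move: M2; set K := 16 / f + _ => M2.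
have -> : K * (l ^+ 3 / x) = eta * (K / eta * l ^+ 3) / x by field; rewrite !gt_eqF.
by rewrite ler_pdivrMr// ler_pM2l.
Unshelve. all: by end_near. Qed.

Lemma critical_point_probability :
  (forall n, measurable [set w | exists! z, crit n w z]) /\
  P [set w | exists! z, crit n w z] @[n --> \oo] --> 1%E.
Proof.
have mg n : measurable [set w | exists! z, crit n w z].
  by apply: (measurable_unique_critical (xi := fun k => xi k)) => k.
split=> //; apply: likely_cvg1 => //.
by apply: (likelyS (likely_linearized ltr01)); apply: nearW => n w [].
Qed.

(** Slutsky's argument transfers the spline limits from the walk to the normalized critical point,
    since the two are close with high probability. The values of [eta] matter only for
    measurability, as they are used on an event of vanishing probability. *)
Lemma critical_point_weak_limit (eta : nat -> {RV P >-> R[i]}) (zeta : nat -> T -> R[i]) :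
  (forall n w, (exists! z, crit n w z) -> crit n w (zeta n w)) ->
  (forall n w, ~ (exists! z, crit n w z) -> zeta n w = eta n w) ->
  (forall n, measurable_fun setT (zeta n)) /\
  cvg_in_distribution P (fun n w => V_ n (zeta n w)) (complex_normal (pi * p u0)).
Proof.
move=> zc ze.
have mz n : measurable_fun setT (zeta n).
  apply: (@measurable_critical_choice R _ T (fun k => xi k) n u0 (r n) _ (eta n)) => //.
  - by move=> w gw; exact: zc.
  - by move=> w gw; exact: ze.
split=> // g cg [M gM].
have mV n : measurable_fun setT (fun w => V_ n (zeta n w)).
  rewrite /V_; apply: measurable_complexM => //.
  apply: measurable_complexD => //; apply: measurable_complexM => //.
  exact: measurable_complexD.
have mVp n : measurable_fun setT (fun w => reim (V_ n (zeta n w))).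
  exact: (measurableT_comp (@measurable_reim R)).
have wc := fun c a b (c0 : 0 < c) => inverse_walk_cvg_mean indX idX delta0 hp cp a b c0.
have lim c a b : 0 < c -> cvg_mean P (fun n w => reim (V_ n (zeta n w)))
    (gaussian_plane (pi * p u0 / 2)) (spline2 c a b).
  move=> c0; apply: (cvg_mean_slutsky (@measurable_inverse_walk _ _ _ _ xi u0) mVp (wc c a b c0)).
  move=> e e0; apply: (likelyS (likely_linearized e0)); apply: nearW => n w [gw h].
  have hv := h _ (zc _ _ gw).
  have reimB (x y : R[i]) : complex.Re (x - y) = complex.Re x - complex.Re y /\
      complex.Im (x - y) = complex.Im x - complex.Im y by case: x y => a' b' [].
  have [rB iB] := reimB (W n w) (V_ n (zeta n w)).
  split; apply: le_trans hv.
    by apply: le_trans (Re_le_normc _); rewrite rB.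
  by apply: le_trans (Im_le_normc _); rewrite iB.
have cgp : continuous ((fun v => g (v.1 +i* v.2)) : R * R -> R).
  move=> v; apply: (@continuous_comp _ R[i]^o R (fun v : R * R => v.1 +i* v.2) g).
    exact: continuous_of_reim.
  exact: cg.
have [[mgp _] cgm] := cvg_mean_continuous mVp lim cgp (fun v => gM _).
have mg : measurable_fun setT g.
  rewrite (_ : g = (fun v : V => g (v.1 +i* v.2)) \o (@reim R)).
    exact: (measurableT_comp mgp (@measurable_reim R)).
  by apply/funext => -[a b].
have -> : \int[complex_normal (pi * p u0)]_z g z =
    \int[gaussian_plane (pi * p u0 / 2)]_v g (v.1 +i* v.2).
  rewrite /complex_normal /Rintegral.
  rewrite (@integral_distribution _ _ _ _ _ _ _ (EFin \o g))//.
    exact/measurable_EFinP.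
  apply: bounded_measurable_integrable; split; first exact: mgp.
  by exists M => v; exact: gM.
apply: cvg_trans cgm; apply: near_eq_cvg; near=> n.
by apply: eq_Rintegral => w _; case: (V_ n (zeta n w)).
Unshelve. all: by end_near. Qed.

End critical_point_clt.

Theorem theorem2p2 (R : realType) (d : measure_display) (T : measurableType d)
    (P : probability T R) (xi : nat -> {RV P >-> R[i]}) (u0 : R[i])
    (delta : R) (p : R[i] -> R) (r : nat -> R) :
  mutually_independent xi ->
  identically_distributed xi ->
  0 < delta ->
  has_density_on (closed_disk u0 delta) (distribution P (xi 0%N)) p ->
  {for u0, continuous (p : R[i]^o -> R)} ->
  let f := cauchy_stieltjes P (xi 0%N) in
  f u0 != 0 ->
  (forall n, (0 < n)%N -> 0 < r n) ->
  n%:R * r n @[n --> \oo] --> +oo ->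
  Num.sqrt n%:R * r n @[n --> \oo] --> (0 : R) ->
  let crit n (w : T) :=
    critical_in_disk (poly_with_zeros u0 (fun k => xi k w) n) u0 (r n) in
  let good n := [set w | exists! z, crit n w z] in
  ((forall n, measurable (good n)) /\ P (good n) @[n --> \oo] --> 1%E) /\
  (forall (eta : nat -> {RV P >-> R[i]}) (zeta : nat -> T -> R[i]),
    (forall n w, good n w -> crit n w (zeta n w)) ->
    (forall n w, ~ good n w -> zeta n w = eta n w) ->
    (forall n, measurable_fun setT (zeta n)) /\
    cvg_in_distribution P
      (fun n w => f u0 ^+ 2 * (Num.sqrt (n%:R / ln n%:R))%:C *
                  (n%:R * (zeta n w - u0) + (f u0)^-1))
      (complex_normal (pi * p u0))).
Proof.
move=> indX idX delta0 hp cp f f0 r0 nr sqrtnr crit good.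
split; first exact: (critical_point_probability indX idX delta0 hp cp f0 r0 nr sqrtnr).
move=> eta zeta zc ze.
exact: (critical_point_weak_limit indX idX delta0 hp cp f0 r0 nr sqrtnr zc ze).
Qed.
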